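(* Let $n,d\ge 1$ be integers, let $\Delta=\{(t,s)\in\mathbb{R}^2: 0\le s\le t<+\infty\}$, let $H:\Delta\to\mathbb{R}^{n\times n}$ be continuous, and let $B=(B_1,\dots,B_d)$ be a $d$-dimensional vector of mutually independent standard Brownian motions. Then the following statements are equivalent: (A) There exists $H_\infty\in C([0,\infty);\mathbb{R}^{n\times n})$ such that $\int_0^\infty \|H_\infty(s)\|^2\,ds<+\infty$ and $$\lim_{t\to\infty}\int_0^t \|H(t,s)-H_\infty(s)\|^2\,ds=0.$$ (B) There exists $H_\infty\in C([0,\infty);\mathbb{R}^{n\times n})$ such that for each $f\in BC([0,\infty);\mathbb{R}^{n\times d})$, $$\lim_{t\to\infty}\mathbb{E}\left[\left\|\int_0^t H(t,s)f(s)\,dB(s)-\int_0^\infty H_\infty(s)f(s)\,dB(s)\right\|^2\right]=0.$$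
   Context: $C([0,\infty);\mathbb{R}^{n\times n})$ is the space of continuous $\mathbb{R}^{n\times n}$-valued functions on $[0,\infty)$, and $BC([0,\infty);\mathbb{R}^{n\times d})$ is the space of bounded continuous $\mathbb{R}^{n\times d}$-valued functions on $[0,\infty)$. $\|\cdot\|$ denotes the Euclidean norm on vectors and the Frobenius norm on matrices. $H$ and $f$ are deterministic; for each fixed $t$, $\int_0^t H(t,s)f(s)\,dB(s)$ is the $\mathbb{R}^n$-valued It\^o integral (with respect to the natural filtration of $B$) of the deterministic integrand $s\mapsto H(t,s)f(s)$. In (B), it is implicit in the statement that the stochastic integral $\int_0^\infty H_\infty(s)f(s)\,dB(s)$, i.e. the almost sure limit of $\int_0^T H_\infty(s)f(s)\,dB(s)$ as $T\to\infty$, exists for every $f\in BC([0,\infty);\mathbb{R}^{n\times d})$. *)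

(* Defs.v *)
From HB Require Import structures.
From mathcomp Require Import all_boot all_order all_algebra.
From mathcomp Require Import finmap.
From mathcomp Require Import all_classical all_reals all_analysis.

Set Implicit Arguments.
Unset Strict Implicit.
Unset Printing Implicit Defensive.

Import Order.TTheory GRing.Theory Num.Theory.
Import numFieldNormedType.Exports.

Local Open Scope classical_set_scope.
Local Open Scope ring_scope.

(* The library's norm on matrices is the maximum norm (same topology).
   On column vectors this is the Euclidean norm. *)
Definition frobenius (R : realType) (m n : nat) (A : 'M[R]_(m, n)) : R :=
  Num.sqrt (\sum_i \sum_j A i j ^+ 2).

(* Functions on [0, +oo[ are represented by functions on R whose values at
   negative arguments are irrelevant. *)
Definition continuous_half_line (R : realType) (m n : nat)
    (f : R -> 'M[R]_(m, n)) : Prop :=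
  {within `[0, +oo[%classic, continuous f}.

Definition bounded_continuous_half_line (R : realType) (m n : nat)
    (f : R -> 'M[R]_(m, n)) : Prop :=
  continuous_half_line f /\
  exists K : R, forall s : R, 0 <= s -> frobenius (f s) <= K.

Definition triangle (R : realType) : set (R * R) :=
  [set p | 0 <= p.2 /\ p.2 <= p.1].

Definition sigma_generated (d : measure_display) (Omega : measurableType d)
    (R : realType) (I : Type) (D : set I) (X : I -> Omega -> R) :
    set (set Omega) :=
  <<s \bigcup_(i in D) preimage_set_system setT (X i) measurable >>.

Definition measurable_wrt (Omega : Type) (R : realType)
    (F : set (set Omega)) (X : Omega -> R) : Prop :=
  preimage_set_system setT X measurable `<=` F.

Section probability_space.
Context (d0 : measure_display) (Omega : measurableType d0) (R : realType).
Variable P : probability Omega R.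

Definition mutually_independent (I : choiceType) (F : I -> set (set Omega)) :
    Prop :=
  forall (J : {fset I}) (E : I -> set Omega),
    (forall i, i \in J -> F i (E i)) ->
    P (\bigcap_(i in [set` J]) E i) = (\prod_(i <- J) fine (P (E i)))%:E.

Definition independent (F G : set (set Omega)) : Prop :=
  forall A C, F A -> G C -> P (A `&` C) = (P A * P C)%E.

(* The second parameter of normal_prob is the standard deviation. *)
Definition standard_brownian_motion (W : R -> {RV P >-> R}) : Prop :=
  [/\ {ae P, forall w, W 0 w = 0},
      forall s t : R, 0 <= s -> s < t -> forall C : set R, measurable C ->
        P ((fun w => W t w - W s w) @^-1` C) =
        normal_prob 0 (Num.sqrt (t - s)) C,
      forall s t : R, 0 <= s -> s < t ->
        independent
          (sigma_generated [set u | 0 <= u /\ u <= s] (fun u => W u))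
          (preimage_set_system setT (fun w => W t w - W s w) measurable) &
      {ae P, forall w, {within `[0, +oo[%classic, continuous (fun t => W t w)}}].

Section ito.
Variables (n d : nat) (B : 'I_d -> R -> {RV P >-> R}).

Definition brownian_motion : Prop :=
  (forall j, standard_brownian_motion (B j)) /\
  mutually_independent
    (fun j => sigma_generated [set u | 0 <= u] (fun u => B j u)).

Definition natural_filtration (t : R) : set (set Omega) :=
  sigma_generated [set ju : 'I_d * R | 0 <= ju.2 /\ ju.2 <= t]
                  (fun ju => B ju.1 ju.2).

(* The process \sum_(i < m) xi_i 1_[t_i, t_{i+1}[ with
   0 = t_0 < ... < t_m = T and each xi_i bounded and
   natural_filtration t_i - measurable. *)
Record simple_process (T : R) := SimpleProcess {
  sp_size : nat;
  sp_time : nat -> R;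
  sp_coef : nat -> Omega -> 'M[R]_(n, d);
  sp_time0 : sp_time 0%N = 0;
  sp_timeT : sp_time sp_size = T;
  sp_time_incr :
    forall i, (i < sp_size)%N -> sp_time i < sp_time i.+1;
  sp_coef_adapted :
    forall i, (i < sp_size)%N -> forall a b,
      measurable_wrt (natural_filtration (sp_time i))
                     (fun w => sp_coef i w a b);
  sp_coef_bounded :
    exists K : R, forall i, (i < sp_size)%N ->
      forall w, frobenius (sp_coef i w) <= K
}.

Definition simple_value (T : R) (phi : simple_process T) (s : R) (w : Omega) :
    'M[R]_(n, d) :=
  \sum_(i < sp_size phi | sp_time phi i <= s < sp_time phi i.+1)
    sp_coef phi i w.

Definition simple_integral (T : R) (phi : simple_process T) (w : Omega) :
    'cV[R]_n :=
  \sum_(i < sp_size phi)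
    sp_coef phi i w *m
      \col_j (B j (sp_time phi i.+1) w - B j (sp_time phi i) w).

Definition ito_integrable (T : R) (Phi : R -> Omega -> 'M[R]_(n, d)) : Prop :=
  [/\ forall a b, measurable_fun (`[0, T]%classic `*` [set: Omega])
        (fun p : measurableTypeR R * Omega => Phi p.1 p.2 a b),
      forall s : R, 0 <= s -> s <= T -> forall a b,
        measurable_wrt (natural_filtration s) (fun w => Phi s w a b) &
      (\int[P]_w \int[lebesgue_measure]_(s in `[0%R, T])
         (frobenius (Phi s w) ^+ 2)%:E < +oo)%E].

(* X is (a version of) the Ito integral over [0, T] of Phi with respect to B,
   i.e. the L^2(P) limit of integrals of simple adapted processes approximating
   Phi.  It is unique up to almost sure equality, hence a relation. *)
Definition is_ito_integral (T : R) (Phi : R -> Omega -> 'M[R]_(n, d))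
    (X : Omega -> 'cV[R]_n) : Prop :=
  [/\ ito_integrable T Phi,
      forall i, measurable_fun [set: Omega] (fun w => X w i 0) &
      exists phi : nat -> simple_process T,
        (fun k => \int[P]_w \int[lebesgue_measure]_(s in `[0%R, T])
           (frobenius (simple_value (phi k) s w - Phi s w) ^+ 2)%:E)%E
          @ \oo --> 0%E /\
        (fun k => 'E_P[fun w =>
           (frobenius (simple_integral (phi k) w - X w) ^+ 2)%R])%E
          @ \oo --> 0%E].

(* Y is the almost sure limit, as T tends to +oo, of the integrals over [0, T].
   The pathwise limit over real T is taken along an almost surely continuous
   version M of the integral process; the integrals for the individual T alone
   are only determined up to T-dependent null sets. *)
Definition is_ito_integral_half_line (Phi : R -> Omega -> 'M[R]_(n, d))
    (Y : Omega -> 'cV[R]_n) : Prop :=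
  (forall i, measurable_fun [set: Omega] (fun w => Y w i 0)) /\
  exists M : R -> Omega -> 'cV[R]_n,
    [/\ forall T : R, 0 <= T -> is_ito_integral T Phi (M T),
        {ae P, forall w, continuous_half_line (fun T => M T w)} &
        {ae P, forall w, (fun T => M T w) @ +oo --> Y w}].

End ito.
End probability_space.

(* Main.v *)
Require Import Defs.
From HB Require Import structures.
From mathcomp Require Import all_boot all_order all_algebra.
From mathcomp Require Import finmap ring lra.
From mathcomp Require Import all_classical all_reals all_analysis.
From mathcomp Require Import measurable_realfun.

Set Implicit Arguments.
Unset Strict Implicit.
Unset Printing Implicit Defensive.

Import Order.TTheory GRing.Theory Num.Theory.
Import numFieldNormedType.Exports.

Local Open Scope classical_set_scope.
Local Open Scope ring_scope.

(** The integrands are deterministic, so everything rests on the Ito isometry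

      E |int_0^t H(t,s) f(s) dB - int_0^oo Hoo(s) f(s) dB| ^ 2
        = int_0^t |(H(t,s) - Hoo(s)) f(s)| ^ 2 ds + int_t^oo |Hoo(s) f(s)| ^ 2 ds,

    used below as the two inequalities [ito_dist_ge] and [ito_dist_le].

    Kernel convergence implies convergence of the integrals: [f] is bounded, so
    the first term is at most a constant times the distance of the kernels, and
    the second one is the tail of a convergent integral. The work lies in the
    existence of the integral over the half line as an almost sure limit along a
    continuous version. [version] is a limit, uniform in time, of integrals of
    step functions that converge fast in mean square: the maximal inequality
    [kolmogorov] and the Borel-Cantelli lemma give uniform convergence
    on almost every path ([ae_regular_path], [version_close]).

    Conversely, testing against constant functions [f] with a single nonzero
    entry gives the convergence of the kernels column by column, once the
    isometry applies to [Hoo], that is, once [Hoo] is known to be square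
    integrable. Only the almost sure convergence of its integrals is given. A
    Gaussian argument closes this gap: sums of independent Brownian increments
    have a fourth moment controlled by their variance, so by the Paley-Zygmund
    inequality ([grid_sum_anticoncentration]) an integral with a large variance
    is large with probability at least 1/16 ([variance_spreads]). An almost
    surely convergent family is tight ([ae_cvg_tight]), hence its variances stay
    bounded ([ae_cvg_sqint_fin]), and Fatou's lemma identifies the almost sure
    limit with the mean square one ([half_line_limit]).

    The isometry itself ([elem_isometry], [ito_limit_isometry]) comes from the
    independence of an increment of one motion from the past of that motion
    and all of the other motions ([increment_indep]). The integral is then the
    closure [ito_limit] of its values on elementary integrands, taken row by
    row. *)


Lemma le_of_eq (d : Order.disp_t) (T : porderType d) (x y : T) : x = y -> (x <= y)%O.
Proof. by move=> ->. Qed.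

(** * Expectations of real random variables *)

Section expectation_toolkit.
Context (d : measure_display) (T : measurableType d) (R : realType).
Variable P : probability T R.

Local Notation intble X := (P.-integrable [set: T] (EFin \o X)).
Local Notation Ex X := (\int[P]_w X w)%R.

Lemma intble_mfun (X : T -> R) : intble X -> measurable_fun setT X.
Proof. by move=> /measurable_int/measurable_EFinP. Qed.

Lemma intble_cst (c : R) : intble (fun=> c).
Proof. exact: finite_measure_integrable_cst. Qed.

Lemma intbleD (X Y : T -> R) : intble X -> intble Y -> intble (fun w => X w + Y w).
Proof. by move=> iX iY; apply: eq_integrable (integrableD _ iX iY). Qed.

Lemma intbleZ (c : R) (X : T -> R) : intble X -> intble (fun w => c * X w).
Proof. by move=> iX; apply: eq_integrable (integrableZl _ c iX). Qed.

Lemma intbleB (X Y : T -> R) : intble X -> intble Y -> intble (fun w => X w - Y w).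
Proof. by move=> iX iY; apply: eq_integrable (integrableB _ iX iY). Qed.

Lemma intble_sum (I : Type) (r : seq I) (X : I -> T -> R) :
  (forall i, intble (X i)) -> intble (fun w => \sum_(i <- r) X i w).
Proof.
move=> iX; elim: r => [|i r IH].
  by under eq_fun do rewrite big_nil; exact: intble_cst.
by under eq_fun do rewrite big_cons; exact: intbleD.
Qed.

Lemma intble_le (X Y : T -> R) : measurable_fun setT X ->
  (forall w, `|X w| <= Y w) -> intble Y -> intble X.
Proof.
move=> mX XY iY; apply: (le_integrable _ _ _ iY) => //.
  exact/measurable_EFinP.
by move=> w _ /=; rewrite lee_fin (le_trans (XY w))// ler_norm.
Qed.

Lemma intble_bounded_mul (Z X : T -> R) : measurable_fun setT Z ->
  (exists K, forall w, `|Z w| <= K) -> intble X -> intble (fun w => Z w * X w).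
Proof.
move=> mZ [K ZK] iX; apply: (@intble_le _ (fun w => K * `|X w|)).
- by apply: measurable_funM => //; exact: intble_mfun.
- by move=> w; rewrite normrM ler_wpM2r.
- by apply: intbleZ; exact: integrable_norm.
Qed.

Lemma intble_sqr (X : T -> R) : measurable_fun setT X ->
  intble (fun w => X w ^+ 2) -> intble X.
Proof.
move=> mX iX; apply: (@intble_le _ (fun w => 1 + X w ^+ 2)) => //.
  move=> w; rewrite -[X w ^+ 2]real_normK ?num_real//.
  have := normr_ge0 (X w); nra.
exact: intbleD (intble_cst _) _.
Qed.

Lemma Ex_cst (c : R) : Ex (fun=> c) = c.
Proof. by rewrite Rintegral_cst//= probability_setT mulr1. Qed.

Lemma ExD (X Y : T -> R) : intble X -> intble Y ->
  Ex (fun w => X w + Y w) = Ex X + Ex Y.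
Proof. by move=> *; rewrite RintegralD. Qed.

Lemma ExB (X Y : T -> R) : intble X -> intble Y ->
  Ex (fun w => X w - Y w) = Ex X - Ex Y.
Proof. by move=> *; rewrite RintegralB. Qed.

Lemma ExZ (c : R) (X : T -> R) : intble X -> Ex (fun w => c * X w) = c * Ex X.
Proof. by move=> *; rewrite RintegralZl. Qed.

Lemma Ex_sum (I : Type) (r : seq I) (X : I -> T -> R) :
  (forall i, intble (X i)) ->
  Ex (fun w => \sum_(i <- r) X i w) = \sum_(i <- r) Ex (X i).
Proof.
move=> iX; elim: r => [|i r IH].
  by under eq_Rintegral do rewrite big_nil; rewrite big_nil Ex_cst.
under eq_Rintegral do rewrite big_cons.
by rewrite big_cons -IH ExD//; exact: intble_sum.
Qed.

Lemma Ex_le (X Y : T -> R) : intble X -> intble Y ->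
  (forall w, X w <= Y w) -> Ex X <= Ex Y.
Proof. by move=> iX iY XY; apply: le_Rintegral. Qed.

Lemma Ex_EFin (X : T -> R) : intble X -> (Ex X)%:E = (\int[P]_w (X w)%:E)%E.
Proof. by move=> iX; rewrite fineK//; exact: integrable_fin_num. Qed.

Lemma intble_indic (A : set T) : measurable A -> intble (\1_A).
Proof. exact: integrable_indic. Qed.

Lemma Ex_indic (A : set T) : measurable A -> Ex (\1_A) = fine (P A).
Proof. by move=> mA; rewrite /Rintegral integral_indic// setIT. Qed.

Definition indep_rv (X Y : T -> R) := forall A C : set R,
  measurable A -> measurable C ->
  P (X @^-1` A `&` Y @^-1` C) = (P (X @^-1` A) * P (Y @^-1` C))%E.

(** The joint law of independent variables is the product of their laws, so
    that Fubini's theorem factors the expectation. *)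
Lemma intble_indep_mul (X Y : T -> R) : indep_rv X Y -> intble X -> intble Y ->
  intble (fun w => X w * Y w) /\ Ex (fun w => X w * Y w) = Ex X * Ex Y.
Proof.
move=> XY iX iY.
have mabs : measurable_fun [set: R] (fun x : R => `|x|%:E).
  by apply/measurable_EFinP; exact: normr_measurable.
have mmul : measurable_fun [set: R * R] (fun z => (z.1 * z.2)%:E).
  by apply/measurable_EFinP; exact: measurable_funM.
have mX := intble_mfun iX; have mY := intble_mfun iY.
have mXY : measurable_fun setT (fun w => (X w, Y w)) by exact: measurable_fun_pair.
pose X' := mfun_Sub (mem_set mX : X \in mfun).
pose Y' := mfun_Sub (mem_set mY : Y \in mfun).
pose XY' := mfun_Sub (mem_set mXY : (fun w => (X w, Y w)) \in mfun).
pose PX := distribution P X'; pose PY := distribution P Y'.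
pose PXY := distribution P XY'.
have prodE A : measurable A -> (PX \x PY)%E A = PXY A.
  by move=> mA; apply: product_measure_unique => // B C mB mC; exact: XY.
have intE (f : R * R -> \bar R) : measurable_fun setT f ->
    (forall y, (0 <= f y)%E) ->
    (\int[P]_w f (X w, Y w) = \int[PX]_x \int[PY]_y f (x, y))%E.
  move=> mf f0; rewrite -(fubini_tonelli1 f)//.
  rewrite (eq_measure_integral PXY) => [|A mA _]; last exact: prodE.
  by rewrite ge0_integral_distribution.
have iXY : intble (fun w => X w * Y w).
  apply/integrableP; split; first exact/measurable_EFinP/measurable_funM.
  have := intE (fun z => `|z.1 * z.2|%:E).
  move=> /= ->; last 2 first.
    by apply/measurable_EFinP/measurableT_comp => //; exact: measurable_funM.
    by move=> y; rewrite lee_fin.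
  have factor x : (\int[PY]_y `|x * y|%:E = `|x|%:E * \int[PY]_y `|y|%:E)%E.
    under eq_integral do rewrite normrM EFinM.
    by rewrite ge0_integralZl.
  under eq_integral do rewrite factor.
  rewrite ge0_integralZr//=; last by apply: integral_ge0 => *; rewrite lee_fin.
  have iab (Z : {RV P >-> R}) : intble Z ->
     (\int[distribution P Z]_x `|x|%:E < +oo)%E.
    by move=> /integrableP[_]; rewrite ge0_integral_distribution.
  by apply: lte_mul_pinfty; rewrite ?iab// ?ge0_fin_numE ?iab//;
    apply: integral_ge0 => *; rewrite lee_fin.
split=> //.
rewrite {1}/Rintegral -[in RHS]fineM; [|exact: integrable_fin_num..].
congr fine.
have iprod : (PX \x PY)%E.-integrable setT (fun z : R * R => (z.1 * z.2)%:E).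
  apply/integrableP; split; first exact: mmul.
  rewrite (eq_measure_integral PXY) => [|A mA _]; last exact: prodE.
  rewrite ge0_integral_distribution//=; first by case/integrableP : iXY.
  by apply/measurable_EFinP; apply: measurableT_comp => //;
    exact/measurable_EFinP.
transitivity (\int[PXY]_z (z.1 * z.2)%:E)%E.
  by rewrite integral_distribution.
rewrite (eq_measure_integral (PX \x PY)%E) => [|A mA _]; last exact/esym/prodE.
rewrite -(integral12_prod_meas1 iprod).
rewrite /fubini_F/=.
have idX : PX.-integrable setT (EFin \o id).
  apply/integrableP; split; first exact/measurable_EFinP.
  by rewrite ge0_integral_distribution//=; case/integrableP : iX.
have idY : PY.-integrable setT (EFin \o id).
  apply/integrableP; split; first exact/measurable_EFinP.
  by rewrite ge0_integral_distribution//=; case/integrableP : iY.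
have fY : (\int[PY]_y y%:E = (Ex Y)%:E)%E.
  by rewrite Ex_EFin// integral_distribution//=; exact/measurable_EFinP.
have factor x : (\int[PY]_y (x * y)%:E = x%:E * (Ex Y)%:E)%E.
  under eq_integral do rewrite EFinM.
  by rewrite integralZl// fY.
under eq_integral do rewrite factor.
rewrite integralZr// -!Ex_EFin//; congr (_ * _)%E.
by rewrite integral_distribution//= Ex_EFin.
Qed.

End expectation_toolkit.

(** * Sigma-algebras generated by Brownian motions *)

Section generated_sigma_algebras.
Context (d0 : measure_display) (Omega : measurableType d0) (R : realType).
Implicit Types F G : set (set Omega).

Lemma measurable_wrtP F : sigma_algebra setT F -> forall X : Omega -> R,
  measurable_wrt F X <->
  measurable_fun [set: g_sigma_algebraType F] (X : g_sigma_algebraType F -> R).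
Proof.
move=> sF X; have FE : <<s F >> = F by exact: sigma_algebra_id.
split=> [mX _ Y mY|mX _ [Y mY <-]].
  rewrite /measurable/= FE; apply: mX; exists Y => //.
by have := mX measurableT Y mY; rewrite /measurable/= FE.
Qed.

Lemma sigma_algebraT F : sigma_algebra setT F -> F setT.
Proof. by move=> /sigma_algebra_dynkin/dynkinT. Qed.

Lemma sigma_algebraI F A C : sigma_algebra setT F -> F A -> F C -> F (A `&` C).
Proof. by move=> sF; have [//|_ _ _] := (sigma_algebraP _).1 sF; exact. Qed.

Section closure.
Variable F : set (set Omega).
Hypothesis sF : sigma_algebra setT F.

Lemma wrt_cst (c : R) : measurable_wrt F (fun=> c).
Proof. by apply/measurable_wrtP. Qed.

Lemma wrtD (X Y : Omega -> R) : measurable_wrt F X -> measurable_wrt F Y ->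
  measurable_wrt F (fun w => X w + Y w).
Proof.
move=> /(measurable_wrtP sF) mX /(measurable_wrtP sF) mY.
by apply/measurable_wrtP => //; exact: measurable_funD.
Qed.

Lemma wrtB (X Y : Omega -> R) : measurable_wrt F X -> measurable_wrt F Y ->
  measurable_wrt F (fun w => X w - Y w).
Proof.
move=> /(measurable_wrtP sF) mX /(measurable_wrtP sF) mY.
by apply/measurable_wrtP => //; exact: measurable_funB.
Qed.

Lemma wrtM (X Y : Omega -> R) : measurable_wrt F X -> measurable_wrt F Y ->
  measurable_wrt F (fun w => X w * Y w).
Proof.
move=> /(measurable_wrtP sF) mX /(measurable_wrtP sF) mY.
by apply/measurable_wrtP => //; exact: measurable_funM.
Qed.

Lemma wrt_sum (I : Type) (r : seq I) (X : I -> Omega -> R) :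
  (forall i, measurable_wrt F (X i)) ->
  measurable_wrt F (fun w => \sum_(i <- r) X i w).
Proof.
move=> mX; elim: r => [|i r IH].
  by under eq_fun do rewrite big_nil; exact: wrt_cst.
by under eq_fun do rewrite big_cons; exact: wrtD.
Qed.

Lemma wrt_indic (A : set Omega) : F A -> measurable_wrt F (\1_A : Omega -> R).
Proof.
move=> FA; apply/measurable_wrtP => //; apply: measurable_indic.
by rewrite /measurable/=; exact: sub_sigma_algebra.
Qed.

End closure.

Lemma wrtS F G (X : Omega -> R) : F `<=` G ->
  measurable_wrt F X -> measurable_wrt G X.
Proof. by move=> FG mX A /mX/FG. Qed.

Lemma wrt_measurable F (X : Omega -> R) : F `<=` measurable ->
  measurable_wrt F X -> measurable_fun setT X.
Proof. by move=> Fm mX _ A mA; apply/Fm/mX; exists A. Qed.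

Variables (I : Type) (X : I -> Omega -> R).

Lemma sigma_generated_sigma (D : set I) : sigma_algebra setT (sigma_generated D X).
Proof. exact: smallest_sigma_algebra. Qed.

Lemma sigma_generatedS (D D' : set I) : D `<=` D' ->
  sigma_generated D X `<=` sigma_generated D' X.
Proof. by move=> DD'; apply: sub_sigma_algebra2; exact: bigcup_subset. Qed.

Lemma sigma_generated_wrt (D : set I) i : D i ->
  measurable_wrt (sigma_generated D X) (X i).
Proof. by move=> Di A XA; apply: sub_sigma_algebra; exists i. Qed.

Lemma sigma_generated_measurable (D : set I) :
  (forall i, D i -> measurable_fun setT (X i)) ->
  sigma_generated D X `<=` measurable.
Proof.
move=> mX; apply: smallest_sub; first exact: sigma_algebra_measurable.
by move=> _ [i Di [A mA <-]]; exact: mX.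
Qed.

End generated_sigma_algebras.

Section brownian_independence.
Context (d0 : measure_display) (Omega : measurableType d0) (R : realType).
Variables (P : probability Omega R) (d : nat) (B : 'I_d -> R -> {RV P >-> R}).
Hypothesis hB : brownian_motion B.

(** This sigma-algebra contains the natural filtration at time [s] as well as
    all increments of the motions other than the [j]-th, so that independence
    from it also handles products of increments of distinct motions. *)
Definition past_and_others (j : 'I_d) (s : R) : set (set Omega) :=
  sigma_generated [set ku : 'I_d * R | 0 <= ku.2 /\ (ku.1 = j -> ku.2 <= s)]
    (fun ku => B ku.1 ku.2).

Lemma past_and_others_sigma j s : sigma_algebra setT (past_and_others j s).
Proof. exact: sigma_generated_sigma. Qed.

Lemma natural_filtration_sigma s : sigma_algebra setT (natural_filtration B s).
Proof. exact: sigma_generated_sigma. Qed.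

Lemma natural_filtration_measurable s : natural_filtration B s `<=` measurable.
Proof. by apply: sigma_generated_measurable => i _. Qed.

Lemma natural_filtrationS s t : s <= t ->
  natural_filtration B s `<=` natural_filtration B t.
Proof.
move=> st; apply: sigma_generatedS => -[k u] [/= u0 us].
by split=> //; exact: le_trans st.
Qed.

Lemma natural_filtration_past_and_others j s :
  natural_filtration B s `<=` past_and_others j s.
Proof. by apply: sigma_generatedS => -[k u] [/= u0 us]; split. Qed.

(** Pi-lambda argument: past_and_others is generated by intersections of
    events, one per motion, on which the product rule follows from the mutual
    independence of the motions and the independence of increments of the
    [j]-th motion from its own past. *)
Lemma increment_indep (j : 'I_d) (s t : R) : 0 <= s -> s < t ->
  independent P (past_and_others j s)
    (preimage_set_system setT (fun w => B j t w - B j s w) measurable).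
Proof.
move=> s0 st; have [hBM hI] := hB; have [_ _ hinc _] := hBM j.
pose S k := sigma_generated [set u : R | 0 <= u] (fun u => B k u).
pose Sj := sigma_generated [set u : R | 0 <= u /\ u <= s] (fun u => B j u).
have SjS : Sj `<=` S j by apply: sigma_generatedS => u [].
have sS k : sigma_algebra setT (S k) by exact: sigma_generated_sigma.
have sSj : sigma_algebra setT Sj by exact: sigma_generated_sigma.
have Sm k : S k `<=` measurable by apply: sigma_generated_measurable.
move=> A C mA [C0 mC0 CE].
have SC : S j C.
  rewrite -CE; apply: (@wrtB _ _ _ _ (sS j) (B j t) (B j s)); last by exists C0.
    by apply: sigma_generated_wrt => /=; exact: le_trans (ltW st).
  exact: sigma_generated_wrt.
have mC : measurable C by exact: Sm SC.
pose G := [set E | exists2 e : 'I_d -> set Omega,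
  (forall k, S k (e k)) /\ Sj (e j) & E = \bigcap_k e k].
have GT : G setT.
  exists (fun=> setT); last by rewrite bigcapT.
  by split=> [k|]; [exact: sigma_algebraT (sS k)|exact: sigma_algebraT sSj].
have bigm (e : 'I_d -> set Omega) : (forall k, S k (e k)) ->
    measurable (\bigcap_k e k).
  by move=> Se; apply: fin_bigcap_measurable => // k _; exact: Sm (Se k).
have Gm : G `<=` measurable by move=> _ [e [Se _] ->]; exact: bigm.
have GI : setI_closed G.
  move=> _ _ [e [Se Sje] ->] [f [Sf Sjf] ->].
  exists (fun k => e k `&` f k); last by rewrite bigcapI.
  split=> [k|]; first exact: sigma_algebraI (sS k) _ _.
  exact: sigma_algebraI sSj _ _.
have prodE (e : 'I_d -> set Omega) : (forall k, S k (e k)) ->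
    P (\bigcap_k e k) =
    (fine (P (e j)) * \prod_(i <- fset_set [set: 'I_d] | i != j) fine (P (e i)))%:E.
  move=> Se; have := hI (fset_set [set: 'I_d]) e (fun i _ => Se i).
  rewrite fset_setK; last exact: finite_finset.
  move=> ->; rewrite (bigD1_seq j)//=.
    by rewrite in_fset_set ?inE//; exact: finite_finset.
  exact: fset_uniq.
(* The product rule for [C] says that two finite measures are equal; it is
   enough to compare them on the pi-system [G]. *)
pose c := fine (P C).
have cE : c%:E = P C by rewrite fineK// fin_num_measure.
have c0 : 0 <= c by exact: fine_ge0.
pose m1 := mrestr P mC; pose m2 := mscale (NngNum c0) P.
have m12 E : G E -> m1 E = m2 E.
  move=> [e [Se Sje] ->]; rewrite /m1 /mrestr/= /m2 /mscale/= cE.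
  pose e' k := if k == j then e j `&` C else e k.
  have Se' k : S k (e' k).
    rewrite /e'; case: eqP => [->|_]//; exact: sigma_algebraI (sS j) _ _.
  have -> : \bigcap_k e k `&` C = \bigcap_k e' k.
    apply/seteqP; split=> [w [ew Cw] k _|w ew].
      by rewrite /e'; case: eqP => _; [split=> //|]; exact: ew.
    split=> [k _|].
      have := ew k I; rewrite /e'; case: eqP => [->[]|]//.
    by have := ew j I; rewrite /e' eqxx => -[].
  rewrite !prodE// {1}/e' eqxx.
  have := hinc s t s0 st (e j) C Sje; rewrite -CE => ->; last by exists C0.
  rewrite CE fineM ?fin_num_measure//; last exact: (Sm j (e j) (Se j)).
  rewrite -cE -EFinM mulrA [c * _]mulrC; congr (_ * _)%:E.
  by apply: eq_bigr => i /negbTE ij; rewrite /e' ij.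
have cover : \bigcup_(k : nat) [set: Omega] = setT by rewrite bigcup_const.
have fin (k : nat) : (m1 setT < +oo)%E.
  by rewrite /m1/= /mrestr setTI ltey_eq fin_num_measure.
have key : forall E, <<s G >> E -> m1 E = m2 E.
  exact: (g_sigma_algebra_measure_unique G Gm (fun=> setT) (fun=> GT) cover _ _ GI m12 fin).
transitivity (m1 A) => //; rewrite key.
- by rewrite /m2/= /mscale/= cE muleC.
- move: A mA {m12}; apply: smallest_sub; first exact: smallest_sigma_algebra.
  move=> _ [[k u] [/= u0 uj] [A mA <-]]; apply: sub_sigma_algebra.
  exists (fun i => if i == k then (B k u : Omega -> R) @^-1` A else setT).
    split=> [i|].
      case: eqP => [->|_]; last exact: sigma_algebraT (sS i).
      by apply: sub_sigma_algebra; exists u => //; exists A; rewrite ?setTI.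
    case: eqP => [jk|_]; last exact: sigma_algebraT sSj.
    rewrite -jk; apply: sub_sigma_algebra; exists u; last by exists A; rewrite ?setTI.
    by split=> //; exact: uj.
  rewrite setTI; apply/seteqP; split=> [w Aw i _|w /(_ k I)].
    by case: eqP.
  by rewrite eqxx.
Qed.

End brownian_independence.

(** * Gaussian moments *)

Section density.
Context (d : measure_display) (T : measurableType d) (R : realType).
Variables (mu nu : {measure set T -> \bar R}) (p : T -> R).
Hypotheses (mp : measurable_fun setT p) (p_ge0 : forall x, 0 <= p x).
Hypothesis nuE : forall A, measurable A -> nu A = (\int[mu]_(x in A) (p x)%:E)%E.
Import HBNNSimple.

(** Both sides agree on indicators by hypothesis, hence on simple functions;
    monotone convergence extends this to nonnegative functions. *)
Lemma ge0_integral_density (f : T -> \bar R) : measurable_fun setT f ->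
  (forall x, 0 <= f x)%E ->
  (\int[nu]_x f x = \int[mu]_x (f x * (p x)%:E))%E.
Proof.
move=> mf f0; pose h := nnsfun_approx measurableT mf.
have ndh x : nondecreasing_seq (fun n => h n x).
  by move=> m n mn; have /lefP := nd_nnsfun_approx measurableT mf mn; exact.
have mh n : measurable_fun setT (fun x => (h n x)%:E).
  by apply/measurable_EFinP; exact/measurable_funP.
have mpdf : measurable_fun setT (fun x => (p x)%:E).
  by apply/measurable_EFinP; exact: mp.
have pdf0 x : (0 <= (p x)%:E)%E.
  by rewrite lee_fin p_ge0.
have cvgN : (\int[nu]_x (h n x)%:E)%E @[n --> \oo] --> (\int[nu]_x f x)%E.
  have -> : (\int[nu]_x f x = \int[nu]_x limn (fun n => (h n x)%:E))%E.
    apply: eq_integral => x _; apply/esym/cvg_lim => //.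
    exact: cvg_nnsfun_approx.
  apply: cvg_monotone_convergence => //.
  - by move=> n x _; rewrite lee_fin.
  - by move=> x _ m n mn; rewrite lee_fin; exact: ndh.
have cvgmu : (\int[mu]_x ((h n x)%:E * (p x)%:E))%E @[n --> \oo]
    --> (\int[mu]_x (f x * (p x)%:E))%E.
  have -> : (\int[mu]_x (f x * (p x)%:E) =
      \int[mu]_x limn (fun n => (h n x)%:E * (p x)%:E))%E.
    apply: eq_integral => x _; apply/esym/cvg_lim => //.
    by apply: cvgeZr => //; exact: cvg_nnsfun_approx.
  apply: cvg_monotone_convergence => //.
  - by move=> n; apply: emeasurable_funM; [exact: mh|exact: mpdf].
  - by move=> n x _; rewrite mule_ge0// lee_fin.
  - move=> x _ m n mn; apply: lee_wpmul2r => //.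
    by rewrite lee_fin; exact: ndh.
apply: (cvg_unique _ cvgN) => //.
have -> // : (fun n => \int[nu]_x (h n x)%:E)%E =
  (fun n => \int[mu]_x ((h n x)%:E * (p x)%:E))%E.
apply/funext => n.
have indich r : measurable_fun setT (fun x => (r * \1_(h n @^-1` [set r]) x)%:E).
  by apply/measurable_EFinP; exact: measurable_funM.
transitivity (\int[nu]_x (\sum_(y \in range (h n)) (y * \1_(h n @^-1` [set y]) x)%:E))%E.
  by apply: eq_integral => x _; rewrite fimfunE -fsumEFin.
rewrite ge0_integral_fsum//; last by move=> m y _; exact: nnfun_muleindic_ge0.
transitivity (\int[mu]_x (\sum_(y \in range (h n))
    (y * \1_(h n @^-1` [set y]) x)%:E * (p x)%:E))%E; last first.
  apply: eq_integral => x _; rewrite [h n x]fimfunE -fsumEFin// ge0_mule_fsuml//.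
  by move=> y; exact: nnfun_muleindic_ge0.
rewrite ge0_integral_fsum//; last 2 first.
  by move=> y; apply: emeasurable_funM; [exact: indich|exact: mpdf].
  by move=> m y _; rewrite mule_ge0// nnfun_muleindic_ge0.
apply: eq_fsbigr => r rh.
rewrite integralZl_indic_nnsfun//.
under [RHS]eq_integral do rewrite EFinM -muleA.
rewrite ge0_integralZl//.
- congr (_ * _)%E; rewrite integral_indic//= setIT nuE// integral_mkcond/=.
  apply: eq_integral => x _; rewrite patchE indicE.
  by case: ifPn => _; rewrite ?mul1e ?mul0e.
- by apply: emeasurable_funM => //; exact/measurable_EFinP.
- by move=> x _; rewrite mule_ge0// lee_fin.
- by rewrite lee_fin; move: rh; rewrite inE => -[x _ <-].
Qed.

End density.

Section gaussian_moments.
Context (R : realType).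
Local Notation mu := (@lebesgue_measure R).

Section half_line.
Variable a : R.
Hypothesis a0 : 0 < a.
Let g (x : R) := expR (- (a * x ^+ 2)).

Let g_gt0 x : 0 < g x. Proof. exact: expR_gt0. Qed.

Let dg (x : R) : is_derive x (1 : R) g (- (2 * a * x) * g x).
Proof.
have h : is_derive x (1 : R) (fun y : R => - (a * y ^+ 2)) (- (2 * a * x)).
  apply: is_derive_eq.
  by rewrite /GRing.scale/=; ring.
rewrite [X in is_derive _ _ _ X]mulrC; exact: is_derive1_comp.
Qed.

Let cg : continuous g.
Proof.
by move=> x; apply: differentiable_continuous; apply/derivable1_diffP.
Qed.

Let cXg k : continuous (fun x : R => x ^+ k * g x).
Proof.
move=> x; apply: cvgM; last exact: cg.
exact: exprn_continuous.
Qed.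

Let half_moment k (n : R) := \int[mu]_(x in `[0, n]) (x ^+ k * g x).

Let intXg k (n : R) : mu.-integrable `[0, n] (EFin \o (fun x => x ^+ k * g x)).
Proof.
apply: continuous_compact_integrable; first exact: segment_compact.
exact: continuous_subspaceT.
Qed.

(** Integration by parts of [x ^ (k + 1) * exp (- a x ^ 2)]. *)
Let half_moment_rec k (n : R) : 0 < n ->
  2 * a * half_moment k.+2 n = k.+1%:R * half_moment k n - n ^+ k.+1 * g n.
Proof.
move=> n0; pose F (x : R) := x ^+ k.+1 * g x.
pose f (x : R) := k.+1%:R * (x ^+ k * g x) - 2 * a * (x ^+ k.+2 * g x).
have dF (x : R) : is_derive x (1 : R) F (f x).
  have dX : is_derive x (1 : R) (fun y : R => y ^+ k.+1) (k.+1%:R * x ^+ k).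
    have := is_deriveX k.+1 (is_derive_id x (1 : R)).
    by rewrite exprfctE /GRing.scale/= mulr1.
  apply: (is_derive_eq (is_deriveM dX (dg x))).
  rewrite /f /GRing.scale/= !exprS; ring.
have cF : continuous F by exact: cXg.
have := @continuous_FTC2 R f F 0 n n0.
have -> : (\int[mu]_(x in `[0%R, n]) (f x)%:E =
    (k.+1%:R * half_moment k n - 2 * a * half_moment k.+2 n)%:E)%E.
  have i1 : mu.-integrable `[0, n] (EFin \o (fun x => k.+1%:R * (x ^+ k * g x))).
    by apply: eq_integrable (integrableZl _ k.+1%:R (intXg k n)).
  have i2 : mu.-integrable `[0, n] (EFin \o (fun x => 2 * a * (x ^+ k.+2 * g x))).
    by apply: eq_integrable (integrableZl _ (2 * a) (intXg k.+2 n)).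
  rewrite -RintegralZl// -RintegralZl// -RintegralB// fineK//.
  apply: integrable_fin_num => //.
  by apply: eq_integrable (integrableB _ i1 i2).
rewrite /F expr0n/= mul0r oppr0 adde0 => h.
have : k.+1%:R * half_moment k n - 2 * a * half_moment k.+2 n = n ^+ k.+1 * g n.
  apply: EFin_inj; apply: h.
  - apply: continuous_subspaceT => x.
    by apply: cvgB; apply: cvgM; (try exact: cvg_cst); exact: cXg.
  - split.
    + by move=> x _; have [] := dF x.
    + exact: cvg_at_right_filter (cF 0).
    + exact: cvg_at_left_filter (cF n).
  - by move=> x _; rewrite derive1E; exact: derive_val.
by move=> <-; ring.
Qed.

Definition gauss_half_integral k :=
  (\int[mu]_(x in `[0%R, +oo[) (x ^+ (2 * k) * expR (- (a * x ^+ 2)))%:E)%E.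
Local Notation gint := gauss_half_integral.

Let even_ge0 k (x : R) : 0 <= x ^+ (2 * k) * g x.
Proof. by apply: mulr_ge0; [rewrite exprM exprn_ge0 ?sqr_ge0|exact: ltW]. Qed.

Let gint_cvg k : (half_moment (2 * k) n%:R)%:E @[n --> \oo] --> gint k.
Proof.
have -> : (fun n : nat => (half_moment (2 * k) n%:R)%:E) =
    (fun n => \int[mu]_(x in `[0%R, n%:R]) (x ^+ (2 * k) * g x)%:E)%E.
  by apply/funext => n; rewrite fineK//; apply: integrable_fin_num => //; exact: intXg.
apply: ge0_cvgn_integral => //.
by apply: continuous_measurable_fun; exact: cXg.
Qed.

Let gint_ge k (n : nat) : ((half_moment (2 * k) n%:R)%:E <= gint k)%E.
Proof.
rewrite fineK; last by apply: integrable_fin_num => //; exact: intXg.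
apply: ge0_subset_integral => //.
- by apply/measurable_EFinP/measurable_funTS; apply: continuous_measurable_fun; exact: cXg.
- by move=> x _; rewrite lee_fin.
- by move=> x /=; rewrite !in_itv/= => /andP[->].
Qed.

(** The boundary terms in [half_moment_rec] have a favourable sign. *)
Lemma gauss_half_integral_le k : ((2 * a)%:E * gint k.+1 <= (2 * k).+1%:R%:E * gint k)%E.
Proof.
have c1 := cvgeZl (y := (2 * a)%:E) isT (@gint_cvg k.+1).
apply: (cvge_le _ c1).
exists 1%N => // n /= n1.
rewrite mulnS add2n -EFinM half_moment_rec ?ltr0n// EFinB EFinM.
rewrite (@le_trans _ _ ((2 * k).+1%:R%:E * (half_moment (2 * k) n%:R)%:E)%E)//.
  rewrite -EFinM -EFinB lee_fin lerBlDr lerDl.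
  by apply: mulr_ge0; [exact: exprn_ge0|exact: ltW].
by apply: lee_pmul => //; rewrite lee_fin ?ler0n// Rintegral_ge0.
Qed.

(** The boundary term [n * exp (- a n ^ 2)] is at most [1 / (a n)], because
    [exp x >= 1 + x]. *)
Lemma gauss_half_integral1 : ((2 * a)%:E * gint 1 = gint 0)%E.
Proof.
have c1 := cvgeZl (y := (2 * a)%:E) isT (@gint_cvg 1%N).
apply: (cvg_unique _ c1) => //.
have -> : (fun n : nat => ((2 * a)%:E * (half_moment (2 * 1) n%:R)%:E)%E) =
    (fun n => (half_moment 0 n%:R)%:E - (n%:R * g n%:R)%:E)%E.
  apply/funext => -[|n].
    rewrite mul0r sube0 /half_moment set_itv1 !Rintegral_set1 mule0//.
  by rewrite muln1 -EFinM half_moment_rec// mul1r expr1.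
rewrite -[gint 0]sube0; apply: cvgeB => //.
- by rewrite oppe0 fin_num_adde_defl.
- by have := @gint_cvg 0%N; rewrite muln0.
- apply: cvg_EFin; first exact: nearW.
  have c3 : (fun n : nat => a^-1 * n.+1%:R^-1) @ \oo --> (0 : R).
    have := @cvgMl_tmp R nat eventually _ harmonic a^-1 0 (@cvg_harmonic R).
    by rewrite mulr0; apply; exact: eventually_filter.
  rewrite -cvg_shiftS /=.
  apply: (squeeze_cvgr _ (cvg_cst 0) c3).
  apply: nearW => n; apply/andP; split; first by apply: mulr_ge0 => //; exact: ltW.
  rewrite /g expRN -invfM ler_pdivrMr ?expR_gt0//.
  rewrite ler_pdivlMl ?mulr_gt0//.
  apply: le_trans (expR_ge1Dx _).
  by rewrite mulrA mulrAC -mulrA -expr2 lerDr.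
Qed.

End half_line.
Variable sigma : R.
Hypothesis sigma0 : 0 < sigma.
Local Notation N := (normal_prob 0 sigma).

Lemma ge0_integral_normal_prob (f : R -> \bar R) : measurable_fun setT f ->
  (forall x, 0 <= f x)%E ->
  (\int[N]_x f x = \int[mu]_x (f x * (normal_pdf 0 sigma x)%:E))%E.
Proof.
move=> mf f0; apply: ge0_integral_density => //; first exact: measurable_normal_pdf.
by move=> x; exact: normal_pdf_ge0.
Qed.

End gaussian_moments.

Section normal_moments.
Context (R : realType).
Local Notation mu := (@lebesgue_measure R).
Variable sigma : R.
Hypothesis sigma0 : 0 < sigma.
Local Notation N := (normal_prob 0 sigma).
Let sigma_neq0 : sigma != 0. Proof. exact: lt0r_neq0. Qed.
Let a : R := (sigma ^+ 2 *+ 2)^-1.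
Let a0 : 0 < a. Proof. by rewrite invr_gt0 pmulrn_lgt0// exprn_gt0. Qed.
Let G := gauss_half_integral a.

Let pdfE (x : R) : normal_pdf 0 sigma x = normal_peak sigma * expR (- (a * x ^+ 2)).
Proof.
by rewrite normal_pdfE// /normal_fun subr0 /a mulNr [_ / _]mulrC.
Qed.

Let normal_even_moment k :
  (\int[N]_x (x ^+ (2 * k))%:E = (2 * normal_peak sigma)%:E * G k)%E.
Proof.
have p0 : 0 < normal_peak sigma by rewrite normal_peak_gt0.
have even0 (x : R) : 0 <= x ^+ (2 * k) by rewrite exprM exprn_ge0 ?sqr_ge0.
rewrite ge0_integral_normal_prob//; last first.
  by apply/measurable_EFinP; exact: measurable_funX.
under eq_integral do rewrite -EFinM pdfE mulrCA.
rewrite ge0_symfun_integralT.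
- rewrite EFinM -muleA; congr (_ * _)%E.
  under eq_integral do rewrite EFinM.
  rewrite ge0_integralZl//=.
  + by rewrite /G /gauss_half_integral set_itvcy.
  + by rewrite -set_itvcy.
  + apply/measurable_EFinP/measurable_funM; first exact: measurable_funX.
    apply: measurableT_comp => //; apply: measurableT_comp => //.
    by apply: measurable_funM => //; exact: measurable_funX.
  + by move=> x _; rewrite lee_fin mulr_ge0// expR_ge0.
  + by rewrite lee_fin ltW.
- by move=> x; apply: mulr_ge0; [exact: ltW|apply: mulr_ge0 => //; exact: expR_ge0].
- move=> x; apply: cvgM; first exact: cvg_cst.
  apply: cvgM; first exact: exprn_continuous.
  apply: (cvg_comp _ expR); last exact: continuous_expR.
  apply: (@cvgN _ R^o).
  by apply: cvgM; [exact: cvg_cst|exact: exprn_continuous].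
- by move=> x /=; rewrite [(- x) ^+ (2 * k)]exprM !sqrrN -exprM.
Qed.

(** Read off from the total mass of the normal law instead of computing the
    Gaussian integral. *)
Let G0 : G 0 = ((2 * normal_peak sigma)^-1)%:E.
Proof.
have p0 : 2 * normal_peak sigma != 0.
  by rewrite mulf_neq0// gt_eqF// normal_peak_gt0.
have := normal_even_moment 0.
have -> : (\int[N]_x (x ^+ (2 * 0))%:E = 1)%E.
  by under eq_integral do rewrite muln0 expr0; rewrite integral_cst// mul1e; exact: probability_setT.
move=> /(congr1 (fun y => ((2 * normal_peak sigma)^-1)%:E * y)%E).
by rewrite mule1 muleA -EFinM mulVf// mul1e.
Qed.

Lemma normal_prob_moment2 : (\int[N]_x (x ^+ 2)%:E = (sigma ^+ 2)%:E)%E.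
Proof.
rewrite -[2%N]muln1 normal_even_moment.
have := gauss_half_integral1 a0; rewrite -/G G0.
move=> /(congr1 (fun y => ((2 * a)^-1)%:E * y)%E).
have a1 : 2 * a != 0 by rewrite mulf_neq0// gt_eqF.
rewrite muleA -EFinM mulVf// mul1e => ->; rewrite muleA -!EFinM; congr EFin.
have p0 : 2 * normal_peak sigma != 0.
  by rewrite mulf_neq0// gt_eqF// normal_peak_gt0.
by rewrite mulrAC mulfV// mul1r /a invfM invrK -[sigma ^+ 2 *+ 2]mulr_natl mulrA mulVf// mul1r.
Qed.

Lemma normal_prob_moment4 : (\int[N]_x (x ^+ 4)%:E <= (3 * sigma ^+ 4)%:E)%E.
Proof.
have h := gauss_half_integral_le a 1%N; rewrite -/G in h.
have p0 : (0 <= (2 * normal_peak sigma)%:E)%E.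
  by rewrite lee_fin mulr_ge0// ltW// normal_peak_gt0.
have a1 : 0 < 2 * a by rewrite mulr_gt0.
have -> : (\int[N]_x (x ^+ 4)%:E = (2 * normal_peak sigma)%:E * G 2)%E.
  by rewrite -normal_even_moment.
rewrite -(@lee_pmul2l _ (2 * a)%:E)//.
rewrite muleCA.
have := lee_wpmul2l p0 h; move=> /le_trans; apply.
rewrite muleCA -normal_even_moment muln1 normal_prob_moment2 -!EFinM lee_fin.
apply: le_of_eq.
by rewrite /a; field; rewrite sigma_neq0.
Qed.

(** By symmetry the positive and the negative part have the same integral,
    which is finite since [x] is dominated by [1 + x ^ 2]. *)
Lemma normal_prob_odd : (\int[N]_x x%:E = 0)%E.
Proof.
have mid : measurable_fun [set: R] (fun x : R => x%:E) by exact/measurable_EFinP.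
rewrite integralE.
have -> : (\int[N]_x ((fun x : R => x%:E)^\- x) = \int[N]_x ((fun x : R => x%:E)^\+ x))%E.
  rewrite !ge0_integral_normal_prob//.
  - have mf : measurable_fun [set: R]
        (fun x : R => (EFin^\+ x * (normal_pdf 0 sigma x)%:E)%E).
      apply: emeasurable_funM; first exact: measurable_funepos.
      by apply/measurable_EFinP; exact: measurable_normal_pdf.
    rewrite [RHS](_ : _ = \int[pushforward mu (-%R : _ -> measurableTypeR R)]_x
       (EFin^\+ x * (normal_pdf 0 sigma x)%:E))%E; last first.
      apply: eq_measure_integral => A mA _; exact/esym/lebesgue_measureN.
    rewrite ge0_integral_pushforward//.
      rewrite preimage_setT; apply: eq_integral => x _ /=.
      by rewrite !pdfE sqrrN funeposE funenegE.
    by move=> x _; rewrite mule_ge0 ?funepos_ge0// lee_fin normal_pdf_ge0.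
  - exact: measurable_funepos.
  - exact: measurable_funeneg.
rewrite subee//.
rewrite ge0_fin_numE; last by apply: integral_ge0 => x _; exact: funepos_ge0.
apply: le_lt_trans (_ : (\int[N]_x (1 + x ^+ 2)%:E < +oo)%E).
  apply: ge0_le_integral => //.
  - exact: measurable_funepos.
  - apply/measurable_EFinP; apply: measurable_funD => //; exact: measurable_funX.
  - move=> x _; rewrite funeposE /maxe; case: ifPn => _; rewrite lee_fin.
      by rewrite addr_ge0// sqr_ge0.
    by have := sqr_ge0 (x - 1); nra.
under eq_integral do rewrite EFinD.
rewrite ge0_integralD//; last 2 first.
  by move=> x _; rewrite lee_fin sqr_ge0.
  by apply/measurable_EFinP; exact: measurable_funX.
rewrite normal_prob_moment2 integral_cst// mul1e lte_add_pinfty ?ltry//.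
rewrite [X in (X < _)%E](_ : _ = 1%E) ?ltry//; exact: probability_setT.
Qed.

End normal_moments.

(** * Moments of Brownian increments *)

Section increments.
Context (d0 : measure_display) (Omega : measurableType d0) (R : realType).
Variables (P : probability Omega R) (d : nat) (B : 'I_d -> R -> {RV P >-> R}).
Hypothesis hB : brownian_motion B.
Local Notation intble X := (P.-integrable [set: Omega] (EFin \o X)).
Local Notation Ex X := (\int[P]_w X w)%R.

Definition incr (j : 'I_d) (s t : R) (w : Omega) : R := B j t w - B j s w.

Lemma incrD j s t u w : incr j s t w + incr j t u w = incr j s u w.
Proof. by rewrite /incr addrC subrKA. Qed.

Lemma incrxx j s w : incr j s s w = 0. Proof. exact: subrr. Qed.

Lemma measurable_incr j s t : measurable_fun setT (incr j s t).
Proof. exact: measurable_funB. Qed.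
#[local] Hint Resolve measurable_incr : core.

Lemma incr_wrt j s t u : 0 <= s -> 0 <= t -> s <= u -> t <= u ->
  measurable_wrt (natural_filtration B u) (incr j s t).
Proof.
move=> s0 t0 su tu.
by apply: wrtB; [exact: natural_filtration_sigma|
  apply: (@sigma_generated_wrt _ _ _ _ (fun ku : 'I_d * R => B ku.1 ku.2) _ (j, _))..].
Qed.

Lemma incr_past_and_others j k s t c : 0 <= s -> 0 <= t -> k != j ->
  measurable_wrt (past_and_others B j c) (incr k s t).
Proof.
move=> s0 t0 kj.
apply: wrtB; first exact: past_and_others_sigma.
  apply: (@sigma_generated_wrt _ _ _ _ (fun ku : 'I_d * R => B ku.1 ku.2) _ (k, t)).
  by split=> //= kjE; rewrite kjE eqxx in kj.
apply: (@sigma_generated_wrt _ _ _ _ (fun ku : 'I_d * R => B ku.1 ku.2) _ (k, s)).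
by split=> //= kjE; rewrite kjE eqxx in kj.
Qed.

Let incr_law j s t (f : R -> \bar R) : 0 <= s -> s < t ->
  measurable_fun setT f -> (forall x, 0 <= f x)%E ->
  (\int[P]_w f (incr j s t w) = \int[normal_prob 0 (Num.sqrt (t - s))]_x f x)%E.
Proof.
move=> s0 st mf f0; have [/(_ j)[_ hlaw _ _] _] := hB.
pose X := @mfun_Sub _ _ Omega (measurableTypeR R) (incr j s t)
  (mem_set (measurable_incr j s t)).
transitivity (\int[distribution P X]_x f x)%E.
  by rewrite (ge0_integral_distribution X).
apply: eq_measure_integral => A mA _; exact: hlaw.
Qed.

Let sqrt_gt0 (s t : R) : s < t -> 0 < Num.sqrt (t - s).
Proof. by move=> st; rewrite sqrtr_gt0 subr_gt0. Qed.

Let mXn n : measurable_fun [set: R] (fun x : R => (x ^+ n)%:E).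
Proof. by apply/measurable_EFinP; exact: measurable_funX. Qed.

Lemma incr_moment2 j s t : 0 <= s -> s <= t ->
  intble (fun w => incr j s t w ^+ 2) /\ Ex (fun w => incr j s t w ^+ 2) = t - s.
Proof.
move=> s0; rewrite le_eqVlt => /predU1P[<-|st].
  have -> : (fun w => incr j s s w ^+ 2) = (fun=> 0).
    by apply/funext => w; rewrite incrxx expr0n.
  by rewrite subrr Ex_cst; split=> //; exact: intble_cst.
have h : (\int[P]_w (incr j s t w ^+ 2)%:E = (t - s)%:E)%E.
  rewrite (incr_law _ s0 st (mXn 2)).
    by rewrite (normal_prob_moment2 (sqrt_gt0 st)) sqr_sqrtr// subr_ge0 ltW.
  by move=> x; rewrite lee_fin sqr_ge0.
split; last by rewrite /Rintegral h.
apply/integrableP; split; first exact/measurable_EFinP/measurable_funX.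
by under eq_integral do rewrite /= ger0_norm ?sqr_ge0//; rewrite h ltry.
Qed.

Lemma incr_moment4 j s t : 0 <= s -> s <= t ->
  intble (fun w => incr j s t w ^+ 4) /\
  Ex (fun w => incr j s t w ^+ 4) <= 3 * (t - s) ^+ 2.
Proof.
move=> s0; rewrite le_eqVlt => /predU1P[<-|st].
  have -> : (fun w => incr j s s w ^+ 4) = (fun=> 0).
    by apply/funext => w; rewrite incrxx expr0n.
  by rewrite subrr Ex_cst expr0n mulr0; split=> //; exact: intble_cst.
have x40 (x : R) : 0 <= x ^+ 4 by rewrite (exprM x 2 2) sqr_ge0.
have h : (\int[P]_w (incr j s t w ^+ 4)%:E <= (3 * (t - s) ^+ 2)%:E)%E.
  rewrite (incr_law _ s0 st (mXn 4)); last by move=> x; rewrite lee_fin.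
  apply: (le_trans (normal_prob_moment4 (sqrt_gt0 st))).
  by rewrite (exprM _ 2 2) sqr_sqrtr// subr_ge0 ltW.
have i4 : intble (fun w => incr j s t w ^+ 4).
  apply/integrableP; split; first exact/measurable_EFinP/measurable_funX.
  under eq_integral do rewrite /= ger0_norm//.
  by rewrite (le_lt_trans h)// ltry.
by split=> //; rewrite -lee_fin Ex_EFin.
Qed.

Lemma intble_incr j s t : 0 <= s -> s <= t -> intble (incr j s t).
Proof. by move=> s0 st; apply: intble_sqr => //; have [] := incr_moment2 j s0 st. Qed.

Lemma Ex_incr j s t : 0 <= s -> s <= t -> Ex (incr j s t) = 0.
Proof.
move=> s0; rewrite le_eqVlt => /predU1P[<-|st].
  have -> : (fun w => incr j s s w) = (fun=> 0).
    by apply/funext => w; rewrite incrxx.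
  by rewrite Ex_cst.
have [/(_ j)[_ hlaw _ _] _] := hB.
pose X := @mfun_Sub _ _ Omega (measurableTypeR R) (incr j s t)
  (mem_set (measurable_incr j s t)).
rewrite /Rintegral; have -> : (\int[P]_w (incr j s t w)%:E = 0)%E; last by [].
rewrite -(normal_prob_odd (sqrt_gt0 st)).
transitivity (\int[distribution P X]_x x%:E)%E.
  rewrite (integral_distribution (X := X))//=.
  exact: intble_incr (ltW st).
apply: eq_measure_integral => A mA _; exact: hlaw.
Qed.

Lemma indep_incr j s t (Z : Omega -> R) (phi : R -> R) : 0 <= s -> s < t ->
  measurable_wrt (past_and_others B j s) Z -> measurable_fun setT phi ->
  indep_rv P Z (fun w => phi (incr j s t w)).
Proof.
move=> s0 st mZ mphi A C mA mC.
have h := @increment_indep _ _ _ _ _ B hB j s t s0 st; apply: h.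
  by apply: mZ; exists A => //; rewrite setTI.
exists (phi @^-1` C); last by rewrite setTI.
by rewrite -[X in measurable X]setTI; exact: mphi.
Qed.

(** Martingale property of the [j]-th motion, even after enlarging the past
    with the other motions. *)
Lemma Ex_past_incr j s t (Z : Omega -> R) : 0 <= s -> s <= t ->
  measurable_wrt (past_and_others B j s) Z -> intble Z ->
  intble (fun w => Z w * incr j s t w) /\ Ex (fun w => Z w * incr j s t w) = 0.
Proof.
move=> s0; rewrite le_eqVlt => /predU1P[<-|st] mZ iZ.
  have -> : (fun w => Z w * incr j s s w) = (fun=> 0).
    by apply/funext => w; rewrite incrxx mulr0.
  by rewrite Ex_cst; split=> //; exact: intble_cst.
have ind := @indep_incr j s t Z id s0 st mZ (@measurable_id _ _ _).
have [i1 ->] := intble_indep_mul ind iZ (intble_incr j s0 (ltW st)).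
by rewrite (Ex_incr j s0 (ltW st)) mulr0.
Qed.

Lemma Ex_past_incr2 j s t (Z : Omega -> R) : 0 <= s -> s <= t ->
  measurable_wrt (past_and_others B j s) Z -> intble Z ->
  intble (fun w => Z w * incr j s t w ^+ 2) /\
  Ex (fun w => Z w * incr j s t w ^+ 2) = (t - s) * Ex Z.
Proof.
move=> s0; rewrite le_eqVlt => /predU1P[<-|st] mZ iZ.
  have -> : (fun w => Z w * incr j s s w ^+ 2) = (fun=> 0).
    by apply/funext => w; rewrite incrxx expr0n mulr0.
  by rewrite Ex_cst subrr mul0r; split=> //; exact: intble_cst.
have [i2 E2] := incr_moment2 j s0 (ltW st).
have mX : measurable_fun setT (fun x : R => x ^+ 2) by exact: measurable_funX.
have ind := @indep_incr j s t Z _ s0 st mZ mX.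
by have [i1 ->] := intble_indep_mul ind iZ i2; rewrite E2 mulrC.
Qed.

Lemma wrt_past j s (Z : Omega -> R) : measurable_wrt (natural_filtration B s) Z ->
  measurable_wrt (past_and_others B j s) Z.
Proof. by apply: wrtS; exact: natural_filtration_past_and_others. Qed.

Lemma wrt_later s t (Z : Omega -> R) : s <= t ->
  measurable_wrt (natural_filtration B s) Z ->
  measurable_wrt (natural_filtration B t) Z.
Proof. by move=> st; apply: wrtS; exact: natural_filtrationS. Qed.

Let filtM s (X Y : Omega -> R) : measurable_wrt (natural_filtration B s) X ->
  measurable_wrt (natural_filtration B s) Y ->
  measurable_wrt (natural_filtration B s) (fun w => X w * Y w).
Proof. by apply: wrtM; exact: natural_filtration_sigma. Qed.

(** For distinct motions the second increment is independent of a past that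
    contains the first one. For a single motion the longer increment splits at
    the end of the shorter one, and the part after that time contributes 0. *)
Lemma Ex_incr_incr j k c b e (Z : Omega -> R) : 0 <= c -> c <= b -> c <= e ->
  measurable_wrt (natural_filtration B c) Z -> intble Z ->
  intble (fun w => Z w * incr j c b w * incr k c e w) /\
  Ex (fun w => Z w * incr j c b w * incr k c e w) =
    (j == k)%:R * Num.min (b - c) (e - c) * Ex Z.
Proof.
move=> c0 cb ce mZ iZ; case: (eqVneq j k) => [<-|jk]; last first.
  have [i1 _] := Ex_past_incr c0 cb (@wrt_past j _ _ mZ) iZ.
  rewrite !mul0r; apply: Ex_past_incr => //.
  apply: wrtM; first exact: past_and_others_sigma.
    exact: wrt_past.
  by apply: incr_past_and_others => //; exact: le_trans c0 cb.
rewrite mul1r; wlog be : b e cb ce / b <= e.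
  move=> wl; have [be|/ltW be] := leP b e; first exact: wl.
  have [h1 h2] := wl e b ce cb be; rewrite minC -h2.
  have E : (fun w => Z w * incr j c b w * incr j c e w) =
           (fun w => Z w * incr j c e w * incr j c b w).
    by apply/funext => w; rewrite mulrAC.
  by rewrite E.
rewrite min_l ?lerD2r//.
have b0 := le_trans c0 cb.
have [i1 E1] := Ex_past_incr2 c0 cb (@wrt_past j _ _ mZ) iZ.
have [i2 _] := Ex_past_incr c0 cb (@wrt_past j _ _ mZ) iZ.
have mZi : measurable_wrt (past_and_others B j b) (fun w => Z w * incr j c b w).
  apply: wrt_past; apply: filtM.
    exact: (wrt_later cb).
  exact: incr_wrt.
have [i3 E3] := Ex_past_incr b0 be mZi i2.
have E : (fun w => Z w * incr j c b w * incr j c e w) =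
  (fun w => Z w * incr j c b w ^+ 2 + Z w * incr j c b w * incr j b e w).
  by apply/funext => w; rewrite -(incrD j c b e); ring.
by rewrite E; split; [exact: intbleD|rewrite ExD// E1 E3 addr0].
Qed.

End increments.

(** * Elementary integrals and their isometry *)

Section elementary_integrands.
Context (d0 : measure_display) (Omega : measurableType d0) (R : realType).
Variables (P : probability Omega R) (d : nat) (B : 'I_d -> R -> {RV P >-> R}).
Local Notation intble X := (P.-integrable [set: Omega] (EFin \o X)).
Local Notation Ex X := (\int[P]_w X w)%R.
Local Notation mu := (@lebesgue_measure R).

(** Lists of blocks replace simple processes because blocks may overlap: the
    difference of two elementary integrals is then a concatenation, and no
    common refinement of partitions has to be formed. *)
Record block := Block {
  block_lo : R;
  block_hi : R;
  block_dim : 'I_d;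
  block_coef : Omega -> R;
  block_lo_ge0 : 0 <= block_lo;
  block_le : block_lo <= block_hi;
  block_adapted : measurable_wrt (natural_filtration B block_lo) block_coef;
  block_bounded : exists K : R, forall w, `|block_coef w| <= K }.

Definition block_integral e w : R :=
  block_coef e w * incr B (block_dim e) (block_lo e) (block_hi e) w.

Definition block_indic e (s : R) : R :=
  \1_(`[block_lo e, block_hi e[%classic : set R) s.

Definition block_value e (j : 'I_d) (s : R) (w : Omega) : R :=
  (block_dim e == j)%:R * block_indic e s * block_coef e w.

(** The length of the intersection of the two time intervals. *)
Definition overlap (e e' : block) : R :=
  Num.max 0 (Num.min (block_hi e) (block_hi e') -
             Num.max (block_lo e) (block_lo e')).

Definition elem_integral (l : seq block) w : R := \sum_(e <- l) block_integral e w.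

Definition elem_value (l : seq block) j s w : R :=
  \sum_(e <- l) block_value e j s w.

Lemma block_coef_measurable e : measurable_fun setT (block_coef e).
Proof.
apply: wrt_measurable (block_adapted (b := e)).
exact: natural_filtration_measurable.
Qed.
#[local] Hint Resolve block_coef_measurable : core.

Lemma intble_block_coefM e e' : intble (fun w => block_coef e w * block_coef e' w).
Proof.
apply: intble_bounded_mul; [exact: block_coef_measurable|exact: block_bounded|].
have -> : block_coef e' = (fun w => block_coef e' w * 1).
  by apply/funext => w; rewrite mulr1.
apply: intble_bounded_mul; [exact: block_coef_measurable|exact: block_bounded|].
exact: intble_cst.
Qed.

Section isometry.
Hypothesis hB : brownian_motion B.

(** Splitting the earlier block at the start of the later one reduces the
    product to increments over the common part. *)
Lemma Ex_block_integralM e e' :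
  intble (fun w => block_integral e w * block_integral e' w) /\
  Ex (fun w => block_integral e w * block_integral e' w) =
  (block_dim e == block_dim e')%:R * overlap e e' *
    Ex (fun w => block_coef e w * block_coef e' w).
Proof.
wlog ee' : e e' / block_lo e <= block_lo e'.
  move=> wl; have [ee'|/ltW ee'] := leP (block_lo e) (block_lo e'); first exact: wl.
  have [h1 h2] := wl e' e ee'.
  have E : (fun w => block_integral e w * block_integral e' w) =
      (fun w => block_integral e' w * block_integral e w).
    by apply/funext => w; rewrite mulrC.
  rewrite E; split=> //; rewrite h2 eq_sym /overlap minC [Num.max (block_lo e') _]maxC.
  congr (_ * _).
  by apply: eq_Rintegral => w _; rewrite mulrC.
rewrite /block_integral /overlap (max_r ee').
case: e e' ee' => a b j x /= a0 ab mx bx [c e k y /= c0 ce my byy] ac.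
have mx' : measurable_wrt (natural_filtration B c) x by exact: (wrt_later ac).
have sF := natural_filtration_sigma B c.
have mFm := @natural_filtration_measurable _ _ _ _ _ B c.
have mX := wrt_measurable mFm mx'; have mY := wrt_measurable mFm my.
have iy : intble y.
  have -> : y = (fun w => y w * 1) by apply/funext => w; rewrite mulr1.
  by apply: intble_bounded_mul => //; exact: intble_cst.
have ixy : intble (fun w => x w * y w) by exact: intble_bounded_mul.
have mxy : measurable_wrt (natural_filtration B c) (fun w => x w * y w) by exact: wrtM.
have step u : a <= u -> u <= c ->
    intble (fun w => x w * y w * incr B j a u w) /\
    measurable_wrt (natural_filtration B c) (fun w => x w * y w * incr B j a u w).
  move=> au uc; split; last first.
    apply: wrtM => //; apply: incr_wrt => //; exact: le_trans a0 au.
  have -> : (fun w => x w * y w * incr B j a u w) =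
            (fun w => x w * (y w * incr B j a u w)).
    by apply/funext => w; rewrite mulrA.
  apply: intble_bounded_mul => //; apply: intble_bounded_mul => //.
  exact: intble_incr.
have [bc|/ltW cb] := leP b c.
  have -> : (fun w => x w * incr B j a b w * (y w * incr B k c e w)) =
            (fun w => x w * y w * incr B j a b w * incr B k c e w).
    by apply/funext => w; rewrite mulrACA mulrA.
  have [i1 m1] := step b ab bc.
  have [i2 ->] := Ex_past_incr hB c0 ce (@wrt_past _ _ _ _ _ _ k _ _ m1) i1.
  by split=> //; rewrite max_l ?mulr0 ?mul0r// subr_le0 ge_min bc.
have -> : (fun w => x w * incr B j a b w * (y w * incr B k c e w)) =
  (fun w => x w * y w * incr B j a c w * incr B k c e w +
            x w * y w * incr B j c b w * incr B k c e w).
  by apply/funext => w; rewrite -(incrD B j a c b); ring.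
have [i1 m1] := step c ac (lexx c).
have [i2 E2] := Ex_past_incr hB c0 ce (@wrt_past _ _ _ _ _ _ k _ _ m1) i1.
have [i3 E3] := Ex_incr_incr hB j k c0 cb ce mxy ixy.
split; first exact: intbleD.
rewrite ExD// E2 E3 add0r max_r; last by rewrite subr_ge0 le_min cb ce.
by congr (_ * _ * _); rewrite -addr_minl.
Qed.

Lemma elem_integral_sqrE l :
  intble (fun w => elem_integral l w ^+ 2) /\
  Ex (fun w => elem_integral l w ^+ 2) =
  \sum_(e <- l) \sum_(e' <- l) (block_dim e == block_dim e')%:R * overlap e e' *
    Ex (fun w => block_coef e w * block_coef e' w).
Proof.
have -> : (fun w => elem_integral l w ^+ 2) =
  (fun w => \sum_(e <- l) \sum_(e' <- l) block_integral e w * block_integral e' w).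
  apply/funext => w; rewrite expr2 /elem_integral big_distrl/=.
  by apply: eq_bigr => e _; rewrite big_distrr.
have i1 e : intble (fun w => \sum_(e' <- l) block_integral e w * block_integral e' w).
  by apply: intble_sum => e'; have [] := Ex_block_integralM e e'.
split; first exact: intble_sum.
rewrite Ex_sum//; apply: eq_bigr => e _; rewrite Ex_sum.
  by apply: eq_bigr => e' _; have [] := Ex_block_integralM e e'.
by move=> e'; have [] := Ex_block_integralM e e'.
Qed.

End isometry.

Let overlapE e e' :
  (\int[mu]_s (block_indic e s * block_indic e' s)%:E = (overlap e e')%:E)%E.
Proof.
rewrite /block_indic /overlap.
have E s : \1_(`[block_lo e, block_hi e[%classic : set R) s *
           \1_(`[block_lo e', block_hi e'[%classic : set R) s =
  \1_(`[Num.max (block_lo e) (block_lo e'),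
        Num.min (block_hi e) (block_hi e')[%classic : set R) s :> R.
  rewrite !indicE -natrM mulnb; congr (nat_of_bool _)%:R; rewrite -in_setI.
  congr (s \in _); apply/seteqP; split=> u /=; rewrite !in_itv/= ge_max lt_min.
    by move=> [/andP[-> ->] /andP[-> ->]].
  by move=> /andP[/andP[-> ->] /andP[-> ->]].
under eq_integral do rewrite E.
rewrite integral_indic//= setIT
  lebesgue_measure_itv/=.
rewrite lte_fin -EFinB; case: ifPn => [h|]; last rewrite -leNgt => h.
  by rewrite [Num.max 0 _]max_r// subr_ge0 ltW.
by rewrite [Num.max 0 _]max_l// subr_le0.
Qed.

Let intble_indicM e e' :
  mu.-integrable setT (EFin \o (fun s => block_indic e s * block_indic e' s)).
Proof.
apply/integrableP; split.
  by apply/measurable_EFinP; apply: measurable_funM; exact: measurable_indic.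
under eq_integral do rewrite /= ger0_norm ?mulr_ge0//.
by rewrite overlapE ltry.
Qed.

Lemma elem_value_sqr_integral l j w :
  (\int[mu]_s (elem_value l j s w ^+ 2)%:E =
   (\sum_(e <- l) \sum_(e' <- l) ((block_dim e == j) && (block_dim e' == j))%:R *
      overlap e e' * (block_coef e w * block_coef e' w))%:E)%E.
Proof.
have -> : (fun s => (elem_value l j s w ^+ 2)%:E) =
  (fun s => \sum_(e <- l) \sum_(e' <- l)
     (((block_dim e == j) && (block_dim e' == j))%:R *
      (block_coef e w * block_coef e' w))%:E *
      (block_indic e s * block_indic e' s)%:E)%E.
  apply/funext => s; rewrite expr2 /elem_value big_distrl/= -sumEFin.
  apply: eq_bigr => e _; rewrite big_distrr/= -sumEFin.
  apply: eq_bigr => e' _; rewrite -EFinM -mulnb natrM /block_value; congr EFin.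
  ring.
rewrite integral_sum//; last first.
  by move=> e; apply: integrable_sum => // e' _; apply: integrableZl => //; exact: intble_indicM.
rewrite -sumEFin; apply: eq_bigr => e _.
rewrite integral_sum//; last first.
  by move=> e'; apply: integrableZl => //; exact: intble_indicM.
rewrite -sumEFin; apply: eq_bigr => e' _.
by rewrite integralZl//; [rewrite overlapE -EFinM mulrAC|exact: intble_indicM].
Qed.

(** Both sides expand into the same double sum over pairs of blocks, weighted by
    [overlap]: the left side by [Ex_block_integralM], the right side by
    integrating products of indicators. *)
Lemma elem_isometry : brownian_motion B -> forall l,
  intble (fun w => elem_integral l w ^+ 2) /\
  (\int[P]_w (elem_integral l w ^+ 2)%:E =
   \sum_(j < d) \int[P]_w \int[mu]_s (elem_value l j s w ^+ 2)%:E)%E.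
Proof.
move=> hB l; have [i1 E1] := elem_integral_sqrE hB l; split=> //.
rewrite -Ex_EFin// E1.
transitivity (\sum_(j < d) (\sum_(e <- l) \sum_(e' <- l)
    ((block_dim e == j) && (block_dim e' == j))%:R * overlap e e' *
    Ex (fun w => block_coef e w * block_coef e' w))%:E)%E; last first.
  apply: eq_bigr => j _.
  under eq_integral do rewrite elem_value_sqr_integral.
  have i2 e e' : intble (fun w => ((block_dim e == j) && (block_dim e' == j))%:R *
      overlap e e' * (block_coef e w * block_coef e' w)).
    by apply: intbleZ; exact: intble_block_coefM.
  have i3 e : intble (fun w => \sum_(e' <- l) ((block_dim e == j) && (block_dim e' == j))%:R *
      overlap e e' * (block_coef e w * block_coef e' w)) by exact: intble_sum.
  rewrite -Ex_EFin; last exact: intble_sum.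
  rewrite Ex_sum//; congr EFin; apply: eq_bigr => e _; rewrite Ex_sum//.
  by apply: eq_bigr => e' _; rewrite ExZ//; exact: intble_block_coefM.
rewrite sumEFin; congr EFin; rewrite [RHS]exchange_big; apply: eq_bigr => e _ /=.
rewrite [RHS]exchange_big; apply: eq_bigr => e' _ /=.
rewrite -mulr_suml -mulr_suml; congr (_ * _ * _).
rewrite (bigD1 (block_dim e))//= eqxx/= eq_sym big1 ?addr0// => j /negbTE je.
by rewrite eq_sym je.
Qed.

End elementary_integrands.

(** * Mean square estimates *)

Section square_integrals.
Context (d : measure_display) (T : measurableType d) (R : realType).
Variable mu : {measure set T -> \bar R}.
Implicit Types F u r : T -> R.

Definition sqint F : \bar R := (\int[mu]_x (F x ^+ 2)%:E)%E.

Lemma sqint_ge0 F : (0 <= sqint F)%E.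
Proof. by apply: integral_ge0 => x _; rewrite lee_fin sqr_ge0. Qed.

Lemma sqintN F : sqint (fun x => - F x) = sqint F.
Proof. by apply: eq_integral => x _; rewrite sqrrN. Qed.

Lemma measurable_sqr F : measurable_fun setT F ->
  measurable_fun setT (fun x => (F x ^+ 2)%:E).
Proof. by move=> mF; apply/measurable_EFinP; exact: measurable_funX. Qed.

(** Replaces Minkowski's inequality and avoids square roots. The factor
    [1 + delta] tends to 1, so that exact isometries survive passing to limits. *)
Lemma sqint_le F u r1 r2 (delta : R) : 0 < delta ->
  measurable_fun setT u -> measurable_fun setT r1 -> measurable_fun setT r2 ->
  (forall x, F x = u x + r1 x + r2 x) ->
  (sqint F <= (1 + delta)%:E * sqint u +
              (2 * (1 + delta^-1))%:E * (sqint r1 + sqint r2))%E.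
Proof.
move=> delta0 mu0 mr1 mr2 FE.
have c1 : 0 <= 1 + delta by rewrite addr_ge0// ltW.
have c2 : 0 <= 2 * (1 + delta^-1) by rewrite mulr_ge0// addr_ge0// invr_ge0 ltW.
have mF : measurable_fun setT F.
  have -> : F = (fun x => u x + r1 x + r2 x) by exact/funext.
  by apply: measurable_funD => //; exact: measurable_funD.
have nn G x : (0 <= (G x ^+ 2)%:E :> \bar R)%E by rewrite lee_fin sqr_ge0.
rewrite /sqint -ge0_integralD//; try exact: measurable_sqr.
rewrite -ge0_integralZl//; try exact: measurable_sqr.
rewrite -ge0_integralZl//; last 2 first.
- by apply: emeasurable_funD; exact: measurable_sqr.
- by move=> x _; rewrite adde_ge0.
rewrite -ge0_integralD//; last first.
- apply: emeasurable_funM => //; apply: emeasurable_funD; exact: measurable_sqr.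
- by move=> x _; rewrite mule_ge0// adde_ge0.
- by apply: emeasurable_funM => //; exact: measurable_sqr.
- by move=> x _; rewrite mule_ge0.
apply: ge0_le_integral => //.
- exact: measurable_sqr.
- by apply: emeasurable_funD; apply: emeasurable_funM => //;
    (try apply: emeasurable_funD); exact: measurable_sqr.
move=> x _; rewrite -!EFinD lee_fin FE -addrA.
set r := r1 x + r2 x.
have h1 : (u x + r) ^+ 2 <= (1 + delta) * u x ^+ 2 + (1 + delta^-1) * r ^+ 2.
  rewrite -subr_ge0.
  have -> : (1 + delta) * u x ^+ 2 + (1 + delta^-1) * r ^+ 2 - (u x + r) ^+ 2 =
            delta * (u x - delta^-1 * r) ^+ 2.
    by field; rewrite lt0r_neq0.
  by rewrite mulr_ge0 ?sqr_ge0// ltW.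
apply: (le_trans h1); rewrite lerD2l [2 * _]mulrC -mulrA ler_wpM2l//.
  by rewrite addr_ge0// invr_ge0 ltW.
by rewrite /r; have := sqr_ge0 (r1 x - r2 x); nra.
Qed.

Lemma sqint_le2 F r1 r2 :
  measurable_fun setT r1 -> measurable_fun setT r2 ->
  (forall x, F x = r1 x + r2 x) ->
  (sqint F <= 4%:E * (sqint r1 + sqint r2))%E.
Proof.
move=> mr1 mr2 FE.
have := @sqint_le F (fun=> 0) r1 r2 1 ltr01 (measurable_cst _) mr1 mr2.
rewrite invr1 -(_ : 4 = 2 * (1 + 1) :> R); last by ring.
have -> : sqint (fun=> 0) = 0%E.
  by rewrite /sqint; under eq_integral do rewrite expr0n; exact: integral0.
by rewrite mule0 add0e; apply => x; rewrite add0r.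
Qed.

End square_integrals.

(** Passing to the limit in two nested applications of [sqint_le]. *)
Lemma le_of_quasi_le (R : realType) (a b : \bar R) : (0 <= b)%E ->
  (forall delta eps : R, (0 < delta)%R -> (0 < eps)%R ->
     a <= (1 + delta)%:E *
            ((1 + delta)%:E * b + (2 * (1 + delta^-1))%:E * eps%:E) +
          (2 * (1 + delta^-1))%:E * eps%:E)%E ->
  (a <= b)%E.
Proof.
case: b => [b| |]//; last by move=> _ _; rewrite leey.
rewrite lee_fin => b0 ab; apply/lee_addgt0Pr => e e0.
(* For [delta <= 1] the bound exceeds [b] by at most [3 * delta * b] from the
   factor [(1 + delta) ^ 2] and [3 * delta] from the additive terms. *)
pose delta := Num.min 1 (e / (3 * b + 3)).
have b3 : 0 < 3 * b + 3 by lra.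
have delta0 : 0 < delta by rewrite lt_min ltr01 divr_gt0.
have delta1 : delta <= 1 by rewrite ge_min lexx.
have deltae : delta * (3 * b + 3) <= e.
  by rewrite -ler_pdivlMr// ge_min lexx orbT.
pose C := 2 * (1 + delta^-1).
have C0 : 0 < C by rewrite mulr_gt0// addr_gt0// invr_gt0.
apply: (le_trans (ab delta (delta / C) delta0 (divr_gt0 delta0 C0))).
rewrite -/C -!EFinD lee_fin.
rewrite [C * _]mulrC divfK ?lt0r_neq0//.
have : 0 <= delta * b by rewrite mulr_ge0// ltW.
have : delta * delta <= delta by rewrite ler_piMr// ltW.
have : delta * delta * b <= delta * b by rewrite ler_wpM2r// ler_piMr// ltW.
nra.
Qed.

Section convergence_to_zero.
Context (R : realType) (I : Type) (F : set_system I).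
Implicit Types f : I -> \bar R.

Lemma cvge0_near_lt f : Filter F -> f @ F --> 0%E ->
  forall eps : R, 0 < eps -> \forall x \near F, (f x < eps%:E)%E.
Proof. by move=> FF f0 eps eps0; exact: (f0 _ (nbhs_open_ereal_lt (f := fun=> eps) eps0)). Qed.

Lemma near_le_cvge0 f : Filter F -> (forall x, (0 <= f x)%E) ->
  (forall eps : R, 0 < eps -> \forall x \near F, (f x <= eps%:E)%E) -> f @ F --> 0%E.
Proof.
move=> FF f0 h; apply/fine_cvgP; split.
  apply: filterS (h 1 ltr01) => x fx1.
  by rewrite ge0_fin_numE// (le_lt_trans fx1)// ltry.
apply/cvgrPdist_le => eps eps0; apply: filterS (h eps eps0) => x fx.
rewrite sub0r normrN /= ger0_norm ?fine_ge0// -lee_fin fineK//.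
by rewrite ge0_fin_numE// (le_lt_trans fx)// ltry.
Qed.

End convergence_to_zero.

(** * The closure of the elementary integral *)

Section ito_limits.
Context (d0 : measure_display) (Omega : measurableType d0) (R : realType).
Variables (P : probability Omega R) (d : nat) (B : 'I_d -> R -> {RV P >-> R}).
Hypothesis hB : brownian_motion B.
Local Notation mu := (@lebesgue_measure R).
Local Notation block := (block B).

Definition jointly_measurable (f : R -> Omega -> R) :=
  measurable_fun setT (fun z : Omega * measurableTypeR R => f z.2 z.1).

Lemma iterated_sqintE (f : R -> Omega -> R) : jointly_measurable f ->
  (\int[P]_w \int[mu]_s (f s w ^+ 2)%:E =
   sqint (P \x mu)%E (fun z => f z.2 z.1))%E.
Proof.
move=> mf; rewrite /sqint fubini_tonelli1//; first exact: measurable_sqr.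
by move=> z; rewrite lee_fin sqr_ge0.
Qed.

Lemma jointly_measurable_cst (g : R -> R) : measurable_fun setT g ->
  jointly_measurable (fun s _ => g s).
Proof. by move=> mg; apply: (measurableT_comp mg). Qed.

Lemma elem_value_jointly_measurable (l : seq block) j :
  jointly_measurable (elem_value l j).
Proof.
rewrite /jointly_measurable /elem_value; apply: measurable_sum => e.
apply: measurable_funM.
  apply: measurable_funM => //; rewrite /block_indic.
  by apply: measurableT_comp => //; exact: measurable_indic.
by apply: measurableT_comp => //; exact: block_coef_measurable.
Qed.

Lemma elem_integral_measurable (l : seq block) : measurable_fun setT (elem_integral l).
Proof.
apply: measurable_sum => e; apply: measurable_funM.
  exact: block_coef_measurable.
exact: measurable_incr.
Qed.

Let neg_adapted (e : block) :
  measurable_wrt (natural_filtration B (block_lo e)) (fun w => - block_coef e w).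
Proof.
have -> : (fun w => - block_coef e w) = (fun w => 0 - block_coef e w).
  by apply/funext => w; rewrite sub0r.
apply: wrtB; first exact: natural_filtration_sigma.
  by apply: wrt_cst; exact: natural_filtration_sigma.
exact: block_adapted.
Qed.

Let neg_bounded (e : block) : exists K : R, forall w, `|- block_coef e w| <= K.
Proof. by have [K h] := block_bounded e; exists K => w; rewrite normrN. Qed.

Definition neg_block (e : block) : block :=
  Block (block_dim e) (block_lo_ge0 e) (block_le e)
    (@neg_adapted e) (@neg_bounded e).

Definition elem_sub (l l' : seq block) := l ++ map neg_block l'.

Lemma elem_integralB (l l' : seq block) w :
  elem_integral (elem_sub l l') w = elem_integral l w - elem_integral l' w.
Proof.
rewrite /elem_integral big_cat/= big_map -sumrN; congr (_ + _).
by apply: eq_bigr => e _; rewrite /block_integral/= mulNr.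
Qed.

Lemma elem_valueB (l l' : seq block) j s w :
  elem_value (elem_sub l l') j s w = elem_value l j s w - elem_value l' j s w.
Proof.
rewrite /elem_value big_cat/= big_map -sumrN; congr (_ + _).
by apply: eq_bigr => e _; rewrite /block_value/= mulrN.
Qed.

Definition integrand_dist (l : seq block) (g : 'I_d -> R -> R) : \bar R :=
  (\sum_(j < d) \int[P]_w \int[mu]_s ((elem_value l j s w - g j s) ^+ 2)%:E)%E.

(** The closure of the graph of the elementary integral for mean square
    distances; a relation, because integrals are unique only up to null sets.
    The integrand lives on the whole half line: the integral over [0, T] is the
    one of an integrand that vanishes outside [0, T], so that integrals over
    different horizons are compared by one isometry. *)
Definition ito_limit (g : 'I_d -> R -> R) (X : Omega -> R) : Prop :=
  measurable_fun setT X /\ forall eps : R, 0 < eps -> exists l : seq block,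
    (integrand_dist l g <= eps%:E)%E /\
    (sqint P (fun w => elem_integral l w - X w)%R <= eps%:E)%E.

Definition row_sqint (g : 'I_d -> R -> R) : \bar R := (\sum_(j < d) sqint mu (g j))%E.

Lemma row_sqint_ge0 g : (0 <= row_sqint g)%E.
Proof. by apply: sume_ge0 => j _; exact: sqint_ge0. Qed.

Local Notation space := (Omega * measurableTypeR R)%type.
Local Notation nu := (P \x mu)%E.

Let value (l : seq block) j : space -> R := fun z => elem_value l j z.2 z.1.
Let lift (f : R -> R) : space -> R := fun z => f z.2.

Let mvalue l j : measurable_fun setT (value l j).
Proof. exact: elem_value_jointly_measurable. Qed.

Let mlift f : measurable_fun setT f -> measurable_fun setT (lift f).
Proof. exact: jointly_measurable_cst. Qed.

Lemma sqint_prod_cst (g : R -> R) : measurable_fun setT g ->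
  sqint nu (lift g) = sqint mu g.
Proof.
move=> mg; rewrite -(@iterated_sqintE (fun s _ => g s)); last first.
  exact: jointly_measurable_cst.
rewrite integral_cst//= [X in (_ * X)%E](_ : _ = 1%E) ?mule1//.
exact: probability_setT.
Qed.

(** Fubini's theorem leads to square integrals on a product space, where
    [sqint_le] applies. *)
Lemma integrand_distE (l : seq block) g : (forall j, measurable_fun setT (g j)) ->
  integrand_dist l g =
  (\sum_(j < d) sqint nu (fun z => value l j z - lift (g j) z)%R)%E.
Proof.
move=> mg; apply: eq_bigr => j _.
rewrite (@iterated_sqintE (fun s w => elem_value l j s w - g j s))//.
apply: measurable_funB; first exact: elem_value_jointly_measurable.
exact: jointly_measurable_cst.
Qed.

Lemma elem_sub_isometry (l l' : seq block) :
  sqint P (fun w => elem_integral l w - elem_integral l' w) =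
  (\sum_(j < d) sqint nu (fun z => value l j z - value l' j z)%R)%E.
Proof.
have [_ h] := elem_isometry hB (elem_sub l l').
transitivity (\int[P]_w (elem_integral (elem_sub l l') w ^+ 2)%:E)%E.
  by apply: eq_integral => w _; rewrite elem_integralB.
rewrite h; apply: eq_bigr => j _.
rewrite iterated_sqintE; last exact: elem_value_jointly_measurable.
by apply: eq_integral => z _; rewrite elem_valueB.
Qed.

Section two_limits.
Variables (g h : 'I_d -> R -> R) (X Y : Omega -> R).
Hypotheses (mg : forall j, measurable_fun setT (g j))
           (mh : forall j, measurable_fun setT (h j)).
Hypotheses (gX : ito_limit g X) (hY : ito_limit h Y).

Let sum_le (delta : R) (a b c b' : 'I_d -> \bar R) : 0 < delta ->
  (forall j, 0 <= b j)%E -> (forall j, 0 <= c j)%E -> (forall j, 0 <= b' j)%E ->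
  (forall j, a j <= (1 + delta)%:E * b j +
    (2 * (1 + delta^-1))%:E * (c j + b' j))%E ->
  (\sum_(j < d) a j <= (1 + delta)%:E * (\sum_(j < d) b j) +
    (2 * (1 + delta^-1))%:E * (\sum_(j < d) c j + \sum_(j < d) b' j))%E.
Proof.
move=> delta0 b0 c0 b'0 h1.
rewrite -big_split/= !ge0_sume_distrr//; last first.
  by move=> j _; rewrite adde_ge0.
by rewrite -big_split/=; apply: lee_sum => j _; exact: h1.
Qed.

(** The isometry of elementary integrals passes to the closure. Either
    inequality takes two applications of [sqint_le], one for the integrals and
    one for the integrands. *)
Theorem ito_limit_isometry :
  sqint P (fun w => X w - Y w) = row_sqint (fun j s => g j s - h j s).
Proof.
have [mX hX] := gX; have [mY hY'] := hY.
have mI := elem_integral_measurable.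
have approx (eps : R) : 0 < eps -> exists l l',
    [/\ (integrand_dist l g + integrand_dist l' h <= eps%:E)%E &
      (sqint P (fun w => elem_integral l w - X w)%R +
       sqint P (fun w => elem_integral l' w - Y w)%R <= eps%:E)%E].
  move=> eps0; have e2 : 0 < eps / 2 by rewrite divr_gt0.
  have [l [lg lX]] := hX _ e2; have [l' [l'h l'Y]] := hY' _ e2.
  have -> : eps%:E = ((eps / 2)%:E + (eps / 2)%:E)%E by rewrite -EFinD -splitr.
  by exists l, l'; split; [exact: (leeD lg l'h)|exact: (leeD lX l'Y)].
have C0 (delta : R) : 0 < delta -> 0 <= 2 * (1 + delta^-1).
  by move=> h0; rewrite mulr_ge0// addr_ge0// invr_ge0 ltW.
have D0 (delta : R) : 0 < delta -> 0 <= 1 + delta.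
  by move=> h0; rewrite addr_ge0// ltW.
apply/eqP; rewrite eq_le; apply/andP; split; apply: le_of_quasi_le.
- exact: row_sqint_ge0.
- move=> delta eps delta0 eps0; have [l [l' [h1 h2]]] := approx eps eps0.
  apply: (le_trans (@sqint_le _ _ _ P _
    (fun w => elem_integral l w - elem_integral l' w)
    (fun w => - (elem_integral l w - X w)) (fun w => elem_integral l' w - Y w)
    delta delta0 _ _ _ _)).
  + exact: measurable_funB.
  + by apply: measurableT_comp => //; exact: measurable_funB.
  + exact: measurable_funB.
  + by move=> w; ring.
  rewrite sqintN; apply: leeD; last first.
    by apply: lee_wpmul2l => //; rewrite lee_fin C0.
  apply: lee_wpmul2l; first by rewrite lee_fin D0.
  rewrite elem_sub_isometry !integrand_distE// in h1 *.
  have h3 := @sum_le delta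
    (fun j => sqint nu (fun z => value l j z - value l' j z))
    (fun j => sqint mu (fun s => g j s - h j s))
    (fun j => sqint nu (fun z => value l j z - lift (g j) z))
    (fun j => sqint nu (fun z => value l' j z - lift (h j) z))
    delta0.
  apply: (le_trans (h3 _ _ _ _)); try by move=> j; exact: sqint_ge0.
    move=> j; rewrite -(@sqint_prod_cst (fun s => g j s - h j s)); last first.
      exact: measurable_funB.
    rewrite -(sqintN nu (fun z => value l' j z - lift (h j) z)).
    apply: sqint_le => //.
    + by apply: mlift; exact: measurable_funB.
    + by apply: measurable_funB; [exact: mvalue|exact: mlift].
    + apply: measurableT_comp => //.
      by apply: measurable_funB; [exact: mvalue|exact: mlift].
    + by move=> z; rewrite /lift; ring.
  apply: leeD => //; apply: lee_wpmul2l => //.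
  by rewrite lee_fin C0.
- exact: sqint_ge0.
- move=> delta eps delta0 eps0; have [l [l' [h1 h2]]] := approx eps eps0.
  rewrite !integrand_distE// in h1.
  have h3 := @sum_le delta
    (fun j => sqint mu (fun s => g j s - h j s))
    (fun j => sqint nu (fun z => value l j z - value l' j z))
    (fun j => sqint nu (fun z => value l j z - lift (g j) z))
    (fun j => sqint nu (fun z => value l' j z - lift (h j) z))
    delta0.
  apply: (le_trans (h3 _ _ _ _)); try by move=> j; exact: sqint_ge0.
    move=> j; rewrite -(@sqint_prod_cst (fun s => g j s - h j s)); last first.
      exact: measurable_funB.
    rewrite -(sqintN nu (fun z => value l j z - lift (g j) z)).
    apply: sqint_le => //.
    + by apply: measurable_funB; exact: mvalue.
    + apply: measurableT_comp => //.
      by apply: measurable_funB; [exact: mvalue|exact: mlift].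
    + by apply: measurable_funB; [exact: mvalue|exact: mlift].
    + by move=> z; rewrite /lift; ring.
  apply: leeD; last by apply: lee_wpmul2l => //; rewrite lee_fin C0.
  apply: lee_wpmul2l; first by rewrite lee_fin D0.
  rewrite -elem_sub_isometry.
  apply: (le_trans (@sqint_le _ _ _ P _ (fun w => X w - Y w)
    (fun w => elem_integral l w - X w) (fun w => - (elem_integral l' w - Y w))
    delta delta0 _ _ _ _)).
  + exact: measurable_funB.
  + exact: measurable_funB.
  + by apply: measurableT_comp => //; exact: measurable_funB.
  + by move=> w; ring.
  rewrite sqintN; apply: leeD => //.
  by apply: lee_wpmul2l => //; rewrite lee_fin C0.
Qed.

End two_limits.
End ito_limits.

(** * Matrix-valued simple processes *)

Section simple_processes.
Context (d0 : measure_display) (Omega : measurableType d0) (R : realType).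
Variables (P : probability Omega R) (n d : nat) (B : 'I_d -> R -> {RV P >-> R}).
Hypothesis hB : brownian_motion B.
Local Notation mu := (@lebesgue_measure R).
Local Notation block := (block B).

Lemma frobenius_sqr p q (A : 'M[R]_(p, q)) :
  frobenius A ^+ 2 = \sum_i \sum_j A i j ^+ 2.
Proof.
by rewrite sqr_sqrtr// !sumr_ge0// => i _; rewrite sumr_ge0// => j _; rewrite sqr_ge0.
Qed.

Lemma frobenius_ge_entry p q (A : 'M[R]_(p, q)) i j : `|A i j| <= frobenius A.
Proof.
rewrite -sqrtr_sqr ler_sqrt; last first.
  by apply: sumr_ge0 => i' _; apply: sumr_ge0 => j' _; exact: sqr_ge0.
rewrite (bigD1 i)//= (bigD1 j)//= -addrA lerDl addr_ge0 ?sumr_ge0// => [j' _|i' _].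
  exact: sqr_ge0.
by apply: sumr_ge0 => j' _; exact: sqr_ge0.
Qed.

Section rows.
Variables (T : R) (phi : simple_process n B T).
Local Notation m := (sp_size phi).
Local Notation t := (sp_time phi).

Lemma sp_time_mono k k' : (k <= k' <= m)%N -> t k <= t k'.
Proof.
move=> /andP[]; elim: k' => [|k' IH]; first by rewrite leqn0 => /eqP ->.
rewrite leq_eqVlt => /predU1P[<-//|kk' k'm].
by apply: (le_trans (IH kk' (ltnW k'm))); apply/ltW/sp_time_incr.
Qed.

Lemma sp_time_ge0 k : (k <= m)%N -> 0 <= t k.
Proof. by move=> km; rewrite -(sp_time0 phi) sp_time_mono. Qed.

Lemma sp_time_le k : (k <= m)%N -> t k <= T.
Proof. by move=> km; rewrite -[leRHS](sp_timeT phi) sp_time_mono// km/=. Qed.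

Let coef_bounded (i : 'I_n) (k : 'I_m) (j : 'I_d) :
  exists K : R, forall w, `|sp_coef phi k w i j| <= K.
Proof.
have [K hK] := sp_coef_bounded phi; exists K => w.
exact: le_trans (frobenius_ge_entry _ i j) (hK k (ltn_ord k) w).
Qed.

Definition sp_block (i : 'I_n) (kj : 'I_m * 'I_d) : block :=
  Block kj.2 (sp_time_ge0 (ltnW (ltn_ord kj.1)))
    (ltW (sp_time_incr (ltn_ord kj.1)))
    (sp_coef_adapted (ltn_ord kj.1) (a := i) (b := kj.2))
    (coef_bounded i kj.1 kj.2).

(** The isometry is scalar, so a vector-valued integral is studied row by row;
    a row has one block for each interval and each motion. *)
Definition sp_row (i : 'I_n) : seq block :=
  map (sp_block i) (index_enum ('I_m * 'I_d)%type).

Lemma sp_row_integral i w : elem_integral (sp_row i) w = simple_integral phi w i 0.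
Proof.
rewrite /elem_integral big_map /simple_integral summxE.
rewrite (eq_bigr (fun k : 'I_m => \sum_j sp_coef phi k w i j *
  incr B j (t k) (t k.+1) w)); last first.
  by move=> k _; rewrite mxE; apply: eq_bigr => j _; rewrite mxE.
by rewrite pair_bigA; apply: eq_bigr => -[k j] _.
Qed.

Lemma sp_row_value i j s w : elem_value (sp_row i) j s w = simple_value phi s w i j.
Proof.
rewrite /elem_value big_map /simple_value summxE [RHS]big_mkcond/=.
rewrite (eq_bigr (fun kj : 'I_m * 'I_d => (kj.2 == j)%:R *
   ((t kj.1 <= s < t kj.1.+1)%R%:R * sp_coef phi kj.1 w i kj.2))); last first.
  move=> [k j'] _; rewrite /block_value/= /block_indic/= indicE mulrA.
  by rewrite mem_setE in_itv.
rewrite -(pair_bigA _ (fun k j' => (j' == j)%:R *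
   ((t (k : 'I_m) <= s < t k.+1)%R%:R * sp_coef phi k w i j')))/=.
apply: eq_bigr => k _; rewrite (bigD1 j)//= eqxx mul1r big1 ?addr0; last first.
  by move=> j' /negbTE ->; rewrite mul0r.
by case: ifP => _; rewrite ?mul1r ?mul0r.
Qed.

Lemma simple_value_out s w : ~~ (0 <= s < T) -> simple_value phi s w = 0.
Proof.
move=> sT; rewrite /simple_value big1// => k /andP[ks sk].
move: sT; rewrite negb_and -ltNge -leNgt => /orP[s0|Ts].
  by have := le_trans (sp_time_ge0 (ltnW (ltn_ord k))) ks; rewrite leNgt s0.
have := lt_le_trans sk (sp_time_le (ltn_ord k)).
by rewrite ltNge Ts.
Qed.

End rows.

(** The right end point is dropped because simple processes vanish there. *)
(** Half-open at [T], to match the intervals of simple processes. *)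
Definition cut (T : R) (Phi : R -> 'M[R]_(n, d)) (i : 'I_n) (j : 'I_d) : R -> R :=
  (fun s => Phi s i j) \_ `[0, T[.

Definition cut_measurable T Phi := forall i j, measurable_fun setT (cut T Phi i j).

Lemma simple_value_distE T (phi : simple_process n B T) Phi : cut_measurable T Phi ->
  (\int[P]_w \int[mu]_(s in `[0%R, T])
     (frobenius (simple_value phi s w - Phi s) ^+ 2)%:E =
   \sum_i integrand_dist (sp_row phi i) (cut T Phi i))%E.
Proof.
move=> mc.
pose D i j (z : Omega * measurableTypeR R) : R :=
  elem_value (sp_row phi i) j z.2 z.1 - cut T Phi i j z.2.
have mD i j : measurable_fun setT (D i j).
  apply: measurable_funB; first exact: elem_value_jointly_measurable.
  exact: jointly_measurable_cst.
have mS : measurable_fun setT (fun z => (\sum_i \sum_j D i j z ^+ 2)%:E).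
  apply/measurable_EFinP/measurable_sum => i; apply: measurable_sum => j.
  exact: measurable_funX.
transitivity (\int[P \x mu]_z (\sum_i \sum_j D i j z ^+ 2)%:E)%E.
  rewrite fubini_tonelli1; [|exact: mS|]; last first.
    move=> z; rewrite lee_fin sumr_ge0// => i _; rewrite sumr_ge0// => j _.
    exact: sqr_ge0.
  apply: eq_integral => w _.
  have DE s : (0 <= s < T)%R ->
      frobenius (simple_value phi s w - Phi s) ^+ 2 = \sum_i \sum_j D i j (w, s) ^+ 2.
    move=> sT; rewrite frobenius_sqr; apply: eq_bigr => i _; apply: eq_bigr => j _.
    by rewrite /D/= !mxE sp_row_value /cut patchE mem_setE in_itv/= sT.
  have mw : measurable_fun setT (fun s : R => (\sum_i \sum_j D i j (w, s) ^+ 2)%:E).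
    exact: (measurableT_comp mS).
  rewrite -integral_itv_bndo_bndc; last first.
    apply: (eq_measurable_fun (fun s : R => (\sum_i \sum_j D i j (w, s) ^+ 2)%:E)).
      by move=> s; rewrite mem_setE in_itv/= => sT; rewrite DE.
    exact: measurable_funTS.
  rewrite integral_mkcond; apply: eq_integral => s _; rewrite patchE mem_setE in_itv/=.
  case: ifPn => [sT|sT]; first by rewrite DE.
  rewrite big1// => i _; rewrite big1// => j _.
  rewrite /D/= sp_row_value simple_value_out// /cut patchE mem_setE in_itv/=.
  by rewrite (negbTE sT) mxE subr0 expr0n.
under eq_integral do rewrite -sumEFin.
rewrite ge0_integral_sum//; last 2 first.
- by move=> i; apply/measurable_EFinP/measurable_sum => j; exact: measurable_funX.
- by move=> i z _; rewrite lee_fin sumr_ge0// => j _; exact: sqr_ge0.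
apply: eq_bigr => i _; rewrite integrand_distE; last exact: mc.
under eq_integral do rewrite -sumEFin.
rewrite ge0_integral_sum//.
- by move=> j; exact: measurable_sqr.
- by move=> j z _; rewrite lee_fin sqr_ge0.
Qed.

Lemma frobenius_expectationE (X Y : Omega -> 'cV[R]_n) :
  (forall i, measurable_fun setT (fun w => X w i 0)) ->
  (forall i, measurable_fun setT (fun w => Y w i 0)) ->
  ('E_P[fun w => (frobenius (X w - Y w) ^+ 2)%R] =
   \sum_i sqint P (fun w => X w i 0 - Y w i 0)%R)%E.
Proof.
move=> mX mY; rewrite unlock.
transitivity (\int[P]_w (\sum_i ((X w i 0 - Y w i 0) ^+ 2)%:E))%E.
  apply: eq_integral => w _; rewrite frobenius_sqr sumEFin; congr EFin.
  by apply: eq_bigr => i _; rewrite big_ord1 !mxE.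
rewrite ge0_integral_sum//.
  by move=> i; apply: measurable_sqr; exact: measurable_funB.
by move=> i w _; rewrite lee_fin sqr_ge0.
Qed.

Lemma simple_integral_measurable T (phi : simple_process n B T) i :
  measurable_fun setT (fun w => simple_integral phi w i 0).
Proof.
have -> : (fun w => simple_integral phi w i 0) = elem_integral (sp_row phi i).
  by apply/funext => w; rewrite sp_row_integral.
exact: elem_integral_measurable.
Qed.

(** A single good term of the approximating sequence, read row by row, is a
    witness for [ito_limit]. *)
Lemma is_ito_integral_limit T Phi (X : Omega -> 'cV[R]_n) : cut_measurable T Phi ->
  is_ito_integral B T (fun s _ => Phi s) X ->
  forall i, ito_limit B (cut T Phi i) (fun w => X w i 0).
Proof.
move=> mc [_ mX [phi [c1 c2]]] i; split=> // eps eps0.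
have [k [h1 h2]] : exists k,
    ((\int[P]_w \int[mu]_(s in `[0%R, T])
       (frobenius (simple_value (phi k) s w - Phi s) ^+ 2)%:E) <= eps%:E)%E /\
    ('E_P[fun w => (frobenius (simple_integral (phi k) w - X w) ^+ 2)%R] <= eps%:E)%E.
  have [N1 _ n1] : \forall k \near \oo, ((\int[P]_w \int[mu]_(s in `[0%R, T])
       (frobenius (simple_value (phi k) s w - Phi s) ^+ 2)%:E) < eps%:E)%E.
    exact: cvge0_near_lt c1 _ eps0.
  have [N2 _ n2] : \forall k \near \oo, ('E_P[fun w =>
       (frobenius (simple_integral (phi k) w - X w) ^+ 2)%R] < eps%:E)%E.
    exact: cvge0_near_lt c2 _ eps0.
  exists (maxn N1 N2); split; apply/ltW.
    by apply: n1; exact: leq_maxl.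
  by apply: n2; exact: leq_maxr.
exists (sp_row (phi k) i); split.
  apply: le_trans h1; rewrite simple_value_distE// (bigD1 i)//= leeDl//.
  by apply: sume_ge0 => i' _; apply: sume_ge0 => j _; apply: integral_ge0 => w _;
    apply: integral_ge0 => s _; rewrite lee_fin sqr_ge0.
apply: le_trans h2; rewrite frobenius_expectationE//; last first.
  by move=> i'; exact: simple_integral_measurable.
rewrite (bigD1 i)//= -[leLHS]adde0 leeD//.
  apply: le_of_eq; apply: eq_integral => w _.
  by rewrite sp_row_integral.
by apply: sume_ge0 => i' _; exact: sqint_ge0.
Qed.

End simple_processes.

(** * Riemann approximation of continuous integrands *)

Section riemann_approximation.
Context (d0 : measure_display) (Omega : measurableType d0) (R : realType).
Variables (P : probability Omega R) (n d : nat) (B : 'I_d -> R -> {RV P >-> R}).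
Hypothesis hB : brownian_motion B.
Local Notation mu := (@lebesgue_measure R).
Local Notation block := (block B).

(** Heine's theorem; only [s] is confined to the compact interval. *)
Lemma uniform_mesh (f : R -> R) (T eps : R) : continuous f -> 0 <= T -> 0 < eps ->
  \forall N \near \oo, forall s s', 0 <= s <= T ->
    `|s - s'| <= T / N.+1%:R -> `|f s - f s'| <= eps.
Proof.
move=> cf T0 eps0.
pose Q (N : nat) s := forall s', `|s - s'| <= T / N.+1%:R -> `|f s - f s'| <= eps.
have /compact_near_coveringP/(_ nat eventually Q) : compact `[0, T]%classic.
  exact: segment_compact.
move=> h; have {h} : \forall N \near \oo, `[0, T]%classic `<=` Q N.
  apply: h => x _.
  have e2 : 0 < eps / 2 by rewrite divr_gt0.
  have /cvgrPdist_le/(_ _ e2)/nbhs_ballP[r /= r0 hr] := cf x.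
  have r2 : 0 < r / 2 by rewrite divr_gt0.
  have rT : 0 < r / 2 / (T + 1) by rewrite divr_gt0// ltr_wpDl.
  exists (ball x (r / 2), [set N : nat | N.+1%:R^-1 < r / 2 / (T + 1)]).
    split; first exact: nbhsx_ballx.
    exact: (near_infty_natSinv_lt (PosNum rT)).
  move=> [y N] /= [xy hN] s' ys'.
  have xs' : ball x r s'.
    rewrite /ball/= -(subrKA y) (le_lt_trans (ler_normD _ _))// (splitr r).
    rewrite ltr_leD// (le_trans ys')//.
    rewrite ltr_pdivlMr ?ltr_wpDl// in hN.
    apply: le_trans (ltW hN); rewrite mulrC ler_wpM2l//.
    by rewrite lerDl.
  rewrite -(subrKA (f x)) (splitr eps) (le_trans (ler_normD _ _))// lerD//.
    rewrite distrC; apply: hr; apply: le_ball xy.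
    by rewrite ler_pdivrMr// ler_peMr ?ler1n// ltW.
  exact: hr.
by apply: filterS => N hN s s' sT; apply: hN; rewrite /= in_itv.
Qed.

Section process.
Variables (T : R) (T0 : 0 < T) (N : nat) (Phi : R -> 'M[R]_(n, d)).

Let time (k : nat) := T * k%:R / N.+1%:R.

Let time0 : time 0 = 0. Proof. by rewrite /time mulr0 mul0r. Qed.

Let timeT : time N.+1 = T. Proof. by rewrite /time mulfK. Qed.

Let time_incr k : (k < N.+1)%N -> time k < time k.+1.
Proof. by move=> _; rewrite /time ltr_pM2r ?invr_gt0// ltr_pM2l// ltr_nat. Qed.

Let adapted k : (k < N.+1)%N -> forall a b,
  measurable_wrt (natural_filtration B (time k)) (fun w : Omega => Phi (time k) a b).
Proof. by move=> _ a b; apply: wrt_cst; exact: natural_filtration_sigma. Qed.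

Let bounded : exists K : R, forall k, (k < N.+1)%N -> forall w : Omega,
  frobenius (Phi (time k)) <= K.
Proof.
exists (\sum_(k < N.+1) frobenius (Phi (time k))) => k kN _.
rewrite (bigD1 (Ordinal kN))//= lerDl sumr_ge0// => k' _.
exact: sqrtr_ge0.
Qed.

Definition riemann_process : simple_process n B T :=
  SimpleProcess time0 timeT time_incr adapted bounded.

Lemma riemann_value s w : 0 <= s < T -> exists s',
  `|s - s'| <= T / N.+1%:R /\ simple_value riemann_process s w = Phi s'.
Proof.
move=> /andP[s0 sT]; pose x := s * N.+1%:R / T; pose k := Num.truncn x.
have x0 : 0 <= x by apply: divr_ge0; [exact: mulr_ge0|exact: ltW].
have /andP[kx xk] := truncn_itv x0.
have timeE i : (time i <= s) = (i%:R <= x).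
  by rewrite /time /x ler_pdivrMr// ler_pdivlMr// [T * _]mulrC.
have kN : (k < N.+1)%N.
  rewrite -(ltr_nat R); apply: (le_lt_trans kx).
  by rewrite /x ltr_pdivrMr// mulrC ltr_pM2l.
have ks : time k <= s by rewrite timeE.
have sk : s < time k.+1 by rewrite ltNge timeE -ltNge.
exists (time k); split.
  rewrite ger0_norm ?subr_ge0// lerBlDr (le_trans (ltW sk))//.
  by rewrite /time -natr1 mulrDr mulrDl mulr1 addrC.
rewrite /simple_value (big_pred1 (Ordinal kN))// => i /=.
rewrite timeE [s < _]ltNge timeE -ltNge -val_eqE/=.
apply/idP/eqP => [ix|->]; last by rewrite kx xk.
by apply/esym; exact: truncn_def.
Qed.

End process.

(** The horizon 0 leaves no room for a mesh. *)
Definition null_process : simple_process n B 0.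
Proof.
refine (@SimpleProcess _ _ _ _ _ _ B 0 0%N (fun=> 0) (fun _ _ => 0) erefl erefl _ _ _).
- by [].
- by [].
- by exists 0.
Defined.

(** For such lists the distance to a deterministic integrand is a plain Lebesgue
    integral, and [v] is itself an integrand to which the isometry applies. *)
Definition elem_det (l : seq block) (v : 'I_d -> R -> R) :=
  forall j s w, elem_value l j s w = v j s.

(** Provides a sample point at which deterministic values can be read off. *)
Lemma probability_inhabited : exists w : Omega, True.
Proof.
apply: contrapT => h; have PT := probability_setT P.
have E : [set: Omega] = set0 by apply/seteqP; split=> w // _; apply: h; exists w.
by move/eqP: PT; rewrite E measure0 eqe eq_sym oner_eq0.
Qed.

Lemma elem_det_measurable (l : seq block) v j : elem_det l v -> measurable_fun setT (v j).
Proof.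
move=> lv; have [w0 _] := probability_inhabited.
have -> : v j = fun s => elem_value l j s w0 by apply/funext => s; rewrite lv.
apply: measurable_sum => e; apply: measurable_funM => //.
by apply: measurable_funM => //; exact: measurable_indic.
Qed.

Definition entries_continuous (Phi : R -> 'M[R]_(n, d)) :=
  forall i j, continuous (fun s => Phi s i j).

Lemma measurable_patch_itv (T : R) (f : R -> R) : measurable_fun setT f ->
  measurable_fun setT (f \_ `[0, T[%classic).
Proof.
move=> mf; apply: (measurable_restrictT f _).1; first exact: measurable_itv.
exact: measurable_funTS.
Qed.

Lemma cut_measurableW T Phi : entries_continuous Phi -> cut_measurable T Phi.
Proof.
move=> cPhi i j; apply: measurable_patch_itv; apply: continuous_measurable_fun.
exact: cPhi.
Qed.

Lemma riemann_process_approx (T : R) (T0 : 0 < T) Phi (eps : R) :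
  entries_continuous Phi -> 0 < eps -> exists N : nat, forall i,
    exists2 v, elem_det (sp_row (riemann_process T0 N Phi) i) v &
      (integrand_dist (sp_row (riemann_process T0 N Phi) i) (cut T Phi i) <= eps%:E)%E.
Proof.
move=> cPhi eps0.
(* A mesh with oscillation [e] makes squared errors at most [e ^ 2 <= e], and
   [d * T * e] after summation over the columns and integration. *)
pose e := Num.min 1 (eps / (d%:R * T + 1)).
have dT : 0 < d%:R * T + 1 by rewrite ltr_wpDl// mulr_ge0// ltW.
have e0 : 0 < e by rewrite lt_min ltr01 divr_gt0.
have e1 : e <= 1 by rewrite ge_min lexx.
have [N hmesh] : exists N : nat, forall i j s s', 0 <= s <= T ->
    `|s - s'| <= T / N.+1%:R -> `|Phi s i j - Phi s' i j| <= e.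
  have /filter_ex[N h] : \forall N \near \oo, forall (ij : 'I_n * 'I_d) s s',
      0 <= s <= T -> `|s - s'| <= T / N.+1%:R ->
      `|Phi s ij.1 ij.2 - Phi s' ij.1 ij.2| <= e.
    by apply: filter_forall => -[i j]; apply: uniform_mesh => //; exact: ltW.
  by exists N => i j; exact: h (i, j).
have [w0 _] := probability_inhabited.
exists N => i.
exists (fun j s => simple_value (riemann_process T0 N Phi) s w0 i j).
  by move=> j s w; rewrite sp_row_value.
have bnd j s w : ((elem_value (sp_row (riemann_process T0 N Phi) i) j s w -
    cut T Phi i j s) ^+ 2 <= (fun=> e) \_ `[0, T[%classic s).
  rewrite sp_row_value /cut !patchE mem_setE in_itv/=; case: ifPn => sT; last first.
    by rewrite simple_value_out// mxE subr0 expr0n.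
  have [s' [ss' ->]] := riemann_value T0 N Phi w sT.
  rewrite -real_normK ?num_real// distrC.
  have h : `|Phi s i j - Phi s' i j| <= e.
    by apply: hmesh => //; case/andP: sT => -> /ltW ->.
  rewrite (le_trans (_ : _ <= e ^+ 2))//.
    by rewrite lerXn2r// nnegrE// ltW.
  by rewrite expr2 ler_piMr// ltW.
rewrite /integrand_dist (@le_trans _ _ (\sum_(j < d) (e * T)%:E)%E)//; last first.
  rewrite sumEFin lee_fin sumr_const card_ord -mulr_natr -mulrA [T * _]mulrC.
  apply: (@le_trans _ _ (e * (d%:R * T + 1))).
    by rewrite ler_wpM2l ?ltW// ltrDl.
  by rewrite -ler_pdivlMr// ge_min lexx orbT.
apply: lee_sum => j _.
have mD : jointly_measurable (fun s w =>
    elem_value (sp_row (riemann_process T0 N Phi) i) j s w - cut T Phi i j s).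
  apply: measurable_funB; first exact: elem_value_jointly_measurable.
  by apply: jointly_measurable_cst; exact: cut_measurableW.
rewrite iterated_sqintE//.
rewrite (@le_trans _ _ (\int[P \x mu]_z (((fun=> e) \_ `[0%R, T[%classic) z.2)%:E)%E)//.
  apply: ge0_le_integral => //.
  - by move=> z _; rewrite lee_fin sqr_ge0.
  - exact: measurable_sqr.
  - apply/measurable_EFinP; apply: (jointly_measurable_cst (g := (fun=> e) \_ _)).
    exact: measurable_patch_itv.
  - by move=> z _; rewrite lee_fin.
rewrite fubini_tonelli1//; last 2 first.
- apply/measurable_EFinP; apply: (jointly_measurable_cst (g := (fun=> e) \_ _)).
  exact: measurable_patch_itv.
- by move=> z; rewrite lee_fin patchE; case: ifP => // _; exact: ltW.
have E : (\int[mu]_s (((fun=> e) \_ `[0%R, T[%classic) s)%:E = (e * T)%:E)%E.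
  transitivity (\int[mu]_(s in `[0%R, T[) e%:E)%E.
    rewrite [RHS]integral_mkcond; apply: eq_integral => s _.
    by rewrite !patchE; case: ifP.
  by rewrite integral_cst//= lebesgue_measure_itv/= lte_fin T0 sube0.
rewrite /fubini_F/=; under eq_integral do rewrite E.
rewrite integral_cst//= [X in (_ * X)%E](_ : _ = 1%E) ?mule1//.
exact: probability_setT.
Qed.

Lemma riemann_approx (T : R) Phi (eps : R) : 0 <= T -> entries_continuous Phi ->
  0 < eps -> exists phi : simple_process n B T,
    forall i, exists2 v, elem_det (sp_row phi i) v &
      (integrand_dist (sp_row phi i) (cut T Phi i) <= eps%:E)%E.
Proof.
move=> T0 cPhi eps0; move: T0; rewrite le_eqVlt => /predU1P[<-|T0].
  exists null_process => i; exists (fun _ _ => 0).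
    move=> j s w; rewrite sp_row_value simple_value_out ?mxE//.
    by case: leP => //= s0; rewrite -leNgt.
  rewrite /integrand_dist big1 ?lee_fin ?ltW// => j _.
  rewrite integral0_eq// => w _; rewrite integral0_eq// => s _.
  rewrite sp_row_value simple_value_out; last by case: leP => //= s0; rewrite -leNgt.
  rewrite /cut patchE mxE; case: ifPn; last by rewrite subr0 expr0n.
  by rewrite mem_setE in_itv/= => /andP[s0]; rewrite ltNge s0.
have [N hN] := riemann_process_approx T0 cPhi eps0.
by exists (riemann_process T0 N Phi).
Qed.

Lemma ito_limit_closed (g : 'I_d -> R -> R) (X : Omega -> R) :
  (forall j, measurable_fun setT (g j)) -> measurable_fun setT X ->
  (forall eps : R, 0 < eps -> exists (g' : 'I_d -> R -> R) (X' : Omega -> R),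
    [/\ forall j, measurable_fun setT (g' j), ito_limit B g' X',
        (row_sqint (fun j s => (g' j s - g j s)%R) <= eps%:E)%E &
        (sqint P (fun w => X' w - X w)%R <= eps%:E)%E]) ->
  ito_limit B g X.
Proof.
move=> mg mX h; split=> // eps eps0; have e8 : 0 < eps / 8 by rewrite divr_gt0.
have [g' [X' [mg' [mX' hg'] gg' XX']]] := h _ e8.
have [l [lg' lX']] := hg' _ e8; exists l.
have split8 (a b : \bar R) : (a <= (eps / 8)%:E)%E -> (b <= (eps / 8)%:E)%E ->
    (4%:E * (a + b) <= eps%:E)%E.
  move=> ha hb; have -> : eps%:E = (4%:E * ((eps / 8)%:E + (eps / 8)%:E))%E.
    by rewrite -!EFinD; congr EFin; field.
  by apply: lee_wpmul2l => //; exact: leeD.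
split; last first.
  apply: le_trans (split8 _ _ lX' XX').
  apply: (@sqint_le2 _ _ _ P _ (fun w => elem_integral l w - X' w)
    (fun w => X' w - X w)).
  - by apply: measurable_funB => //; exact: elem_integral_measurable.
  - exact: measurable_funB.
  - by move=> w; ring.
apply: le_trans (split8 _ _ lg' gg').
rewrite !integrand_distE// /row_sqint -big_split/= ge0_sume_distrr; last first.
  by move=> j _; rewrite adde_ge0// sqint_ge0.
apply: lee_sum => j _; rewrite -(@sqint_prod_cst _ _ _ P); last exact: measurable_funB.
apply: (@sqint_le2 _ _ _ _ _
  (fun z : Omega * measurableTypeR R => elem_value l j z.2 z.1 - g' j z.2)
  (fun z : Omega * measurableTypeR R => g' j z.2 - g j z.2)).
- apply: measurable_funB; first exact: elem_value_jointly_measurable.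
  exact: jointly_measurable_cst.
- by apply: (jointly_measurable_cst (g := fun s => g' j s - g j s));
    exact: measurable_funB.
- by move=> z; ring.
Qed.

Lemma ito_limit_elem (l : seq block) v : elem_det l v -> ito_limit B v (elem_integral l).
Proof.
move=> lv; split; first exact: elem_integral_measurable.
move=> eps eps0; exists l; split.
  rewrite /integrand_dist big1 ?lee_fin ?ltW// => j _.
  rewrite integral0_eq// => w _; rewrite integral0_eq// => s _.
  by rewrite lv subrr expr0n.
rewrite /sqint integral0_eq ?lee_fin ?ltW// => w _.
by rewrite subrr expr0n.
Qed.

Lemma elem_det_dist (l : seq block) v g : elem_det l v ->
  integrand_dist l g = row_sqint (fun j s => v j s - g j s).
Proof.
move=> lv; apply: eq_bigr => j _.
have -> : (fun w => \int[mu]_s ((elem_value l j s w - g j s) ^+ 2)%:E)%E =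
          (fun w : Omega => sqint mu (fun s => v j s - g j s)).
  by apply/funext => w; apply: eq_integral => s _; rewrite lv.
rewrite integral_cst//= [X in (_ * X)%E](_ : _ = 1%E) ?mule1//.
exact: probability_setT.
Qed.

Lemma elem_det_isometry (l : seq block) v g X : elem_det l v ->
  (forall j, measurable_fun setT (g j)) -> ito_limit B g X ->
  sqint P (fun w => elem_integral l w - X w) = integrand_dist l g.
Proof.
move=> lv mg gX; rewrite (elem_det_dist _ lv).
apply: (ito_limit_isometry hB _ mg (ito_limit_elem lv) gX) => j.
exact: elem_det_measurable lv.
Qed.

Lemma continuous_ito_integrable T Phi : entries_continuous Phi ->
  ito_integrable B T (fun s _ => Phi s).
Proof.
move=> cPhi; split.
- move=> a b; apply: measurable_funTS.
  apply: (measurableT_comp (f := fun s : measurableTypeR R => Phi s a b)) => //.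
  by apply: continuous_measurable_fun; exact: cPhi.
- move=> s _ _ a b; apply: wrt_cst; exact: natural_filtration_sigma.
- rewrite integral_cst//= [X in (_ * X)%E](_ : _ = 1%E) ?mule1; last first.
    exact: probability_setT.
  have : mu.-integrable `[0, T] (EFin \o (fun s => frobenius (Phi s) ^+ 2)).
    apply: continuous_compact_integrable; first exact: segment_compact.
    apply: continuous_subspaceT.
    have -> : (fun s => frobenius (Phi s) ^+ 2) =
        (fun s => \sum_i \sum_j Phi s i j ^+ 2).
      by apply/funext => s; rewrite frobenius_sqr.
    have csum (I : Type) (r : seq I) (F : I -> R -> R) :
        (forall i, continuous (F i)) -> continuous (fun s => \sum_(i <- r) F i s).
      move=> cF; elim: r => [|i r IH] x.
        by under eq_fun do rewrite big_nil; exact: cvg_cst.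
      by under eq_fun do rewrite big_cons; apply: cvgD; [exact: cF|exact: IH].
    apply: (csum _ _ _) => i; apply: (csum _ _ _) => j x.
    apply: (cvg_comp (fun s => Phi s i j) (fun y => y ^+ 2)); first exact: cPhi.
    exact: exprn_continuous.
  move=> /integrableP[_]; apply: le_lt_trans.
  apply: le_of_eq; apply: eq_integral => s _ /=.
  by rewrite ger0_norm// sqr_ge0.
Qed.

(** Converse of [is_ito_integral_limit]: Riemann processes approximate all rows
    of a continuous integrand simultaneously, and by the isometry their
    integrals approximate [X]. *)
Lemma ito_limit_is_ito_integral T Phi (X : Omega -> 'cV[R]_n) : 0 <= T ->
  entries_continuous Phi ->
  (forall i, ito_limit B (cut T Phi i) (fun w => X w i 0)) ->
  is_ito_integral B T (fun s _ => Phi s) X.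
Proof.
move=> T0 cPhi hX; have mc := cut_measurableW T cPhi.
split; [exact: continuous_ito_integrable|by move=> i; have [] := hX i|].
have /choice[phi hphi] : forall k : nat, exists phi : simple_process n B T,
    forall i, exists2 v, elem_det (sp_row phi i) v &
      (integrand_dist (sp_row phi i) (cut T Phi i) <= (k.+1%:R^-1)%:E)%E.
  by move=> k; apply: riemann_approx => //; rewrite invr_gt0.
exists phi.
have to0 : (fun k => \sum_i integrand_dist (sp_row (phi k) i) (cut T Phi i))%E @ \oo
    --> 0%E.
  apply: near_le_cvge0.
    move=> k; apply: sume_ge0 => i _; have [v lv _] := hphi k i.
    by rewrite (elem_det_dist _ lv); exact: row_sqint_ge0.
  move=> eps eps0; have e1 : 0 < eps / n.+1%:R by rewrite divr_gt0.
  apply: filterS (near_infty_natSinv_lt (PosNum e1)) => k /= hk.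
  rewrite (@le_trans _ _ (\sum_(i < n) (k.+1%:R^-1)%:E)%E)//.
    by apply: lee_sum => i _; have [] := hphi k i.
  rewrite sumEFin lee_fin sumr_const card_ord -[_ *+ n]mulr_natr.
  apply: (@le_trans _ _ (eps / n.+1%:R * n%:R)).
    by rewrite ler_wpM2r// ltW.
  by rewrite mulrAC ler_pdivrMr// ler_wpM2l ?ltW// ltr_nat.
split.
  apply: cvg_trans to0; apply: near_eq_cvg; apply: nearW => k.
  by rewrite simple_value_distE.
apply: cvg_trans to0; apply: near_eq_cvg; apply: nearW => k.
rewrite frobenius_expectationE; last 2 first.
- by move=> i; exact: simple_integral_measurable.
- by move=> i; have [] := hX i.
apply: eq_bigr => i _; have [v lv _] := hphi k i.
rewrite -(elem_det_isometry lv (mc i) (hX i)).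
by apply: eq_integral => w _; rewrite sp_row_integral.
Qed.

Lemma is_ito_integral_ext T (Phi Psi : R -> 'M[R]_(n, d)) X :
  (forall s, 0 <= s <= T -> Phi s = Psi s) ->
  is_ito_integral B T (fun s _ => Phi s) X -> is_ito_integral B T (fun s _ => Psi s) X.
Proof.
move=> PP [[m1 m2 m3] mX [phi [c1 c2]]].
split; [|exact: mX|]; last first.
  exists phi; split; last exact: c2.
  apply: cvg_trans c1; apply: near_eq_cvg; apply: nearW => k.
  apply: eq_integral => w _; apply: eq_integral => s.
  by rewrite mem_setE in_itv/= => sT; rewrite PP.
split.
- move=> a b; apply: eq_measurable_fun (m1 a b) => -[s w].
  by rewrite inE/= in_itv/= => -[sT _]; rewrite PP.
- by move=> s s0 sT a b; rewrite -PP ?s0//; exact: m2.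
- apply: le_lt_trans m3; apply: le_of_eq.
  apply: eq_integral => w _; apply: eq_integral => s.
  by rewrite mem_setE in_itv/= => sT; rewrite PP.
Qed.

End riemann_approximation.

(** * A maximal inequality *)

Section running_integrals.
Context (d0 : measure_display) (Omega : measurableType d0) (R : realType).
Variables (P : probability Omega R) (d : nat) (B : 'I_d -> R -> {RV P >-> R}).
Hypothesis hB : brownian_motion B.
Local Notation intble X := (P.-integrable [set: Omega] (EFin \o X)).
Local Notation Ex X := (\int[P]_w X w)%R.
Local Notation block := (block B).

Section clipping.
Variables (t : R) (t0 : 0 <= t).

Let clip_lo_ge0 (e : block) : 0 <= Num.min (block_lo e) t.
Proof. by rewrite le_min block_lo_ge0. Qed.

Let clip_le (e : block) : Num.min (block_lo e) t <= Num.min (block_hi e) t.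
Proof. by rewrite le_min !ge_min block_le lexx orbT. Qed.

(** The coefficient is discarded when the block starts after [t], for it is
    then not adapted to the clipped starting time. *)
Definition clip_coef (e : block) (w : Omega) : R :=
  if block_lo e <= t then block_coef e w else 0.

Let clip_adapted (e : block) :
  measurable_wrt (natural_filtration B (Num.min (block_lo e) t)) (clip_coef e).
Proof.
rewrite /clip_coef; case: (leP (block_lo e) t) => h.
  exact: block_adapted.
by apply: wrt_cst; exact: natural_filtration_sigma.
Qed.

Let clip_bounded (e : block) : exists K : R, forall w, `|clip_coef e w| <= K.
Proof.
rewrite /clip_coef; case: (block_lo e <= t); first exact: block_bounded.
by exists 0 => w; rewrite normr0.
Qed.

Definition clip_block (e : block) : block :=
  Block (block_dim e) (clip_lo_ge0 e) (clip_le e) (@clip_adapted e) (@clip_bounded e).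

Lemma clip_block_integral e w : block_integral (clip_block e) w =
  block_coef e w * incr B (block_dim e) (Num.min (block_lo e) t) (Num.min (block_hi e) t) w.
Proof.
rewrite /block_integral/= /clip_coef; case: ifPn => //; rewrite -ltNge => te.
have te' : t <= block_hi e by exact: le_trans (ltW te) (block_le e).
by rewrite !(min_r (ltW te)) (min_r te') incrxx !mulr0.
Qed.

Lemma clip_block_value e j s w :
  block_value (clip_block e) j s w = (s < t)%R%:R * block_value e j s w.
Proof.
rewrite /block_value /block_indic/= !indicE !mem_setE !in_itv/= /clip_coef.
rewrite ge_min lt_min; have [st|ts] := ltP s t.
  rewrite mul1r andbT; case: (leP (block_lo e) t) => [h|h].
    by rewrite orbF.
  rewrite mulr0; have -> : (block_lo e <= s) = false.
    by apply/negbTE; rewrite -ltNge; exact: lt_trans h.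
  by rewrite mulr0 mul0r.
by rewrite andbF andbF mulr0 !mul0r.
Qed.

End clipping.

(** The integral up to time [t]. Stopping the increments rather than clipping the
    blocks makes sense without a proof of [0 <= t]. *)
Definition running (l : seq block) (t : R) (w : Omega) : R :=
  \sum_(e <- l) block_coef e w *
    incr B (block_dim e) (Num.min (block_lo e) t) (Num.min (block_hi e) t) w.

Lemma running_clip l t (t0 : 0 <= t) w :
  running l t w = elem_integral (map (clip_block t0) l) w.
Proof.
by rewrite /elem_integral big_map; apply: eq_bigr => e _; rewrite clip_block_integral.
Qed.

Lemma elem_value_clip l t (t0 : 0 <= t) j s w :
  elem_value (map (clip_block t0) l) j s w = (s < t)%R%:R * elem_value l j s w.
Proof.
rewrite /elem_value big_map big_distrr/=.
by apply: eq_bigr => e _; rewrite clip_block_value.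
Qed.

Lemma running_adapted l t : 0 <= t ->
  measurable_wrt (natural_filtration B t) (running l t).
Proof.
move=> t0; have sF := natural_filtration_sigma B t.
have -> : running l t = fun w => \sum_(e <- l) block_integral (clip_block t0 e) w.
  by apply/funext => w; apply: eq_bigr => e _; rewrite clip_block_integral.
apply: wrt_sum => // e; apply: wrtM => //.
  apply: wrt_later (block_adapted (b := clip_block t0 e)).
  by rewrite /= ge_min lexx orbT.
apply: incr_wrt; rewrite /= ?le_min ?ge_min ?block_lo_ge0 ?t0 ?lexx ?orbT//.
by rewrite (le_trans (block_lo_ge0 e)) ?block_le.
Qed.

Lemma running_sqr l t : 0 <= t -> intble (fun w => running l t w ^+ 2).
Proof.
move=> t0; have [h _] := elem_isometry hB (map (clip_block t0) l).
by apply: eq_integrable h => // w _ /=; rewrite -running_clip.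
Qed.

Lemma running_measurable l t : 0 <= t -> measurable_fun setT (running l t).
Proof.
move=> t0; have -> : running l t = elem_integral (map (clip_block t0) l).
  by apply/funext => w; exact: running_clip.
exact: elem_integral_measurable.
Qed.

(** Every block contributes an increment after time [s], multiplied by a variable
    known when that increment starts; a block that ends before [s] or starts
    after [t] contributes nothing. *)
Lemma running_martingale l s t Z : 0 <= s -> s <= t ->
  measurable_wrt (natural_filtration B s) Z -> intble Z ->
  intble (fun w => Z w * (running l t w - running l s w)) /\
  Ex (fun w => Z w * (running l t w - running l s w)) = 0.
Proof.
move=> s0 st mZ iZ; have t0 := le_trans s0 st.
pose D (e : block) w := Z w * block_coef e w *
  (incr B (block_dim e) (Num.min (block_lo e) t) (Num.min (block_hi e) t) w -
   incr B (block_dim e) (Num.min (block_lo e) s) (Num.min (block_hi e) s) w).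
have -> : (fun w => Z w * (running l t w - running l s w)) =
          (fun w => \sum_(e <- l) D e w).
  apply/funext => w; rewrite /running -sumrB mulr_sumr.
  by apply: eq_bigr => e _; rewrite /D -mulrBr mulrA.
have iZc (e : block) : intble (fun w => Z w * block_coef e w).
  have -> : (fun w => Z w * block_coef e w) = (fun w => block_coef e w * Z w).
    by apply/funext => w; rewrite mulrC.
  apply: intble_bounded_mul => //; first exact: block_coef_measurable.
  exact: block_bounded.
have key (e : block) : intble (D e) /\ Ex (D e) = 0.
  rewrite /D; case: (leP (block_hi e) s) => [hs|sh].
    have ht := le_trans hs st; have ls := le_trans (block_le e) hs.
    rewrite (min_l (le_trans ls st)) (min_l ht) (min_l ls).
    have -> : (fun w => Z w * block_coef e w * (incr B (block_dim e) (block_lo e) (block_hi e) w -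
       incr B (block_dim e) (block_lo e) (block_hi e) w)) = (fun=> 0).
      by apply/funext => w; rewrite subrr mulr0.
    by split; [exact: intble_cst|exact: Ex_cst].
  case: (leP (block_lo e) s) => [ls|sl].
    rewrite (min_l (le_trans ls st)).
    have -> : (fun w => Z w * block_coef e w *
      (incr B (block_dim e) (block_lo e) (Num.min (block_hi e) t) w -
       incr B (block_dim e) (block_lo e) s w)) =
      (fun w => Z w * block_coef e w * incr B (block_dim e) s (Num.min (block_hi e) t) w).
      by apply/funext => w; rewrite /incr; congr (_ * _); ring.
    apply: Ex_past_incr => //; first by rewrite le_min (ltW sh).
    apply: wrt_past; apply: wrtM => //; first exact: natural_filtration_sigma.
    exact: wrt_later ls (block_adapted (b := e)).
  have -> : (fun w => Z w * block_coef e w *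
      (incr B (block_dim e) (Num.min (block_lo e) t) (Num.min (block_hi e) t) w -
       incr B (block_dim e) s s w)) =
      (fun w => Z w * block_coef e w *
       incr B (block_dim e) (Num.min (block_lo e) t) (Num.min (block_hi e) t) w).
    by apply/funext => w; rewrite incrxx subr0.
  have [lt|tl] := leP (block_lo e) t.
    apply: Ex_past_incr => //; first exact: block_lo_ge0.
      by rewrite le_min block_le.
    apply: wrt_past; apply: wrtM; first exact: natural_filtration_sigma.
      exact: wrt_later (ltW sl) mZ.
    exact: block_adapted.
  rewrite (min_r (le_trans (ltW tl) (block_le e))).
  have -> : (fun w => Z w * block_coef e w * incr B (block_dim e) t t w) = (fun=> 0).
    by apply/funext => w; rewrite incrxx mulr0.
  by split; [exact: intble_cst|exact: Ex_cst].
split; first by apply: intble_sum => e; have [] := key e.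
by rewrite Ex_sum ?big1// => e; have [] := key e.
Qed.

Section maximal_inequality.
Variables (l : seq block) (lambda : R) (t : nat -> R).
Hypotheses (lambda0 : 0 < lambda) (t0 : forall i, 0 <= t i)
           (tS : forall i, t i <= t i.+1).

Let S i := running l (t i).
Let A i : set Omega := [set w | lambda < `|S i w|].

(** Recursive, because the maximal inequality goes by induction on the grid. *)
Fixpoint exceed (N : nat) : set Omega :=
  if N is N'.+1 then exceed N' `|` A N else A 0%N.

Lemma exceedP N w : exceed N w <-> exists2 i, (i <= N)%N & lambda < `|running l (t i) w|.
Proof.
elim: N => [|N IH] /=.
  by split=> [h|[i]]; [exists 0%N|rewrite leqn0 => /eqP ->].
split=> [[/IH[i iN h]|h]|[i]].
- by exists i => //; exact: leqW.
- by exists N.+1.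
- by rewrite leq_eqVlt => /predU1P[->|iN] h; [right|left; apply/IH; exists i].
Qed.

Let FA i : natural_filtration B (t i) (A i).
Proof.
have := @running_adapted l (t i) (t0 i).
have -> : A i = setT `&` (S i @^-1` ((fun x => `|x|) @^-1` `]lambda, +oo[%classic)).
  by rewrite setTI; apply/seteqP; split=> w; rewrite /A/= in_itv/= andbT.
apply; exists ((fun x : R => `|x|) @^-1` `]lambda, +oo[%classic) => //.
rewrite -[X in measurable X]setTI; apply: normr_measurable => //.
Qed.

Lemma exceed_filtration N : natural_filtration B (t N) (exceed N).
Proof.
elim: N => [|N IH]/=; first exact: FA.
have sF := natural_filtration_sigma B (t N.+1).
rewrite -[exceed N `|` _]setCK setCU.
have [dT dC dU] := sigma_algebra_dynkin sF.
apply: (dC); apply: (sigma_algebraI sF); apply: dC; last exact: FA.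
exact: (natural_filtrationS (tS N)) IH.
Qed.

Lemma exceed_measurable N : measurable (exceed N).
Proof.
have h := @natural_filtration_measurable _ _ _ _ _ B (t N).
by apply: h; exact: exceed_filtration.
Qed.

Let iS2 i : intble (fun w => S i w ^+ 2). Proof. exact: running_sqr. Qed.

Let iS2U i (U : set Omega) : measurable U -> intble (fun w => \1_U w * S i w ^+ 2).
Proof.
move=> mU; apply: intble_bounded_mul; [exact: measurable_indic| |exact: iS2].
by exists 1 => w; rewrite ger0_norm// indicE; case: (_ \in _).
Qed.

(** On the event reached so far the second moment grows, by the martingale
    property; on what the last time adds, the square is at least [lambda ^ 2]. *)
Let kolmogorov_aux N :
  lambda ^+ 2 * Ex (\1_(exceed N)) <= Ex (fun w => \1_(exceed N) w * S N w ^+ 2).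
Proof.
have sqA i w : A i w -> lambda ^+ 2 <= S i w ^+ 2.
  move=> h; rewrite -[S i w ^+ 2]real_normK ?num_real// lerXn2r// ?nnegrE// ltW//.
elim: N => [|N IH].
  rewrite -ExZ; last exact: intble_indic (exceed_measurable 0).
  apply: Ex_le; [|exact/iS2U/(exceed_measurable 0)|].
    exact/intbleZ/intble_indic/(exceed_measurable 0).
  move=> w; rewrite indicE; case: (boolP (w \in _)) => [|_]; last by rewrite mulr0 mul0r.
  by rewrite inE mulr1 mul1r => /sqA.
pose Z w := \1_(exceed N) w * S N w.
have mU := exceed_measurable N; have mU' := exceed_measurable N.+1.
have iSN : intble (S N) by apply: intble_sqr => //; exact: running_measurable.
have iZ : intble Z.
  apply: intble_bounded_mul; [exact: measurable_indic| |exact: iSN].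
  by exists 1 => w; rewrite ger0_norm// indicE; case: (_ \in _).
have mZ : measurable_wrt (natural_filtration B (t N)) Z.
  apply: wrtM; first exact: natural_filtration_sigma.
    apply: wrt_indic; first exact: natural_filtration_sigma.
    exact: exceed_filtration.
  exact: running_adapted.
have [i1 E1] := running_martingale l (t0 N) (tS N) mZ iZ.
pose W w := \1_(exceed N) w * S N w ^+ 2 + 2 * (Z w * (S N.+1 w - S N w)) +
  lambda ^+ 2 * (\1_(exceed N.+1) w - \1_(exceed N) w).
have iW1 : intble (fun w => \1_(exceed N) w * S N w ^+ 2 + 2 * (Z w * (S N.+1 w - S N w))).
  by apply: intbleD; [exact: iS2U|exact: intbleZ].
have iW2 : intble (fun w => \1_(exceed N.+1) w - \1_(exceed N) w).
  by apply: intbleB; exact: intble_indic.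
apply: (@le_trans _ _ (Ex W)).
  rewrite ExD//; last exact: intbleZ.
  rewrite ExD//; [|exact: iS2U|exact: intbleZ].
  rewrite !ExZ// ExB//; [|exact: intble_indic..].
  by rewrite E1 mulr0 addr0 mulrBr addrCA lerDl subr_ge0.
apply: Ex_le; [by apply: intbleD => //; exact: intbleZ|exact: iS2U|].
move=> w; rewrite /W /Z !indicE.
have [wU|wU] := boolP (w \in exceed N).
  have -> : w \in exceed N.+1 by rewrite inE; left; rewrite inE in wU.
  rewrite /= !mul1r subrr mulr0 addr0 -subr_ge0.
  have -> : S N.+1 w ^+ 2 - (S N w ^+ 2 + 2 * (S N w * (S N.+1 w - S N w))) =
    (S N.+1 w - S N w) ^+ 2 by ring.
  exact: sqr_ge0.
rewrite /= !mul0r mulr0 !add0r subr0.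
have [|_] := boolP (w \in exceed N.+1); last by rewrite mulr0 mul0r.
rewrite inE /= => -[wU'|/sqA h]; first by move: wU; rewrite notin_setE.
by rewrite mulr1 mul1r.
Qed.

Lemma kolmogorov N (V : R) : Ex (fun w => running l (t N) w ^+ 2) <= V ->
  (P (exceed N) <= (V / lambda ^+ 2)%:E)%E.
Proof.
move=> hV; have mU := exceed_measurable N.
rewrite -(fineK (fin_num_measure P _ mU)) lee_fin -Ex_indic// ler_pdivlMr ?exprn_gt0//.
rewrite mulrC (le_trans (kolmogorov_aux N))// (le_trans _ hV)//.
apply: Ex_le; [exact: iS2U|exact: iS2|].
move=> w; rewrite indicE; case: (_ \in _); first by rewrite mul1r.
by rewrite mul0r sqr_ge0.
Qed.

End maximal_inequality.
End running_integrals.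

(** * Uniform bounds on paths *)

(** Continuity within a set is tested only at points of the set, where [r] takes
    its values; [r] will be a retraction of R onto an interval. *)
Lemma within_continuous_comp (U T S : topologicalType) (A : set T) (f : T -> S)
    (r : U -> T) :
  {within A, continuous f} -> continuous r -> (forall x, A (r x)) ->
  continuous (f \o r).
Proof.
move=> /subspace_continuousP cf cr Ar x.
apply: (cvg_comp r f _ (cf (r x) (Ar x))) => W rW.
have h : nbhs x (fun u => A (r u) -> W (r u)) := cr x _ rW.
rewrite /nbhs/=; apply: (filterS _ h) => u; apply; exact: Ar.
Qed.

Section pathwise_sup.
Context (d0 : measure_display) (Omega : measurableType d0) (R : realType).
Variables (P : probability Omega R) (d : nat) (B : 'I_d -> R -> {RV P >-> R}).
Hypothesis hB : brownian_motion B.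
Local Notation block := (block B).

(** Clipping restricts the integrand to [0, t[; the isometry does the rest. *)
Lemma running_sqint_le (l : seq block) t : 0 <= t ->
  (sqint P (running l t) <= sqint P (elem_integral l))%E.
Proof.
move=> t0; have [_ h] := elem_isometry hB l; rewrite [leRHS]h.
have [_ ht] := elem_isometry hB (map (clip_block t0) l).
have -> : sqint P (running l t) =
    (\int[P]_w (elem_integral (map (clip_block t0) l) w ^+ 2)%:E)%E.
  by apply: eq_integral => w _; rewrite -running_clip.
rewrite ht; apply: lee_sum => j _.
rewrite !iterated_sqintE; [|exact: elem_value_jointly_measurable..].
apply: ge0_le_integral => //.
- by move=> z _; rewrite lee_fin sqr_ge0.
- by apply: measurable_sqr; exact: elem_value_jointly_measurable.
- by apply: measurable_sqr; exact: elem_value_jointly_measurable.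
- move=> z _; rewrite lee_fin elem_value_clip exprMn ler_piMl ?sqr_ge0//.
  by case: (_ < _); rewrite ?expr1n ?expr0n.
Qed.

Lemma max0_continuous : continuous (fun t : R => Num.max t 0).
Proof.
by move=> x; apply: (@continuous_max R R id (fun=> 0)); [exact: cvg_id|exact: cvg_cst].
Qed.

Lemma continuous_half_line_max (T : topologicalType) (f : R -> T) :
  {within `[0, +oo[%classic, continuous f} -> continuous (fun t : R => f (Num.max t 0)).
Proof.
move=> cf; apply: within_continuous_comp cf max0_continuous _ => x.
by rewrite /= in_itv/= andbT le_max lexx orbT.
Qed.

Definition continuous_paths (w : Omega) := forall j : 'I_d,
  {within `[0, +oo[%classic, continuous (fun t => B j t w)}.

Lemma ae_continuous_paths : {ae P, forall w, continuous_paths w}.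
Proof.
have [hBM _] := hB.
have h : forall j : 'I_d, {ae P, forall w,
  {within `[0, +oo[%classic, continuous (fun t => B j t w)}}.
  by move=> j; have [] := hBM j.
by apply: filter_forall.
Qed.

Lemma running_continuous (l : seq block) w : continuous_paths w ->
  continuous (fun t : R => running l (Num.max t 0) w).
Proof.
move=> cw.
pose b j (t : R) := B j (Num.max t 0) w.
have cb j : continuous (b j) by exact: (continuous_half_line_max (cw j)).
have E t : running l (Num.max t 0) w = \sum_(e <- l) block_coef e w *
    (b (block_dim e) (Num.min (block_hi e) (Num.max t 0)) -
     b (block_dim e) (Num.min (block_lo e) (Num.max t 0))).
  apply: eq_bigr => e _; rewrite /incr /b; have t0 : 0 <= Num.max t 0.
    by rewrite le_max lexx orbT.
  rewrite !(@max_l _ _ (Num.min _ (Num.max t 0)))// le_min t0 ?block_lo_ge0//.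
  by rewrite (le_trans (block_lo_ge0 e) (block_le e)).
have -> : (fun t => running l (Num.max t 0) w) = (fun t => \sum_(e <- l) block_coef e w *
    (b (block_dim e) (Num.min (block_hi e) (Num.max t 0)) -
     b (block_dim e) (Num.min (block_lo e) (Num.max t 0)))) by exact/funext.
have cmax (c : R) : continuous (fun t : R => Num.min c (Num.max t 0)).
  move=> x; apply: (@continuous_min R R (fun=> c) (fun t => Num.max t 0)).
    exact: cvg_cst.
  by apply: continuous_max => //; exact: cvg_cst.
elim: l {E} => [|e l IH] x.
  by under eq_fun do rewrite big_nil; exact: cvg_cst.
under eq_fun do rewrite big_cons; apply: cvgD; last exact: IH.
apply: cvgM; first exact: cvg_cst.
apply: cvgB.
  apply: (cvg_comp (fun t => Num.min (block_hi e) (Num.max t 0)) (b (block_dim e))).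
    exact: cmax.
  exact: cb.
apply: (cvg_comp (fun t => Num.min (block_lo e) (Num.max t 0)) (b (block_dim e))).
  exact: cmax.
exact: cb.
Qed.

Section dyadic_grid.
Variables (l : seq block) (lambda V : R).
Hypotheses (lambda0 : 0 < lambda) (hV : (sqint P (elem_integral l) <= V%:E)%E).

Let grid m i : R := i%:R / 2 ^+ m.

Let grid0 m i : 0 <= grid m i.
Proof. by rewrite divr_ge0// exprn_ge0. Qed.

Let gridS m i : grid m i <= grid m i.+1.
Proof. by rewrite ler_pM2r ?invr_gt0 ?exprn_gt0// ler_nat. Qed.

Let grid_refine m n i : (m <= n)%N -> grid m i = grid n (i * 2 ^ (n - m)).
Proof.
move=> mn; have -> : grid n (i * 2 ^ (n - m)) =
    i%:R * 2 ^+ (n - m) / (2 ^+ (n - m) * 2 ^+ m).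
  by rewrite /grid natrM natrX -exprD subnK.
by rewrite -mulrA /grid; congr (_ * _); rewrite invfM mulrA mulfV ?mul1r// expf_neq0.
Qed.

Let exc m := exceed l lambda (grid m) (m * 2 ^ m).

Definition sup_exceed : set Omega := \bigcup_m exc m.

Let exc_measurable m : measurable (exc m).
Proof. exact: exceed_measurable. Qed.

Let exc_nd m n : (m <= n)%N -> exc m `<=` exc n.
Proof.
move=> mn w /exceedP[i iN h]; apply/exceedP; exists (i * 2 ^ (n - m))%N.
  have -> : (2 ^ n = 2 ^ (n - m) * 2 ^ m)%N by rewrite -expnD subnK.
  rewrite mulnCA [(i * _)%N]mulnC leq_mul2l; apply/orP; right.
  by rewrite (leq_trans iN)// leq_mul2r mn orbT.
by rewrite -grid_refine.
Qed.

Lemma sup_exceed_measurable : measurable sup_exceed.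
Proof. exact: bigcup_measurable. Qed.

(** The grids of mesh [2 ^- m] on [0, m] are nested, so that the bound of
    [kolmogorov], uniform in [m], passes to their union. *)
Lemma sup_exceed_le : (P sup_exceed <= (V / lambda ^+ 2)%:E)%E.
Proof.
have c : P (exc m) @[m --> \oo] --> P sup_exceed.
  apply: nondecreasing_cvg_mu => //; first exact: sup_exceed_measurable.
  by move=> m n mn; apply/subsetPset; exact: exc_nd.
apply: (cvge_le _ c); apply: nearW => m; apply: kolmogorov => //.
by rewrite -lee_fin Ex_EFin; [exact: le_trans (running_sqint_le _ _) hV|exact: running_sqr].
Qed.

(** Dyadic times are dense, so continuity extends the bound to all times. *)
Lemma not_sup_exceed w : continuous_paths w -> ~ sup_exceed w ->
  forall t, 0 <= t -> `|running l t w| <= lambda.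
Proof.
move=> cw nw t t0; rewrite leNgt; apply/negP => ht; apply: nw.
have e0 : 0 < `|running l t w| - lambda by rewrite subr_gt0.
have tE : Num.max t 0 = t by rewrite max_l.
have := @running_continuous l w cw t.
move=> /cvgrPdist_lt/(_ _ e0)/nbhs_ballP[r /= r0]; rewrite tE => hr.
have /filter_ex[m /= hm] := near_infty_natSinv_expn_lt (PosNum r0).
pose i := Num.truncn (t * 2 ^+ m).
have /andP[it ti] : i%:R <= t * 2 ^+ m < i.+1%:R.
  by apply: truncn_itv; rewrite mulr_ge0// exprn_ge0.
have p2 : 0 < 2 ^+ m :> R by rewrite exprn_gt0.
have git : grid m i <= t by rewrite ler_pdivrMr.
have tgi : `|t - grid m i| < r.
  rewrite ger0_norm ?subr_ge0// (le_lt_trans _ hm)// lerBlDr -mulrDl.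
  by rewrite ler_pdivlMr// addrC natr1 ltW.
have hg : lambda < `|running l (grid m i) w|.
  have := hr _ tgi; rewrite max_l// => h.
  have := le_lt_trans (lerB_dist _ _) h.
  by rewrite ltrD2l ltrN2.
have : exc (maxn m i) w; last by exists (maxn m i).
apply/exceedP; exists (i * 2 ^ (maxn m i - m))%N.
  by rewrite leq_mul// ?leq_maxr// leq_pexp2l// leq_subr.
by rewrite -grid_refine ?leq_maxl.
Qed.

End dyadic_grid.

End pathwise_sup.

(** * Almost sure and mean square limits *)

Section square_limits.
Context (d0 : measure_display) (Omega : measurableType d0) (R : realType).
Variable P : {measure set Omega -> \bar R}.

Lemma measurable_limn_einf (f : nat -> Omega -> \bar R) :
  (forall n, measurable_fun setT (f n)) ->
  measurable_fun setT (fun w => limn_einf (f ^~ w)).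
Proof.
move=> mf.
have -> : (fun w => limn_einf (f ^~ w)) =
    (fun w => - limn_esup (fun n => - f n w))%E.
  apply/funext => w; rewrite -limn_einfN; congr limn_einf.
  by apply/funext => n /=; rewrite oppeK.
apply: measurableT_comp => //; apply: measurable_fun_limn_esup => n.
exact: measurableT_comp.
Qed.

Lemma limn_einf_le (u : nat -> \bar R) (c : \bar R) :
  (forall n, u n <= c)%E -> (limn_einf u <= c)%E.
Proof.
move=> uc; rewrite limn_einf_lim; apply: lime_le; first exact: is_cvg_einfs.
by apply: nearW => n; apply: le_trans (uc n); apply: ereal_inf_lbound; exists n => //=.
Qed.

(** Fatou's lemma: mean square distances are lower semicontinuous along almost
    sure limits. *)
Lemma sqint_fatou (X_ : nat -> Omega -> R) (X Z : Omega -> R) (c : \bar R) :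
  (forall j, measurable_fun setT (X_ j)) -> measurable_fun setT X ->
  measurable_fun setT Z -> {ae P, forall w, X_ ^~ w @ \oo --> X w} ->
  (forall j, (sqint P (fun w => Z w - X_ j w)%R <= c)%E) ->
  (sqint P (fun w => Z w - X w)%R <= c)%E.
Proof.
move=> mX_ mX mZ aeX hc.
have mD j : measurable_fun setT (fun w => ((Z w - X_ j w) ^+ 2)%:E).
  by apply: measurable_sqr; exact: measurable_funB.
have nnD j w : setT w -> (0 <= ((Z w - X_ j w) ^+ 2)%:E :> \bar R)%E.
  by rewrite lee_fin sqr_ge0.
have h := @fatou _ _ _ P setT measurableT _ mD nnD.
apply: le_trans (_ : _ <= limn_einf (fun n => sqint P (fun w => Z w - X_ n w)%R))%E _; last first.
  exact: limn_einf_le.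
apply: le_trans h; apply: le_of_eq.
have einf0 w : (0 <= limn_einf (fun j => ((Z w - X_ j w) ^+ 2)%:E))%E.
  rewrite limn_einf_lim; apply: lime_ge; first exact: is_cvg_einfs.
  by apply: nearW => n; apply: le_ereal_inf_tmp => _ [k _ <-]; rewrite lee_fin sqr_ge0.
apply: ge0_ae_eq_integral => //.
- by apply: measurable_sqr; exact: measurable_funB.
- exact: measurable_limn_einf.
- by move=> w _; rewrite lee_fin sqr_ge0.
apply: filterS aeX => w hw _; apply/esym.
have hc2 : (fun j => ((Z w - X_ j w) ^+ 2)%:E) @ \oo --> ((Z w - X w) ^+ 2)%:E.
  apply: cvg_EFin; first exact: nearW.
  apply: (cvg_comp (fun j => Z w - X_ j w) (fun y => y ^+ 2)); last exact: exprn_continuous.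
  by apply: cvgB => //; exact: cvg_cst.
rewrite is_cvg_limn_einfE; first exact: cvg_lim.
by apply: cvgP hc2.
Qed.

End square_limits.

Section dyadic_cauchy.
Context (R : realType).

(** The rate is the tail of a geometric series. It makes the convergence uniform
    in any parameter on which [u] depends. *)
Lemma dyadic_cauchy_cvg (u : nat -> R) (K : nat) :
  (forall k, (K <= k)%N -> `|u k.+1 - u k| <= (2 ^+ k)^-1) ->
  exists a, u @ \oo --> a /\ forall k, (K <= k)%N -> `|u k - a| <= 2 * (2 ^+ k)^-1.
Proof.
move=> hu.
have p2 k : 0 < (2 ^+ k)^-1 :> R by rewrite invr_gt0 exprn_gt0.
have step k j : (K <= k)%N -> `|u (k + j)%N - u k| <= 2 * (2 ^+ k)^-1 - 2 * (2 ^+ (k + j))^-1.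
  move=> Kk; elim: j => [|j IH]; first by rewrite addn0 !subrr normr0.
  rewrite addnS -(subrKA (u (k + j)%N)) (le_trans (ler_normD _ _))//.
  have := hu _ (leq_trans Kk (leq_addr j k)).
  have -> : 2 * (2 ^+ (k + j).+1)^-1 = (2 ^+ (k + j))^-1 :> R.
    by rewrite exprS invfM mulrA mulfV// mul1r.
  by move=> h; have := lerD h IH; move/le_trans; apply; lra.
have step2 k j : (K <= k)%N -> `|u (k + j)%N - u k| <= 2 * (2 ^+ k)^-1.
  move=> Kk; apply: (le_trans (step k j Kk)); rewrite gerBl.
  by rewrite mulr_ge0// ltW.
have cu : cvg (u @ \oo).
  apply/cauchy_cvgP/cauchyP => e e0.
  have e4 : 0 < e / 2 by rewrite divr_gt0.
  have [N _ hN] := near_infty_natSinv_expn_lt (PosNum e4).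
  exists (u (maxn K N)); exists (maxn K N) => // j /= hj.
  rewrite /ball/= distrC -(subnKC hj) (le_lt_trans (step2 _ _ (leq_maxl _ _)))//.
  have := hN (maxn K N) (leq_maxr _ _); rewrite /= mul1r ltr_pdivlMr// mulrC.
  exact.
exists (lim (u @ \oo)); split=> // k Kk.
have c1 : (fun j => `|u k - u (k + j)%N|) @ \oo --> `|u k - lim (u @ \oo)|.
  apply: cvg_norm; apply: cvgB; first exact: cvg_cst.
  have := cu; rewrite -(cvg_shiftn k) /=.
  by under eq_fun do rewrite addnC.
rewrite -(cvg_lim _ c1)//; apply: limr_le; first exact: cvgP c1.
by apply: nearW => j; rewrite distrC; exact: step2.
Qed.

End dyadic_cauchy.

(** * Continuous versions *)

Section continuous_version.
Context (d0 : measure_display) (Omega : measurableType d0) (R : realType).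
Variables (P : probability Omega R) (d : nat) (B : 'I_d -> R -> {RV P >-> R}).
Hypothesis hB : brownian_motion B.
Local Notation mu := (@lebesgue_measure R).
Local Notation block := (block B).

Lemma running_sub (l l' : seq block) t w :
  running (elem_sub l l') t w = running l t w - running l' t w.
Proof.
rewrite /running big_cat/= big_map -sumrN; congr (_ + _).
by apply: eq_bigr => e _; rewrite mulNr.
Qed.

(** A running integral is eventually constant; this gives access to the limit at
    infinity of [version] below. *)
Lemma running_large (l : seq block) : exists L : R, 0 <= L /\
  forall t w, L <= t -> running l t w = elem_integral l w.
Proof.
elim: l => [|e l [L [L0 hL]]].
  by exists 0; split=> // t w _; rewrite /running /elem_integral !big_nil.
exists (Num.max L (block_hi e)); split; first by rewrite le_max L0.
move=> t w; rewrite ge_max => /andP[Lt et].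
rewrite /running /elem_integral !big_cons; congr (_ + _); last exact: hL.
by rewrite /block_integral !min_l// (le_trans (block_le e)).
Qed.

Lemma elem_value_neg (l : seq block) j s w : s < 0 -> elem_value l j s w = 0.
Proof.
move=> s0; rewrite /elem_value big1// => e _; rewrite /block_value /block_indic indicE.
rewrite mem_setE in_itv/=.
have -> : (block_lo e <= s) = false.
  by apply/negbTE; rewrite -ltNge (lt_le_trans s0)// block_lo_ge0.
by rewrite mulr0 mul0r.
Qed.

Variable g : 'I_d -> R -> R.
Hypothesis mg : forall j, measurable_fun setT (g j).

Lemma elem_sub_sqint_le (l l' : seq block) :
  (sqint P (fun w => elem_integral l w - elem_integral l' w)%R <=
   4%:E * (integrand_dist l g + integrand_dist l' g))%E.
Proof.
rewrite elem_sub_isometry// !integrand_distE// -big_split/= ge0_sume_distrr; last first.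
  by move=> j _; rewrite adde_ge0// sqint_ge0.
apply: lee_sum => j _.
pose r (l1 : seq block) : Omega * measurableTypeR R -> R :=
  fun z => elem_value l1 j z.2 z.1 - g j z.2.
have m l1 : measurable_fun setT (r l1).
  apply: measurable_funB; first exact: elem_value_jointly_measurable.
  exact: jointly_measurable_cst.
have mN : measurable_fun setT (fun z => - r l' z) by exact: measurableT_comp.
apply: (le_trans (@sqint_le2 _ _ _ (P \x mu)%E _ (r l) _ (m l) mN _)); last first.
  by rewrite sqintN.
by move=> z; rewrite /r; ring.
Qed.

Let gcut T j : R -> R := g j \_ `[0, T[%classic.

Let mgcut T j : measurable_fun setT (gcut T j).
Proof. exact: measurable_patch_itv. Qed.

Lemma clip_dist_le (l : seq block) T (T0 : 0 <= T) :
  (integrand_dist (map (clip_block T0) l) (gcut T) <= integrand_dist l g)%E.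
Proof.
rewrite !integrand_distE//; apply: lee_sum => j _.
have m (l1 : seq block) (h : R -> R) : measurable_fun setT h -> measurable_fun setT
    (fun z : Omega * measurableTypeR R => elem_value l1 j z.2 z.1 - h z.2).
  move=> mh; apply: measurable_funB; first exact: elem_value_jointly_measurable.
  exact: jointly_measurable_cst.
apply: ge0_le_integral => //.
- by move=> z _; rewrite lee_fin sqr_ge0.
- by apply: measurable_sqr; exact: m.
- by apply: measurable_sqr; exact: m.
move=> [w s] _ /=; rewrite lee_fin elem_value_clip /gcut patchE mem_setE in_itv/=.
have [s0|s0] := ltP s 0.
  by rewrite elem_value_neg// mulr0 subrr expr0n sqr_ge0.
by case: (ltP s T) => sT /=; rewrite ?mul1r// mul0r subrr expr0n sqr_ge0.
Qed.

Variable l : nat -> seq block.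
Hypothesis hl : forall k, (integrand_dist (l k) g <= ((8 ^+ k)^-1)%:E)%E.

Let dist_le k i : (k <= i)%N ->
  (sqint P (fun w => elem_integral (l k) w - elem_integral (l i) w)%R <=
   (8 * (8 ^+ k)^-1)%:E)%E.
Proof.
move=> ki; apply: (le_trans (elem_sub_sqint_le _ _)).
rewrite (_ : (8 * (8 ^+ k)^-1)%:E = 4%:E * (((8 ^+ k)^-1)%:E + ((8 ^+ k)^-1)%:E))%E; last first.
  by rewrite -!EFinD; congr EFin; ring.
apply: lee_wpmul2l => //; apply: leeD; first exact: hl.
apply: (le_trans (hl i)); rewrite lee_fin lef_pV2 ?posrE ?exprn_gt0//.
by rewrite ler_weXn2l// ler1n.
Qed.

(** Successive integrals are at mean square distance of order [8 ^- k], so the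
    maximal inequality at the level [2 ^- k] gives a probability of order
    [8 ^- k * 4 ^ k = 2 ^- k], which is summable. *)
Let bad k := sup_exceed (elem_sub (l k.+1) (l k)) (2 ^+ k)^-1.

Let bad_measurable k : measurable (bad k).
Proof. by apply: sup_exceed_measurable; rewrite invr_gt0 exprn_gt0. Qed.

Let bad_le k : (P (bad k) <= (16 / (2 ^ k.+1)%:R)%:E)%E.
Proof.
have l0 : 0 < (2 ^+ k)^-1 :> R by rewrite invr_gt0 exprn_gt0.
have h : (sqint P (elem_integral (elem_sub (l k.+1) (l k))) <= (8 * (8 ^+ k)^-1)%:E)%E.
  apply: le_trans (dist_le (leqnSn k)); apply: le_of_eq.
  by apply: eq_integral => w _; rewrite elem_integralB -sqrrN opprB.
apply: (le_trans (sup_exceed_le hB l0 h)); rewrite lee_fin.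
have -> : (8 : R) ^+ k = (2 ^+ k) ^+ 3 by rewrite -exprM mulnC exprM; congr (_ ^+ _); ring.
rewrite natrX [2 ^+ k.+1]exprS.
have : (2 : R) ^+ k != 0 by rewrite expf_neq0.
move: (2 ^+ k) => x x0; apply: le_of_eq.
by field.
Qed.

Definition regular_path (w : Omega) := continuous_paths B w /\
  exists K, forall k, (K <= k)%N -> ~ bad k w.

(** Borel-Cantelli lemma. *)
Lemma ae_regular_path : {ae P, forall w, regular_path w}.
Proof.
have h1 := ae_continuous_paths hB.
have h2 : {ae P, forall w, exists K, forall k, (K <= k)%N -> ~ bad k w}.
  exists (lim_sup_set bad); split.
  - apply: bigcap_measurable => // i _; exact: bigcup_measurable.
  - apply: lim_sup_set_cvg0 => //.
    apply: (@le_lt_trans _ _ (\sum_(k <oo) (16 / (2 ^ k.+1)%:R)%:E)%E).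
      by apply: lee_nneseries => // k _; exact: bad_le.
    by apply: le_lt_trans (epsilon_trick0 _ _) _; rewrite ?ltry.
  - move=> w /= nw K _; apply: contrapT => hK; apply: nw; exists K => k Kk bk.
    by apply: hK; exists k.
by apply: filterS2 h1 h2 => w; split.
Qed.

Lemma regular_path_cvg w : regular_path w -> exists K, forall t, 0 <= t ->
  exists a, (fun k => running (l k) t w) @ \oo --> a /\
    forall k, (K <= k)%N -> `|running (l k) t w - a| <= 2 * (2 ^+ k)^-1.
Proof.
move=> [cw [K hK]]; exists K => t t0; apply: dyadic_cauchy_cvg => k Kk.
have l0 : 0 < (2 ^+ k)^-1 :> R by rewrite invr_gt0 exprn_gt0.
by rewrite -running_sub; apply: not_sup_exceed => //; exact: hK.
Qed.

(** The limit is total: at sample points without convergence it takes a junk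
    value, in a measurable way. *)
Definition seq_limit (u : nat -> R) : R := fine (limn_esup (fun k => (u k)%:E)).

Lemma seq_limitE (u : nat -> R) a : u @ \oo --> a -> seq_limit u = a.
Proof.
move=> ua; have ua' : (fun k => (u k)%:E) @ \oo --> a%:E.
  by apply: cvg_EFin => //; exact: nearW.
rewrite /seq_limit is_cvg_limn_esupE; first by rewrite (cvg_lim _ ua').
exact: cvgP ua'.
Qed.

Lemma measurable_seq_limit (u : nat -> Omega -> R) :
  (forall k, measurable_fun setT (u k)) ->
  measurable_fun setT (fun w => seq_limit (u ^~ w)).
Proof.
move=> mu0; apply: (measurableT_comp (f := fine)) => //.
by apply: measurable_fun_limn_esup => k; exact/measurable_EFinP.
Qed.

Definition version t w := seq_limit (fun k => running (l k) t w).
Definition version_limit w := seq_limit (fun k => elem_integral (l k) w).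

(** The rate of [dyadic_cauchy_cvg] does not depend on [t]: the convergence is
    uniform on the half line, and [version] inherits continuity and a limit at
    infinity from the running integrals. *)
Lemma version_close w : regular_path w -> exists K, forall k, (K <= k)%N ->
  forall t, 0 <= t -> `|running (l k) t w - version t w| <= 2 * (2 ^+ k)^-1.
Proof.
move=> /regular_path_cvg[K hK]; exists K => k Kk t t0.
by have [a [ha h]] := hK t t0; rewrite /version (seq_limitE ha); exact: h.
Qed.

Lemma version_cvg w t : regular_path w -> 0 <= t ->
  (fun k => running (l k) t w) @ \oo --> version t w.
Proof.
move=> /regular_path_cvg[K hK] t0.
by have [a [ha h]] := hK t t0; rewrite /version (seq_limitE ha).
Qed.

Let version_limit_close w : regular_path w ->
  (fun k => elem_integral (l k) w) @ \oo --> version_limit w /\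
  exists K, forall k, (K <= k)%N ->
    `|elem_integral (l k) w - version_limit w| <= 2 * (2 ^+ k)^-1.
Proof.
move=> [cw [K hK]].
have [k Kk|a [ha h]] := @dyadic_cauchy_cvg R (fun k => elem_integral (l k) w) K.
  have l0 : 0 < (2 ^+ k)^-1 :> R by rewrite invr_gt0 exprn_gt0.
  have [L [L0 hL]] := running_large (elem_sub (l k.+1) (l k)).
  rewrite -elem_integralB -(hL L w)//.
  by apply: not_sup_exceed => //; exact: hK.
by rewrite /version_limit (seq_limitE ha); split=> //; exists K.
Qed.

Let half_small (e : R) : 0 < e -> exists N, forall k, (N <= k)%N -> 2 * (2 ^+ k)^-1 <= e.
Proof.
move=> e0; have e2 : 0 < e / 2 by rewrite divr_gt0.
have [N _ hN] := near_infty_natSinv_expn_lt (PosNum e2); exists N => k Nk.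
by have := hN k Nk; rewrite /= mul1r ltr_pdivlMr// mulrC => /ltW.
Qed.

Lemma version_continuous w : regular_path w ->
  continuous (fun t : R => version (Num.max t 0) w).
Proof.
move=> rw x; have [K hK] := version_close rw.
apply/cvgrPdist_le => e e0.
have e3 : 0 < e / 3 by rewrite divr_gt0.
have [N hN] := half_small e3.
pose k := maxn K N.
have max0 (t : R) : 0 <= Num.max t 0 by rewrite le_max lexx orbT.
have hk t := le_trans (hK k (leq_maxl _ _) _ (max0 t)) (hN k (leq_maxr _ _)).
have := @running_continuous _ _ _ _ _ B (l k) w rw.1 x.
move=> /cvgrPdist_le/(_ _ e3); apply: filterS => t ht.
have := hk t; have := hk x; move: ht.
set a := running _ _ _; set b := running _ _ _; set u := version _ _; set v := version _ _.
move=> h1 h2 h3.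
have -> : u - v = (u - a) + ((a - b) + (b - v)) by ring.
rewrite (le_trans (ler_normD _ _))// (le_trans (lerD (lexx _) (ler_normD _ _)))//.
by rewrite distrC; lra.
Qed.

Lemma version_cvg_infty w : regular_path w ->
  (fun t => version t w) @ +oo --> version_limit w.
Proof.
move=> rw; have [K hK] := version_close rw; have [_ [K' hK']] := version_limit_close rw.
apply/cvgrPdist_le => e e0.
have e2 : 0 < e / 2 by rewrite divr_gt0.
have [N hN] := half_small e2.
pose k := maxn (maxn K K') N.
have [L [L0 hL]] := running_large (l k).
near=> t.
have Lt : L <= t by near: t; apply: nbhs_pinfty_ge; rewrite num_real.
have Kk : (K <= k)%N by rewrite /k -maxnA leq_maxl.
have K'k : (K' <= k)%N by rewrite /k maxnAC leq_maxr.
have hNk := hN k (leq_maxr _ _).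
have h1 := hK k Kk t (le_trans L0 Lt); rewrite hL// in h1.
have h2 := hK' k K'k.
have -> : version_limit w - version t w =
  (elem_integral (l k) w - version t w) - (elem_integral (l k) w - version_limit w).
  by ring.
by rewrite (le_trans (ler_normB _ _))//; lra.
Unshelve. all: by end_near. Qed.

Let version_limit_aux (T : R) (X : nat -> Omega -> R) (Y : Omega -> R) h
    (L : nat -> seq block) :
  (forall k w, X k w = elem_integral (L k) w) ->
  (forall k, (integrand_dist (L k) h <= integrand_dist (l k) g)%E) ->
  (forall k i, (k <= i)%N -> (sqint P (fun w => X k w - X i w)%R <= (8 * (8 ^+ k)^-1)%:E)%E) ->
  measurable_fun setT Y -> {ae P, forall w, X ^~ w @ \oo --> Y w} ->
  ito_limit B h Y.
Proof.
move=> XE hL hX mY aeY; split=> // eps eps0.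
have [k hk] : exists k, 8 * (8 ^+ k)^-1 <= eps.
  have e8 : 0 < eps / 8 by rewrite divr_gt0.
  have /filter_ex[k /= hk] := near_infty_natSinv_expn_lt (PosNum e8).
  exists k; rewrite mulrC -ler_pdivlMr//; apply: le_trans (ltW hk).
  by rewrite mul1r lef_pV2 ?posrE ?exprn_gt0// lerXn2r// ?nnegrE// ler_nat.
have mX i : measurable_fun setT (X i).
  have -> : X i = elem_integral (L i) by apply/funext => w.
  exact: elem_integral_measurable.
exists (L k); split.
  apply: (le_trans (hL k)); apply: (le_trans (hl k)); rewrite lee_fin.
  by apply: le_trans hk; rewrite ler_peMl ?ler1n// invr_ge0 exprn_ge0.
have -> : (fun w => elem_integral (L k) w - Y w) = (fun w => X k w - Y w).
  by apply/funext => w; rewrite XE.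
apply: (@sqint_fatou _ _ _ P (fun i => X (k + i)%N)) => //.
  apply: filterS aeY => w hw.
  have := hw; rewrite -(cvg_shiftn k) /=.
  by under eq_fun do rewrite addnC.
move=> i; apply: (le_trans (hX k (k + i)%N (leq_addr _ _))).
by rewrite lee_fin.
Qed.

Lemma version_ito_limit T : 0 <= T -> ito_limit B (gcut T) (version T).
Proof.
move=> T0.
apply: (@version_limit_aux T (fun k => running (l k) T) _ _
  (fun k => map (clip_block T0) (l k))).
- by move=> k w; exact: running_clip.
- by move=> k; exact: clip_dist_le.
- move=> k i ki; apply: le_trans (dist_le ki).
  have -> : (fun w => running (l k) T w - running (l i) T w) =
      running (elem_sub (l k) (l i)) T.
    by apply/funext => w; rewrite running_sub.
  apply: (le_trans (running_sqint_le hB _ T0)); apply: le_of_eq; apply: eq_integral => w _.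
  by rewrite elem_integralB.
- by apply: measurable_seq_limit => k; exact: running_measurable.
- by apply: filterS ae_regular_path => w rw; exact: version_cvg.
Qed.

Lemma version_limit_ito_limit : ito_limit B g version_limit.
Proof.
apply: (@version_limit_aux 0 (fun k => elem_integral (l k)) _ _ l) => //.
- by apply: measurable_seq_limit => k; exact: elem_integral_measurable.
- by apply: filterS ae_regular_path => w rw; have [] := version_limit_close rw.
Qed.

End continuous_version.

(** * Fourth moments and anticoncentration *)

Section fourth_moment.
Context (d0 : measure_display) (Omega : measurableType d0) (R : realType).
Variables (P : probability Omega R) (d : nat) (B : 'I_d -> R -> {RV P >-> R}).
Hypothesis hB : brownian_motion B.
Local Notation intble X := (P.-integrable [set: Omega] (EFin \o X)).
Local Notation Ex X := (\int[P]_w X w)%R.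

Lemma intble_pow4 (X : Omega -> R) p : measurable_fun setT X -> (p <= 4)%N ->
  intble (fun w => X w ^+ 4) -> intble (fun w => X w ^+ p).
Proof.
move=> mX p4 iX; apply: (@intble_le _ _ _ _ _ (fun w => 1 + X w ^+ 4)).
- exact: measurable_funX.
- move=> w; rewrite normrX.
  have x40 : X w ^+ 4 = `|X w| ^+ 4 by rewrite -normrX ger0_norm// (exprM _ 2 2) sqr_ge0.
  rewrite x40; have [x1|/ltW x1] := leP `|X w| 1.
    by rewrite (le_trans (exprn_ile1 _ _ _))// lerDl exprn_ge0.
  by rewrite (le_trans (ler_weXn2l x1 p4))// lerDr.
- exact: intbleD (intble_cst _ _) iX.
Qed.

Variables (j : 'I_d) (c t : nat -> R).
Hypotheses (t0 : forall k, 0 <= t k) (tS : forall k, t k <= t k.+1).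

Definition grid_sum N w := \sum_(k < N) c k * incr B j (t k) (t k.+1) w.
Definition grid_var N := \sum_(k < N) c k ^+ 2 * (t k.+1 - t k).

Let grid_sum_adapted N : measurable_wrt (natural_filtration B (t N)) (grid_sum N).
Proof.
have tmono k : (k <= N)%N -> t k <= t N.
  move=> kN; rewrite -(subnKC kN); elim: (N - k)%N => [|i IH]; first by rewrite addn0.
  by rewrite addnS (le_trans IH).
have sF := natural_filtration_sigma B (t N).
have -> : grid_sum N = fun w => \sum_(k <- index_enum 'I_N) c k * incr B j (t k) (t k.+1) w.
  by [].
apply: wrt_sum => // k; apply: wrtM => //; first exact: wrt_cst.
by apply: incr_wrt => //; apply: tmono; [exact: ltnW|].
Qed.

(** The summands are independent and centred with kurtosis at most 3, and this
    bound on the kurtosis is stable under addition: the odd terms vanish in the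
    expansion of the fourth power of a sum. *)
Lemma grid_sum_moments N :
  [/\ intble (fun w => grid_sum N w ^+ 4), Ex (grid_sum N) = 0,
      Ex (fun w => grid_sum N w ^+ 2) = grid_var N &
      Ex (fun w => grid_sum N w ^+ 4) <= 3 * grid_var N ^+ 2].
Proof.
elim: N => [|N [i4 E1 E2 E4]].
  have E p : (fun w => grid_sum 0 w ^+ p.+1) = (fun=> 0).
    by apply/funext => w; rewrite /grid_sum big_ord0 expr0n.
  have E0 : grid_sum 0 = (fun=> 0) by apply/funext => w; rewrite /grid_sum big_ord0.
  rewrite !E E0 Ex_cst /grid_var big_ord0 expr0n mulr0; split=> //.
  exact: intble_cst.
set S := grid_sum N in i4 E1 E2 E4; set v := grid_var N in E2 E4.
pose x := incr B j (t N) (t N.+1); pose a := c N; pose D := t N.+1 - t N.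
have SE w : grid_sum N.+1 w = S w + a * x w by rewrite /grid_sum big_ord_recr.
have vE : grid_var N.+1 = v + a ^+ 2 * D by rewrite /grid_var big_ord_recr.
have mS : measurable_fun setT S.
  apply: (wrt_measurable _ (@grid_sum_adapted N)).
  exact: natural_filtration_measurable.
have mx : measurable_fun setT x by exact: measurable_incr.
have [x4 X4] := incr_moment4 hB j (t0 N) (tS N).
have [x2 X2] := incr_moment2 hB j (t0 N) (tS N).
have x1 := intble_incr hB j (t0 N) (tS N).
have X1 := Ex_incr hB j (t0 N) (tS N).
have iS p : (p <= 4)%N -> intble (fun w => S w ^+ p).
  by move=> p4; exact: intble_pow4.
have ix p : (p <= 4)%N -> intble (fun w => x w ^+ p).
  by move=> p4; exact: intble_pow4.
have iS1 : intble S by apply: eq_integrable (iS 1%N isT).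
have pS p : measurable_wrt (past_and_others B j (t N)) (fun w => S w ^+ p).
  elim: p => [|p IH].
    by under eq_fun do rewrite expr0; apply: wrt_cst; exact: past_and_others_sigma.
  under eq_fun do rewrite exprS; apply: wrtM => //; first exact: past_and_others_sigma.
  by apply: wrt_past; exact: grid_sum_adapted.
have [i31 E31] := Ex_past_incr hB (t0 N) (tS N) (pS 3%N) (iS 3%N isT).
have [i11 E11] := Ex_past_incr hB (t0 N) (tS N) (pS 1%N) (iS 1%N isT).
have [i22 E22] := Ex_past_incr2 hB (t0 N) (tS N) (pS 2%N) (iS 2%N isT).
have [i13 E13] : intble (fun w => S w * x w ^+ 3) /\ Ex (fun w => S w * x w ^+ 3) = 0.
  have := tS N; rewrite le_eqVlt => /predU1P[tt|tt].
    have -> : (fun w => S w * x w ^+ 3) = (fun=> 0).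
      by apply/funext => w; rewrite /x -tt incrxx expr0n mulr0.
    by split; [exact: intble_cst|exact: Ex_cst].
  have mX : measurable_fun setT (fun y : R => y ^+ 3) by exact: measurable_funX.
  have pS1 : measurable_wrt (past_and_others B j (t N)) S.
    by apply: wrt_past; exact: grid_sum_adapted.
  have ind := @indep_incr _ _ _ _ _ B hB j _ _ S _ (t0 N) tt pS1 mX.
  by have [h ->] := intble_indep_mul ind iS1 (ix 3%N isT); rewrite E1 mul0r.
have i4' : intble (fun w => grid_sum N.+1 w ^+ 4).
  have -> : (fun w => grid_sum N.+1 w ^+ 4) = (fun w => S w ^+ 4 +
      ((4 * a) * (S w ^+ 3 * x w) + ((6 * a ^+ 2) * (S w ^+ 2 * x w ^+ 2) +
       ((4 * a ^+ 3) * (S w * x w ^+ 3) + a ^+ 4 * x w ^+ 4)))).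
    by apply/funext => w; rewrite SE; ring.
  by do !apply: intbleD => //; exact: intbleZ.
split=> //.
- have -> : grid_sum N.+1 = (fun w => S w + a * x w) by exact/funext.
  by rewrite ExD//; [rewrite ExZ// E1 X1 mulr0 addr0|exact: intbleZ].
- have -> : (fun w => grid_sum N.+1 w ^+ 2) = (fun w => S w ^+ 2 +
      ((2 * a) * (S w ^+ 1 * x w) + a ^+ 2 * x w ^+ 2)).
    by apply/funext => w; rewrite SE; ring.
  rewrite ExD//; [|exact: iS|by apply: intbleD; exact: intbleZ].
  rewrite ExD//; [|exact: intbleZ|exact: intbleZ].
  by rewrite !ExZ// E2 E11 X2 mulr0 add0r vE.
- have -> : (fun w => grid_sum N.+1 w ^+ 4) = (fun w => S w ^+ 4 +
      ((4 * a) * (S w ^+ 3 * x w) + ((6 * a ^+ 2) * (S w ^+ 2 * x w ^+ 2) +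
       ((4 * a ^+ 3) * (S w * x w ^+ 3) + a ^+ 4 * x w ^+ 4)))).
    by apply/funext => w; rewrite SE; ring.
  have j4 := intbleZ (a ^+ 4) x4; have j3 := intbleZ (4 * a ^+ 3) i13.
  have j2 := intbleZ (6 * a ^+ 2) i22; have j1 := intbleZ (4 * a) i31.
  have k3 := intbleD j3 j4; have k2 := intbleD j2 k3; have k1 := intbleD j1 k2.
  rewrite ExD// ExD// ExD// ExD// !ExZ// E31 E13 E22 E2 vE -/D.
  have a4 : 0 <= a ^+ 4 by rewrite (exprM _ 2 2) sqr_ge0.
  have h := ler_wpM2l a4 X4.
  apply: (le_trans (lerD E4 (lerD (lexx _) (lerD (lexx _) (lerD (lexx _) h))))).
  by rewrite -/D; apply: le_of_eq; ring.
Qed.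

(** Paley-Zygmund inequality: a variable whose fourth moment is controlled by its
    variance cannot be small with probability close to 1. *)
Lemma grid_sum_anticoncentration N : 0 < grid_var N ->
  12^-1 <= Ex (\1_[set w | grid_var N / 2 <= grid_sum N w ^+ 2]).
Proof.
move=> v0; have [i4 _ E2 E4] := grid_sum_moments N.
set v := grid_var N in v0 E2 E4 *; set A := [set w | _].
have mS : measurable_fun setT (grid_sum N).
  apply: (wrt_measurable _ (@grid_sum_adapted N)).
  exact: natural_filtration_measurable.
have mA : measurable A.
  rewrite /A -[X in measurable X]setTI.
  apply: measurable_fun_le => //; exact: measurable_funX.
have iA := intble_indic P mA.
have i2 : intble (fun w => grid_sum N w ^+ 2) by exact: intble_pow4.
(* With [y] the square of the sum: [y < v / 2] off [A], and
   [y <= y ^ 2 / (12 * v) + 3 * v] everywhere, since [(y - 6 * v) ^ 2 >= 0]. *)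
pose U w := v / 2 + ((12 * v)^-1 * grid_sum N w ^+ 4 + (3 * v) * \1_A w).
have iU1 : intble (fun w => (12 * v)^-1 * grid_sum N w ^+ 4 + (3 * v) * \1_A w).
  by apply: intbleD; exact: intbleZ.
have : v <= Ex U.
  rewrite -[leLHS]E2; apply: Ex_le => //.
    by apply: intbleD => //; exact: intble_cst.
  move=> w; rewrite /U indicE; set y := grid_sum N w ^+ 2.
  have -> : grid_sum N w ^+ 4 = y ^+ 2 by rewrite /y -exprM.
  have [wA|wA] := boolP (w \in A); last first.
    rewrite mulr0 addr0; move: wA; rewrite notin_setE /A/= -/y => /negP.
    rewrite -ltNge => /ltW h; apply: (le_trans h); rewrite lerDl mulr_ge0 ?sqr_ge0//.
    by rewrite invr_ge0 mulr_ge0// ltW.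
  rewrite /= mulr1 -subr_ge0.
  have -> : v / 2 + ((12 * v)^-1 * y ^+ 2 + 3 * v) - y =
     (12 * v)^-1 * ((y - 6 * v) ^+ 2 + 6 * v ^+ 2).
    by field; rewrite lt0r_neq0.
  by rewrite mulr_ge0 ?invr_ge0 ?mulr_ge0 ?addr_ge0 ?sqr_ge0 ?mulr_ge0 ?sqr_ge0// ltW.
rewrite ExD//; last exact: intble_cst.
rewrite Ex_cst ExD//; [|exact: intbleZ..].
rewrite !ExZ// => h.
have h2 : (12 * v)^-1 * Ex (fun w => grid_sum N w ^+ 4) <= v / 4.
  rewrite ler_pdivrMl ?mulr_gt0//; apply: (le_trans E4).
  by apply: le_of_eq; field.
have : v / 4 <= 3 * v * Ex (\1_A) by lra.
rewrite -ler_pdivrMl ?mulr_gt0//; apply: le_trans.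
by apply: le_of_eq; field; rewrite lt0r_neq0.
Qed.

End fourth_moment.

(** * Tails and tightness *)

Section square_integrability.
Context (d0 : measure_display) (Omega : measurableType d0) (R : realType).
Variables (P : probability Omega R) (n d : nat) (B : 'I_d -> R -> {RV P >-> R}).
Hypothesis hB : brownian_motion B.
Local Notation mu := (@lebesgue_measure R).

(** Dominated convergence. *)
Lemma sqint_tail (g : R -> R) (eps : R) : measurable_fun setT g ->
  (sqint mu g < +oo)%E -> 0 < eps ->
  \forall T \near +oo, (sqint mu (g \_ `[T, +oo[) <= eps%:E)%E.
Proof.
move=> mg fg eps0.
have mtail (T : R) : measurable_fun setT (g \_ `[T, +oo[).
  apply/(measurable_restrictT g (measurable_itv `[T, +oo[)).
  exact: measurable_funTS.
have ig : mu.-integrable setT (EFin \o (fun s => g s ^+ 2)).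
  apply/integrableP; split; first exact: measurable_sqr.
  apply: le_lt_trans fg; apply: ge0_le_integral => //.
  - by apply: measurableT_comp => //; exact: measurable_sqr.
  - exact: measurable_sqr.
  - by move=> s _; rewrite /= ger0_norm ?sqr_ge0.
have : (fun k : nat => sqint mu (g \_ `[k%:R, +oo[)) @ \oo --> 0%E.
  rewrite -[X in _ --> X](integral0 mu setT).
  apply: (@dominated_cvg _ _ _ mu setT measurableT
    (fun k s => ((g \_ `[k%:R, +oo[) s ^+ 2)%:E) (fun=> 0%E)
    (EFin \o (fun s => g s ^+ 2))) => //.
  - by move=> k; apply: measurable_sqr; exact: mtail.
  - move=> s _; apply: cvg_near_cst; near=> k.
    rewrite patchE mem_setE in_itv/= andbT ifF ?expr0n//.
    apply/negbTE; rewrite -ltNge; near: k; exact: nbhs_infty_gtr.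
  - move=> k s _; rewrite /= lee_fin ger0_norm ?sqr_ge0// patchE.
    by case: ifP => // _; rewrite expr0n sqr_ge0.
move=> /cvge0_near_lt - /(_ eps eps0)[k _ hk].
near=> T; apply: le_trans (ltW (hk k (leqnn k))).
apply: ge0_le_integral => //.
- by move=> s _; rewrite lee_fin sqr_ge0.
- by apply: measurable_sqr; exact: mtail.
- by apply: measurable_sqr; exact: mtail.
- move=> s _; rewrite lee_fin !patchE !mem_setE !in_itv/= !andbT.
  case: ifPn => [Ts|_]; last by rewrite expr0n sqr_ge0.
  by rewrite ifT// (le_trans _ Ts)//; near: T; exact: nbhs_pinfty_ge.
Unshelve. all: by end_near. Qed.

(** Tightness: the events that a term of rank at least [m] is at least [m] in
    absolute value decrease to an event on which the sequence is unbounded. *)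
Lemma ae_cvg_tight (M : nat -> Omega -> R) (Y : Omega -> R) (eps : R) :
  (forall k, measurable_fun setT (M k)) ->
  {ae P, forall w, M ^~ w @ \oo --> Y w} -> 0 < eps ->
  exists m : nat, forall k, (m <= k)%N ->
    (P [set w | (m%:R <= `|M k w|)%R] < eps%:E)%E.
Proof.
move=> mM [Z [mZ Z0 hZ]] eps0.
have mS (m k : nat) : measurable [set w | (m%:R <= `|M k w|)%R].
  rewrite -[X in measurable X]setTI.
  apply: measurable_fun_le => //; exact: measurableT_comp.
pose F (m : nat) := \bigcup_(k in [set k | (m <= k)%N]) [set w | (m%:R <= `|M k w|)%R].
have mF m : measurable (F m) by exact: bigcup_measurable.
have Fcap : measurable (\bigcap_m F m) by exact: bigcapT_measurable.
have PF0 : P (\bigcap_m F m) = 0%E.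
  apply: (subset_measure0 Fcap mZ _ Z0) => w wF; apply: hZ => /= cw.
  have /cvgrPdist_lt/(_ 1 ltr01)[m1 _ hm1] := cw.
  have [m2 hm2] : exists m2 : nat, `|Y w| + 1 < m2%:R.
    by exists (Num.bound (`|Y w| + 1)); apply: archi_boundP; rewrite addr_ge0.
  have [k /= mk] := wF (maxn m1 m2) I.
  have /hm1 /= hk : (m1 <= k)%N by rewrite (leq_trans _ mk)// leq_maxl.
  have h3 : m2%:R <= (maxn m1 m2)%:R :> R by rewrite ler_nat leq_maxr.
  have := ler_normD (M k w - Y w) (Y w); rewrite subrK distrC; lra.
have Fd : nonincreasing_seq F.
  move=> m m' mm'; apply/subsetPset => w [k /= m'k hk]; exists k => /=.
    exact: leq_trans mm' m'k.
  by apply: le_trans hk; rewrite ler_nat.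
have F0fin : (P (F 0%N) < +oo)%E by rewrite (le_lt_trans (probability_le1 _ _))// ltry.
have PF : (fun m => P (F m)) @ \oo --> 0%E.
  by rewrite -[X in _ --> X]PF0; exact: nonincreasing_cvg_mu.
have [m _ hm] := cvge0_near_lt _ PF eps0; exists m => k mk.
apply: le_lt_trans (hm m (leqnn m)); apply: le_measure; rewrite ?inE//.
by move=> w /= h; exists k.
Qed.

End square_integrability.

(** * Integrals that converge at infinity *)

Section convergent_integrals.
Context (d0 : measure_display) (Omega : measurableType d0) (R : realType).
Variables (P : probability Omega R) (n d : nat) (B : 'I_d -> R -> {RV P >-> R}).
Hypothesis hB : brownian_motion B.
Local Notation mu := (@lebesgue_measure R).
Local Notation Ex X := (\int[P]_w X w)%R.

Definition half_line (Phi : R -> 'M[R]_(n, d)) (i : 'I_n) (j : 'I_d) : R -> R :=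
  (fun s => Phi s i j) \_ `[0, +oo[.

Lemma half_line_measurable Phi : entries_continuous Phi ->
  forall i j, measurable_fun setT (half_line Phi i j).
Proof.
move=> cPhi i j; apply: (measurable_restrictT _ _).1; first exact: measurable_itv.
apply: measurable_funTS; apply: continuous_measurable_fun; exact: cPhi.
Qed.

Lemma half_line_cutE T Phi i j s : 0 <= T ->
  half_line Phi i j s - cut T Phi i j s = (half_line Phi i j \_ `[T, +oo[) s.
Proof.
move=> T0; rewrite /half_line /cut !patchE !mem_setE !in_itv/= !andbT.
have [Ts|sT] := leP T s; first by rewrite andbF subr0.
by rewrite andbT; case: ifP; rewrite subrr.
Qed.

Lemma half_line_tail Phi i (eps : R) : entries_continuous Phi ->
  (row_sqint (half_line Phi i) < +oo)%E -> 0 < eps ->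
  \forall T \near +oo,
    (row_sqint (fun j s => (cut T Phi i j s - half_line Phi i j s)%R) <= eps%:E)%E.
Proof.
move=> cPhi fin eps0; have e1 : 0 < eps / d.+1%:R by rewrite divr_gt0.
have mh := half_line_measurable cPhi i.
have tail : \forall T \near +oo, forall j,
    (sqint mu (half_line Phi i j \_ `[T, +oo[) <= (eps / d.+1%:R)%:E)%E.
  apply: filter_forall => j; apply: sqint_tail => //.
  apply: le_lt_trans fin; rewrite /row_sqint (bigD1 j)//= leeDl// sume_ge0// => k _.
  exact: sqint_ge0.
near=> T; have T0 : 0 <= T by near: T; exact: nbhs_pinfty_ge.
apply: (@le_trans _ _ (\sum_(j < d) (eps / d.+1%:R)%:E)%E).
  apply: lee_sum => j _; rewrite -sqintN.
  have -> : (fun s => - (cut T Phi i j s - half_line Phi i j s)) =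
      half_line Phi i j \_ `[T, +oo[.
    by apply/funext => s; rewrite opprB half_line_cutE.
  by have := near tail T; apply.
rewrite sumEFin lee_fin sumr_const card_ord -[_ *+ d]mulr_natr.
by rewrite mulrAC ler_pdivrMr// ler_wpM2l ?ltW// ltr_nat.
Unshelve. all: by end_near. Qed.

(** By the isometry the integrals over [0, k] form a Cauchy sequence in mean
    square, and Fatou's lemma shows that the almost sure limit is its limit. *)
Lemma half_line_limit Phi i (M : nat -> Omega -> R) (Y : Omega -> R) :
  entries_continuous Phi -> (row_sqint (half_line Phi i) < +oo)%E ->
  (forall k, ito_limit B (cut k%:R Phi i) (M k)) -> measurable_fun setT Y ->
  {ae P, forall w, M ^~ w @ \oo --> Y w} -> ito_limit B (half_line Phi i) Y.
Proof.
move=> cPhi fin hM mY MY; have mc T := cut_measurableW T cPhi.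
have mh := half_line_measurable cPhi i.
apply: ito_limit_closed => // eps eps0.
have [m _ hm] : \forall k \near \oo,
    (row_sqint (fun j s => (cut k%:R Phi i j s - half_line Phi i j s)%R) <= eps%:E)%E.
  exact: (@cvgr_idn R _ (half_line_tail cPhi fin eps0)).
have {}hm := hm m (leqnn m).
exists (cut m%:R Phi i), (M m); split; [exact: mc|exact: hM|exact: hm|].
apply: (@sqint_fatou _ _ _ _ (fun k => M (k + m)%N)) => //.
- by move=> k; have [] := hM (k + m)%N.
- by have [] := hM m.
- apply: filterS MY => w cw.
  by move: cw => /=; rewrite -(cvg_shiftn m).
- move=> k; rewrite (ito_limit_isometry hB (mc _ i) (mc _ i) (hM m) (hM (k + m)%N)).
  apply: le_trans hm; apply: lee_sum => j _; apply: ge0_le_integral => //.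
  + by move=> s _; rewrite lee_fin sqr_ge0.
  + exact: (measurable_sqr (measurable_funB (mc _ i j) (mc _ i j))).
  + exact: (measurable_sqr (measurable_funB (mc _ i j) (mh j))).
  + move=> s _; rewrite lee_fin /cut /half_line !patchE !mem_setE !in_itv/= !andbT.
    have [s0|_] := boolP (0 <= s); rewrite ?subrr//=.
    have [sm|sm] := ltP s m%:R; rewrite ?subrr ?expr0n ?sqr_ge0//=.
      by rewrite (lt_le_trans sm) ?subrr ?expr0n// ler_nat leq_addl.
    by case: ifP => _; rewrite ?subrr ?expr0n ?sqr_ge0.
Qed.

Section one_brownian.
Variables (Phi : R -> 'M[R]_(n, d)) (i : 'I_n) (j0 : 'I_d).
Hypotheses (cPhi : entries_continuous Phi)
           (Phi0 : forall s j, j != j0 -> Phi s i j = 0).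

Let time (T : R) N k := T * k%:R / N.+1%:R.

(** With a single nonzero column, a Riemann sum only involves increments of one
    motion, and the fourth moment bound applies. *)
Lemma riemann_grid_sum T (T0 : 0 < T) N w :
  elem_integral (sp_row (riemann_process B T0 N Phi) i) w =
  grid_sum B j0 (fun k => Phi (time T N k) i j0) (time T N) N.+1 w.
Proof.
rewrite sp_row_integral /simple_integral summxE; apply: eq_bigr => k _.
rewrite mxE (bigD1 j0)//= big1 ?addr0 ?mxE// => j jj0.
by rewrite Phi0// mul0r.
Qed.

(** Anticoncentration for a Riemann sum close to the integral in mean square:
    where the sum is at least [K + 1] and the integral less than [K], they
    differ by at least 1. *)
Lemma variance_spreads T (K : R) X : 0 < T -> 0 <= K ->
  ito_limit B (cut T Phi i) X ->
  ((8 * (K + 1) ^+ 2 + 1)%:E <= row_sqint (cut T Phi i))%E ->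
  ((16^-1)%:E <= P [set w | (K <= `|X w|)%R])%E.
Proof.
move=> T0 K0 hX hV; have mX := hX.1.
(* Chosen so that [1 / 12 - 1 / 48 = 1 / 16]. *)
have e0 : (0 : R) < 48^-1 by rewrite invr_gt0.
have [N hN] := riemann_process_approx B T0 cPhi e0.
have [v lv] := hN i; set l := sp_row _ i in lv *.
have mc := cut_measurableW T cPhi i.
rewrite -(elem_det_isometry hB lv mc hX).
pose c k := Phi (time T N k) i j0; pose S := grid_sum B j0 c (time T N) N.+1.
have -> : (fun w => elem_integral l w - X w) = (fun w => S w - X w).
  by apply/funext => w; rewrite /l riemann_grid_sum.
move=> SX.
have t0 k : 0 <= time T N k by rewrite /time divr_ge0// mulr_ge0// ltW.
have tS k : time T N k <= time T N k.+1.
  by rewrite /time ler_pM2r ?invr_gt0// ler_pM2l// ler_nat.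
have [i4 _ E2 _] := grid_sum_moments hB j0 c t0 tS N.+1; rewrite -/S in i4 E2.
set V := grid_var c _ _ in E2.
have mS : measurable_fun setT S.
  have -> : S = elem_integral l by apply/funext => w; rewrite /l riemann_grid_sum.
  exact: elem_integral_measurable.
have S2 : sqint P S = V%:E.
  by rewrite -E2 Ex_EFin//; exact: intble_pow4.
have Xc : sqint P X = row_sqint (cut T Phi i).
  have nil : elem_det ([::] : seq (block B)) (fun _ _ => 0).
    by move=> j s w; rewrite /elem_value big_nil.
  have := elem_det_isometry hB nil mc hX; rewrite (elem_det_dist _ nil).
  have -> : (fun w => elem_integral ([::] : seq (block B)) w - X w) = (fun w => - X w).
    by apply/funext => w; rewrite /elem_integral big_nil sub0r.
  rewrite sqintN => ->; apply: eq_bigr => j _; rewrite -sqintN; congr sqint.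
  by apply/funext => s; rewrite sub0r opprK.
have hV2 : 8 * (K + 1) ^+ 2 + 1 <= 4 * (V + 48^-1).
  rewrite -lee_fin; apply: (le_trans hV); rewrite -Xc.
  apply: (@le_trans _ _ (4%:E * (sqint P S + sqint P (fun w => S w - X w)%R))%E).
    rewrite -[sqint P (fun w => S w - X w)]sqintN; apply: sqint_le2 => //.
      by apply: measurableT_comp => //; exact: measurable_funB.
    by move=> w; ring.
  rewrite S2 EFinM; apply: lee_wpmul2l; first by rewrite lee_fin.
  by rewrite EFinD leeD2l.
have V0 : 2 * (K + 1) ^+ 2 <= V by lra.
have Vgt0 : 0 < V by apply: lt_le_trans V0; rewrite mulr_gt0// exprn_gt0// ltr_wpDl.
have := grid_sum_anticoncentration hB j0 t0 tS Vgt0; rewrite -/S -/V => hA.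
set A := [set w | _] in hA.
have mA : measurable A.
  rewrite /A -[X in measurable X]setTI.
  apply: measurable_fun_le => //; exact: measurable_funX.
set D := [set w | _].
have mD : measurable D.
  rewrite /D -[X in measurable X]setTI.
  apply: measurable_fun_le => //; exact: measurableT_comp.
have iSX : P.-integrable setT (EFin \o (fun w => (S w - X w) ^+ 2)).
  apply/integrableP; split; first by apply: measurable_sqr; exact: measurable_funB.
  apply: (@le_lt_trans _ _ (sqint P (fun w => S w - X w)%R)).
    apply: le_of_eq; apply: eq_integral => w _.
    by rewrite /= ger0_norm ?sqr_ge0.
  by rewrite (le_lt_trans SX)// ltry.
have SX' : Ex (fun w => (S w - X w) ^+ 2) <= 48^-1 by rewrite -lee_fin Ex_EFin.
have : Ex (\1_A) <= Ex (fun w => \1_D w + (S w - X w) ^+ 2).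
  apply: Ex_le; first exact: intble_indic.
    by apply: intbleD => //; exact: intble_indic.
  move=> w; rewrite !indicE.
  have [wA|_] := boolP (w \in A); last by rewrite addr_ge0 ?sqr_ge0.
  have [_|wD] := boolP (w \in D); first by rewrite lerDl sqr_ge0.
  rewrite add0r; move: wA wD; rewrite inE notin_setE /A /D/= => wA /negP; rewrite -ltNge.
  have {}wA : K + 1 <= `|S w|.
    rewrite -(@ler_pXn2r _ 2%N) ?nnegrE ?addr_ge0// real_normK ?num_real//.
    by apply: le_trans wA; lra.
  move=> wD; have h1 : 1 <= `|S w - X w|.
    by have := ler_normD (S w - X w) (X w); rewrite subrK; lra.
  by rewrite -[leRHS]real_normK ?num_real// -[leLHS](expr1n _ 2) ler_pXn2r ?nnegrE.
rewrite ExD//; last exact: intble_indic.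
rewrite [X in X + _]Ex_indic// => hle.
have fP : P D \is a fin_num by exact: fin_num_measure.
rewrite -(fineK fP) lee_fin; lra.
Qed.

(** If the integral over [0, k] converges almost surely as k grows, its variance
    stays bounded: by tightness it cannot spread. *)
Lemma ae_cvg_sqint_fin (M : nat -> Omega -> R) (Y : Omega -> R) :
  (forall k, ito_limit B (cut k%:R Phi i) (M k)) ->
  {ae P, forall w, M ^~ w @ \oo --> Y w} -> (row_sqint (half_line Phi i) < +oo)%E.
Proof.
move=> hM MY; have e0 : (0 : R) < 16^-1 by rewrite invr_gt0.
have [m hm] := ae_cvg_tight (fun k => (hM k).1) MY e0.
pose C : R := 8 * (m%:R + 1) ^+ 2 + 1.
have bound k : (m < k)%N -> (row_sqint (cut k%:R Phi i) <= C%:E)%E.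
  move=> mk; rewrite leNgt; apply/negP => /ltW hC.
  have k0 : (0 : R) < k%:R by rewrite ltr0n (leq_trans _ mk).
  have := variance_spreads k0 (ler0n R m) (hM k) hC.
  by rewrite leNgt hm// ltnW.
have mc T := cut_measurableW T cPhi i.
have fin j : (sqint mu (half_line Phi i j) <= C%:E)%E.
  have cv : (fun k : nat => sqint mu (cut k%:R Phi i j)) @ \oo -->
      sqint mu (half_line Phi i j).
    have lim s : (fun k : nat => (cut k%:R Phi i j s ^+ 2)%:E) @ \oo -->
        (half_line Phi i j s ^+ 2)%:E.
      apply: cvg_near_cst; near=> k.
      rewrite /cut /half_line !patchE !mem_setE !in_itv/= andbT.
      suff -> : s < k%:R by rewrite andbT.
      by near: k; exact: nbhs_infty_gtr.
    have := @cvg_monotone_convergence _ _ _ mu setT measurableT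
      (fun k s => (cut k%:R Phi i j s ^+ 2)%:E).
    rewrite (_ : (fun x => limn _) = (fun s => (half_line Phi i j s ^+ 2)%:E)).
      apply.
      - by move=> k; apply: measurable_sqr; exact: mc.
      - by move=> k s _; rewrite lee_fin sqr_ge0.
      - move=> s _ k k' kk'; rewrite lee_fin /cut !patchE !mem_setE !in_itv/=.
        case: ifP => [/andP[-> sk]|_]; last by rewrite expr0n sqr_ge0.
        by rewrite (lt_le_trans sk)// ler_nat.
    by apply/funext => s; apply/cvg_lim => //; exact: lim.
  rewrite -(cvg_lim _ cv)//; apply: lime_le; first exact: cvgP cv.
  exists m.+1 => // k /= mk; apply: le_trans (bound k mk).
  rewrite /row_sqint (bigD1 j)//= leeDl// sume_ge0// => k' _.
  exact: sqint_ge0.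
apply: (@le_lt_trans _ _ (\sum_(j < d) C%:E)%E); first exact: lee_sum.
by rewrite sumEFin ltry.
Unshelve. all: by end_near. Qed.

End one_brownian.
End convergent_integrals.

(** * Matrix-valued functions on the half line *)

Section matrix_functions.
Context (R : realType).
Implicit Types (m n p : nat).

Lemma cvg_entries m n (I : Type) (F : set_system I) (f : I -> 'M[R]_(m, n)) (A : 'M[R]_(m, n)) :
  Filter F -> (forall i j, (fun x => f x i j) @ F --> A i j) -> f @ F --> A.
Proof.
move=> FF h U /nbhs_ballP[e /= e0 eU].
have hb i j : \forall x \near F, ball (A i j) e (f x i j).
  by have /cvg_ballP := h i j; exact.
have : \forall x \near F, forall ij : 'I_m * 'I_n, ball (A ij.1 ij.2) e (f x ij.1 ij.2).
  by apply: filter_forall => -[i j]; exact: hb.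
by apply: filterS => x hx; apply: eU; split=> // i j; exact: (hx (i, j)).
Qed.

(** The values of a function on the half line determine a function on R; the
    extension is continuous when the given function is. *)
Definition extend m n (f : R -> 'M[R]_(m, n)) (s : R) : 'M[R]_(m, n) := f (Num.max s 0).

Lemma extendE m n (f : R -> 'M[R]_(m, n)) s : 0 <= s -> extend f s = f s.
Proof. by move=> s0; rewrite /extend max_l. Qed.

Lemma entries_continuous_extend m n (f : R -> 'M[R]_(m, n)) :
  continuous_half_line f -> entries_continuous (extend f).
Proof.
move=> /continuous_half_line_max cf i j s.
have cij : continuous (fun M : 'M[R]_(m, n) => M i j) by exact: coord_continuous.
exact: (continuous_comp (cf s) (cij _)).
Qed.

(** Retraction of R onto [0, t], used to bring the second variable of a kernel
    into the triangle. *)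
Definition clamp (t s : R) := Num.min (Num.max s 0) t.

Lemma entries_continuous_clamp m n (H : R -> R -> 'M[R]_(m, n)) (t : R) : 0 <= t ->
  {within @triangle R, continuous (fun p : R * R => H p.1 p.2)} ->
  entries_continuous (fun s => H t (clamp t s)).
Proof.
move=> t0 cH i j s.
have cc : continuous (clamp t).
  move=> x; apply: (@continuous_min R R (fun y => Num.max y 0) (fun=> t)).
    exact: (@max0_continuous R x).
  exact: cvg_cst.
have cr : continuous (fun x : R => (t, clamp t x)).
  by move=> x; exact: (cvg_pair (@cvg_cst _ t _ (nbhs x) _) (cc x)).
have cHr := within_continuous_comp cH cr.
have cij : continuous (fun M : 'M[R]_(m, n) => M i j) by exact: coord_continuous.
refine (continuous_comp (cHr _ s) (cij _)) => x; rewrite /triangle /clamp/=; split.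
  by rewrite le_min t0 le_max lexx orbT.
by rewrite ge_min lexx orbT.
Qed.

Lemma entries_continuous_mulmx m n p (A : R -> 'M[R]_(m, n)) (f : R -> 'M[R]_(n, p)) :
  entries_continuous A -> entries_continuous f ->
  entries_continuous (fun s => A s *m f s).
Proof.
move=> cA cf i j.
have -> : (fun s => (A s *m f s) i j) = (fun s => \sum_k A s i k * f s k j).
  by apply/funext => s; rewrite mxE.
elim: (index_enum _) => [|k r IH] s.
  by under eq_fun do rewrite big_nil; exact: cvg_cst.
under eq_fun do rewrite big_cons; apply: cvgD; last exact: IH.
by apply: cvgM; [exact: cA|exact: cf].
Qed.

Lemma entries_continuousB m n (A C : R -> 'M[R]_(m, n)) :
  entries_continuous A -> entries_continuous C ->
  entries_continuous (fun s => A s - C s).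
Proof.
move=> cA cC i j.
have -> : (fun s => (A s - C s) i j) = (fun s => A s i j - C s i j).
  by apply/funext => s; rewrite !mxE.
by move=> s; apply: cvgB; [exact: cA|exact: cC].
Qed.

(** An entrywise estimate; the constant is far from optimal. *)
Lemma frobenius_mul_le m n p (A : 'M[R]_(m, n)) (C : 'M[R]_(n, p)) K :
  frobenius C <= K ->
  frobenius (A *m C) ^+ 2 <= (m * p)%:R * (n%:R * K) ^+ 2 * frobenius A ^+ 2.
Proof.
move=> CK; have A0 : 0 <= frobenius A by exact: sqrtr_ge0.
have K0 : 0 <= K by apply: le_trans CK; exact: sqrtr_ge0.
have entry i j : (A *m C) i j ^+ 2 <= (n%:R * K) ^+ 2 * frobenius A ^+ 2.
  rewrite -exprMn -[leLHS]real_normK ?num_real// ler_pXn2r ?nnegrE ?mulr_ge0//.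
  rewrite mxE; apply: (le_trans (ler_norm_sum _ _ _)).
  apply: (@le_trans _ _ (\sum_(k < n) frobenius A * K)).
    apply: ler_sum => k _; rewrite normrM ler_pM//.
      exact: frobenius_ge_entry.
    by apply: le_trans CK; exact: frobenius_ge_entry.
  by rewrite sumr_const card_ord -[_ *+ n]mulr_natr; apply: le_of_eq; ring.
rewrite frobenius_sqr.
apply: (@le_trans _ _ (\sum_(i < m) \sum_(j < p) (n%:R * K) ^+ 2 * frobenius A ^+ 2)).
  by apply: ler_sum => i _; apply: ler_sum => j _.
rewrite !sumr_const !card_ord -mulrnA mulnC -[_ *+ (m * p)]mulr_natr.
by rewrite [leLHS]mulrC mulrA.
Qed.

Local Notation mu := (@lebesgue_measure R).

Lemma frobenius_sqr_measurable m n (Phi : R -> 'M[R]_(m, n)) (D : set R) :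
  entries_continuous Phi -> measurable_fun D (fun s => (frobenius (Phi s) ^+ 2)%:E).
Proof.
move=> cPhi; apply/measurable_funTS/measurable_EFinP.
under eq_fun do rewrite frobenius_sqr.
apply: measurable_sum => i; apply: measurable_sum => j; apply: measurable_funX.
by apply: continuous_measurable_fun; exact: cPhi.
Qed.

Lemma frobenius_integralE m n (Phi : R -> 'M[R]_(m, n)) (D : set R) : measurable D ->
  entries_continuous Phi ->
  (\int[mu]_(s in D) (frobenius (Phi s) ^+ 2)%:E =
   \sum_(i < m) \sum_(j < n) sqint mu ((fun s => Phi s i j) \_ D))%E.
Proof.
move=> mD cPhi.
have mPhi i j : measurable_fun D (fun s => (Phi s i j ^+ 2)%:E).
  apply/measurable_EFinP/measurable_funX/measurable_funTS.
  by apply: continuous_measurable_fun; exact: cPhi.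
have sqintE i j : sqint mu ((fun s => Phi s i j) \_ D) =
    (\int[mu]_(s in D) (Phi s i j ^+ 2)%:E)%E.
  rewrite [RHS]integral_mkcond; apply: eq_integral => s _; rewrite !patchE.
  by case: ifP => // _; rewrite expr0n.
under [LHS]eq_integral do rewrite frobenius_sqr -sumEFin.
rewrite ge0_integral_sum//; last 2 first.
- move=> i; under eq_fun do rewrite -sumEFin.
  by apply: emeasurable_sum => j; exact: mPhi.
- by move=> i s _; rewrite lee_fin sumr_ge0// => j _; exact: sqr_ge0.
apply: eq_bigr => i _; under eq_integral do rewrite -sumEFin.
rewrite ge0_integral_sum//; last 2 first.
- by move=> j; exact: mPhi.
- by move=> j s _; rewrite lee_fin sqr_ge0.
by apply: eq_bigr => j _; rewrite sqintE.
Qed.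

Lemma frobenius_integral_cut n d (Phi : R -> 'M[R]_(n, d)) (t : R) : entries_continuous Phi ->
  (\int[mu]_(s in `[0%R, t]) (frobenius (Phi s) ^+ 2)%:E =
   \sum_(i < n) row_sqint (cut t Phi i))%E.
Proof.
move=> cPhi; rewrite -integral_itv_bndo_bndc; last exact: frobenius_sqr_measurable.
exact: frobenius_integralE.
Qed.

Lemma frobenius_integral_half_line n d (Phi : R -> 'M[R]_(n, d)) :
  entries_continuous Phi ->
  (\int[mu]_(s in `[0%R, +oo[) (frobenius (Phi s) ^+ 2)%:E =
   \sum_(i < n) row_sqint (half_line Phi i))%E.
Proof. by move=> cPhi; exact: frobenius_integralE. Qed.

End matrix_functions.

(** * Existence and comparison of matrix-valued integrals *)

Section stochastic_convergence.
Context (d0 : measure_display) (Omega : measurableType d0) (R : realType).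
Variables (P : probability Omega R) (n d : nat) (B : 'I_d -> R -> {RV P >-> R}).
Hypothesis hB : brownian_motion B.
Local Notation mu := (@lebesgue_measure R).

Lemma row_sqint_le2 (g r h : 'I_d -> R -> R) :
  (forall j, measurable_fun setT (g j)) -> (forall j, measurable_fun setT (r j)) ->
  (forall j, measurable_fun setT (h j)) ->
  (row_sqint (fun j s => (g j s - h j s)%R) <=
   4%:E * (row_sqint (fun j s => (g j s - r j s)%R) +
           row_sqint (fun j s => (r j s - h j s)%R)))%E.
Proof.
move=> mg mr mh; rewrite /row_sqint -big_split/= ge0_sume_distrr; last first.
  by move=> j _; rewrite adde_ge0// sqint_ge0.
apply: lee_sum => j _; apply: sqint_le2.
- exact: (measurable_funB (mg j) (mr j)).
- exact: (measurable_funB (mr j) (mh j)).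
- by move=> s; ring.
Qed.

Lemma half_line_approx (Phi : R -> 'M[R]_(n, d)) (eps : R) i : entries_continuous Phi ->
  (row_sqint (half_line Phi i) < +oo)%E -> 0 < eps ->
  exists l : seq (block B), (integrand_dist l (half_line Phi i) <= eps%:E)%E.
Proof.
move=> cPhi fin eps0; have e8 : 0 < eps / 8 by rewrite divr_gt0.
have /filter_ex[T [T0 hT]] : \forall T \near +oo, 0 <= T /\
    (row_sqint (fun j s => (cut T Phi i j s - half_line Phi i j s)%R) <= (eps / 8)%:E)%E.
  near=> T; split; first by near: T; exact: nbhs_pinfty_ge.
  by near: T; exact: half_line_tail.
have [phi hphi] := riemann_approx B T0 cPhi e8.
have [v lv hv] := hphi i; exists (sp_row phi i).
move: hv; rewrite !(elem_det_dist _ lv) => hv.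
have mv j := elem_det_measurable j lv.
apply: (le_trans (row_sqint_le2 mv (cut_measurableW T cPhi i)
  (half_line_measurable cPhi i))).
have -> : eps%:E = (4%:E * ((eps / 8)%:E + (eps / 8)%:E))%E.
  by rewrite -!EFinD; congr EFin; field.
by apply: lee_wpmul2l => //; exact: leeD.
Unshelve. all: by end_near. Qed.

Lemma within_continuous_eq (T : topologicalType) (f F : R -> T) : continuous F ->
  (forall t, 0 <= t -> f t = F t) -> {within `[0, +oo[%classic, continuous f}.
Proof.
move=> cF fF; apply/subspace_continuousP => x; rewrite /= in_itv/= andbT => x0.
have -> : from_subspace `[0, +oo[ f x = F x by exact: fF.
move=> W FW; have h : nbhs x (fun t => W (F t)) := cF x _ FW.
rewrite /nbhs/=; apply: (filterS _ h) => t Wt.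
by rewrite /= in_itv/= andbT => t0; rewrite [from_subspace _ _ _](fF t t0).
Qed.

(** Each row is the [version] built from lists that approximate it on the whole
    half line; almost surely all rows are regular simultaneously. *)
Lemma ito_process_exists (Phi : R -> 'M[R]_(n, d)) : entries_continuous Phi ->
  (forall i, row_sqint (half_line Phi i) < +oo)%E ->
  exists (M : R -> Omega -> 'cV[R]_n) (Y : Omega -> 'cV[R]_n),
    [/\ forall T, 0 <= T -> is_ito_integral B T (fun s _ => Phi s) (M T),
        forall i, ito_limit B (half_line Phi i) (fun w => Y w i 0),
        {ae P, forall w, continuous_half_line (fun T => M T w)} &
        {ae P, forall w, (fun T => M T w) @ +oo --> Y w}].
Proof.
move=> cPhi fin; have mh i := half_line_measurable cPhi i.
have /choice[l hl] : forall ik : 'I_n * nat, exists l : seq (block B),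
    (integrand_dist l (half_line Phi ik.1) <= ((8 ^+ ik.2)^-1)%:E)%E.
  by move=> [i k]; apply: half_line_approx => //; rewrite invr_gt0 exprn_gt0.
pose L i k := l (i, k).
have hL i k : (integrand_dist (L i k) (half_line Phi i) <= ((8 ^+ k)^-1)%:E)%E.
  exact: (hl (i, k)).
have ae_reg : {ae P, forall w, forall i, regular_path (L i) w}.
  by apply: filter_forall => i; exact: (ae_regular_path hB (mh i) (hL i)).
exists (fun T w => \col_i version (L i) T w), (fun w => \col_i version_limit (L i) w).
split.
- move=> T T0; apply: ito_limit_is_ito_integral => // i.
  have := version_ito_limit hB (mh i) (hL i) T0.
  have -> : (fun w => (\col_i' version (L i') T w) i 0) = version (L i) T.
    by apply/funext => w; rewrite mxE.
  suff -> : cut T Phi i = (fun j => half_line Phi i j \_ `[0, T[) by [].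
  apply/funext => j; apply/funext => s; rewrite /cut /half_line !patchE !mem_setE !in_itv/= andbT.
  by case: (boolP (0 <= s)) => //=; case: ifP.
- move=> i; have := version_limit_ito_limit hB (mh i) (hL i); congr ito_limit.
  by apply/funext => w; rewrite mxE.
- apply: filterS ae_reg => w rw.
  have cv i : continuous (fun T : R => version (L i) (Num.max T 0) w).
    exact: (version_continuous (rw i)).
  apply: (@within_continuous_eq _ _ (fun T => \col_i version (L i) (Num.max T 0) w)).
    move=> T; apply: cvg_entries => i j.
    have -> : (fun x => (\col_i version (L i) (Num.max x 0) w) i j) =
        (fun x => version (L i) (Num.max x 0) w) by apply/funext => x; rewrite mxE.
    rewrite mxE; exact: (cv i T).
  by move=> T T0; rewrite max_l.
- apply: filterS ae_reg => w rw; apply: cvg_entries => i j.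
  have -> : (fun T => (\col_i version (L i) T w) i j) = (fun T => version (L i) T w).
    by apply/funext => T; rewrite mxE.
  rewrite mxE; exact: (version_cvg_infty (rw i)).
Qed.

Lemma ito_integral_exists T (Phi : R -> 'M[R]_(n, d)) : 0 <= T -> entries_continuous Phi ->
  exists X : Omega -> 'cV[R]_n, is_ito_integral B T (fun s _ => Phi s) X.
Proof.
move=> T0 cPhi; have mc := cut_measurableW T cPhi.
have /choice[l hl] : forall ik : 'I_n * nat, exists l : seq (block B),
    (integrand_dist l (cut T Phi ik.1) <= ((8 ^+ ik.2)^-1)%:E)%E.
  move=> [i k]; have e0 : (0 : R) < (8 ^+ k)^-1 by rewrite invr_gt0 exprn_gt0.
  have [phi hphi] := riemann_approx B T0 cPhi e0.
  by have [v _ hv] := hphi i; exists (sp_row phi i).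
exists (fun w => \col_i version_limit (fun k => l (i, k)) w).
apply: ito_limit_is_ito_integral => // i.
have := version_limit_ito_limit hB (mc i) (fun k => hl (i, k)); congr ito_limit.
by apply/funext => w; rewrite mxE.
Qed.

Section comparison.
Variables (T : R) (Phi Psi : R -> 'M[R]_(n, d)) (X Y : Omega -> 'cV[R]_n).
Hypotheses (T0 : 0 <= T) (cPhi : entries_continuous Phi) (cPsi : entries_continuous Psi).
Hypothesis hX : is_ito_integral B T (fun s _ => Phi s) X.
Hypothesis hY : forall i, ito_limit B (half_line Psi i) (fun w => Y w i 0).

Lemma ito_distE : ('E_P[fun w => (frobenius (X w - Y w) ^+ 2)%R] =
  \sum_i row_sqint (fun j s => (cut T Phi i j s - half_line Psi i j s)%R))%E.
Proof.
have mc := cut_measurableW T cPhi; have mh := half_line_measurable cPsi.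
have lX := is_ito_integral_limit mc hX.
rewrite frobenius_expectationE.
- apply: eq_bigr => i _; exact: (ito_limit_isometry hB (mc i) (mh i) (lX i) (hY i)).
- by move=> i; have [] := lX i.
- by move=> i; have [] := hY i.
Qed.

(** Beyond [T] the integrand of [Y] only adds to the distance. *)
Lemma ito_dist_ge : (\int[mu]_(s in `[0%R, T]) (frobenius (Phi s - Psi s) ^+ 2)%:E <=
  'E_P[fun w => (frobenius (X w - Y w) ^+ 2)%R])%E.
Proof.
rewrite ito_distE (frobenius_integral_cut _ (entries_continuousB cPhi cPsi)).
apply: lee_sum => i _; apply: lee_sum => j _; apply: ge0_le_integral => //.
- by move=> s _; rewrite lee_fin sqr_ge0.
- exact: (measurable_sqr (cut_measurableW T (entries_continuousB cPhi cPsi) i j)).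
- exact: (measurable_sqr (measurable_funB (cut_measurableW T cPhi i j)
    (half_line_measurable cPsi i j))).
- move=> s _; rewrite lee_fin /cut /half_line !patchE !mem_setE !in_itv/= andbT.
  case: (boolP (0 <= s)) => _ /=; last by rewrite expr0n sqr_ge0.
  by case: ifP => _; rewrite ?mxE// expr0n sqr_ge0.
Qed.

Lemma ito_dist_le : ('E_P[fun w => (frobenius (X w - Y w) ^+ 2)%R] <=
  4%:E * (\int[mu]_(s in `[0%R, T]) (frobenius (Phi s - Psi s) ^+ 2)%:E +
    \sum_i row_sqint (fun j s => (cut T Psi i j s - half_line Psi i j s)%R)))%E.
Proof.
rewrite ito_distE (frobenius_integral_cut _ (entries_continuousB cPhi cPsi)).
rewrite -big_split/= ge0_sume_distrr; last first.
  by move=> i _; rewrite adde_ge0// row_sqint_ge0.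
apply: lee_sum => i _.
apply: (le_trans (row_sqint_le2 (cut_measurableW T cPhi i) (cut_measurableW T cPsi i)
  (half_line_measurable cPsi i))).
apply: lee_wpmul2l => //; apply: leeD => //.
apply: le_of_eq; apply: eq_bigr => j _.
congr sqint; apply/funext => s; rewrite /cut !patchE.
by case: ifP => _; rewrite ?mxE ?subrr.
Qed.

End comparison.
End stochastic_convergence.

(** * Convergence of integrals of kernels *)

Section kernels.
Context (d0 : measure_display) (Omega : measurableType d0) (R : realType).
Variables (P : probability Omega R) (n d : nat) (B : 'I_d -> R -> {RV P >-> R}).
Hypothesis hB : brownian_motion B.
Variable H : R -> R -> 'M[R]_n.
Hypothesis hH : {within @triangle R, continuous (fun p : R * R => H p.1 p.2)}.
Local Notation mu := (@lebesgue_measure R).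

Lemma clampE (t s : R) : 0 <= s <= t -> clamp t s = s.
Proof. by move=> /andP[s0 st]; rewrite /clamp (max_l s0) min_l. Qed.

Lemma frobenius_integral_mul_le (A : R -> 'M[R]_n) (f : R -> 'M[R]_(n, d)) K (D : set R) :
  measurable D -> entries_continuous A -> entries_continuous f ->
  (forall s, frobenius (f s) <= K) ->
  (\int[mu]_(s in D) (frobenius (A s *m f s) ^+ 2)%:E <=
   ((n * d)%:R * (n%:R * K) ^+ 2)%:E * \int[mu]_(s in D) (frobenius (A s) ^+ 2)%:E)%E.
Proof.
move=> mD cA cf fK; rewrite -ge0_integralZl//; last 3 first.
- exact: frobenius_sqr_measurable.
- by move=> s _; rewrite lee_fin sqr_ge0.
- by rewrite lee_fin mulr_ge0// sqr_ge0.
apply: ge0_le_integral => //.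
- by move=> s _; rewrite lee_fin sqr_ge0.
- by apply: frobenius_sqr_measurable; exact: entries_continuous_mulmx.
- apply: measurable_funeM; exact: frobenius_sqr_measurable.
- by move=> s _; rewrite -EFinM lee_fin frobenius_mul_le.
Qed.

Lemma frobenius_integral_clampE (Hoo : R -> 'M[R]_n) (t : R) :
  (\int[mu]_(s in `[0%R, t]) (frobenius (H t (clamp t s) - extend Hoo s) ^+ 2)%:E =
   \int[mu]_(s in `[0%R, t]) (frobenius (H t s - Hoo s) ^+ 2)%:E)%E.
Proof.
apply: eq_integral => s; rewrite mem_setE in_itv/= => st.
by rewrite clampE// extendE//; case/andP: st.
Qed.

Lemma frobenius_integral_extendE (Hoo : R -> 'M[R]_n) :
  (\int[mu]_(s in `[0%R, +oo[) (frobenius (extend Hoo s) ^+ 2)%:E =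
   \int[mu]_(s in `[0%R, +oo[) (frobenius (Hoo s) ^+ 2)%:E)%E.
Proof.
by apply: eq_integral => s; rewrite mem_setE in_itv/= andbT => s0; rewrite extendE.
Qed.

Let mean_square (X Y : Omega -> 'cV[R]_n) :=
  'E_P[fun w => (frobenius (X w - Y w) ^+ 2)%R]%E.

Let mean_square_ge0 X Y : (0 <= mean_square X Y)%E.
Proof. by apply: expectation_ge0 => w; exact: sqr_ge0. Qed.

(** Boundedness of [f] makes [Hoo s *m f s] square integrable, so its integral
    process exists and converges. The distance between the two integrals is
    controlled by the distance of the kernels on [0, t] and a tail of
    [Hoo s *m f s]. *)
Lemma mean_square_convergence (Hoo : R -> 'M[R]_n) (f : R -> 'M[R]_(n, d)) :
  continuous_half_line Hoo ->
  (\int[mu]_(s in `[0%R, +oo[) (frobenius (Hoo s) ^+ 2)%:E < +oo)%E ->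
  (fun t : R => \int[mu]_(s in `[0%R, t]) (frobenius (H t s - Hoo s) ^+ 2)%:E)%E
    @ +oo --> 0%E ->
  bounded_continuous_half_line f ->
  exists (X : R -> Omega -> 'cV[R]_n) (Y : Omega -> 'cV[R]_n),
    [/\ forall t : R, 0 <= t -> is_ito_integral B t (fun s _ => H t s *m f s) (X t),
        is_ito_integral_half_line B (fun s _ => Hoo s *m f s) Y &
        (fun t => mean_square (X t) Y) @ +oo --> 0%E].
Proof.
move=> cHoo fin lim [cf [K hK]].
have cHoo' := entries_continuous_extend cHoo; have cf' := entries_continuous_extend cf.
have fK s : frobenius (extend f s) <= K by apply: hK; rewrite le_max lexx orbT.
pose Phi t s := H t (clamp t s) *m extend f s.
pose Psi s := extend Hoo s *m extend f s.
have cPsi : entries_continuous Psi by exact: entries_continuous_mulmx.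
have cH t : 0 <= t -> entries_continuous (fun s => H t (clamp t s)).
  by move=> t0; exact: entries_continuous_clamp.
have cPhi t : 0 <= t -> entries_continuous (Phi t).
  by move=> t0; apply: entries_continuous_mulmx => //; exact: cH.
pose c : R := (n * d)%:R * (n%:R * K) ^+ 2.
have c0 : 0 <= c by rewrite mulr_ge0// sqr_ge0.
have finPsi i : (row_sqint (half_line Psi i) < +oo)%E.
  apply: (@le_lt_trans _ _ (\sum_(i < n) row_sqint (half_line Psi i))%E).
    rewrite (bigD1 i)//= leeDl// sume_ge0// => k _; exact: row_sqint_ge0.
  rewrite -frobenius_integral_half_line//.
  apply: (le_lt_trans (frobenius_integral_mul_le (measurable_itv _) cHoo' cf' fK)).
  rewrite frobenius_integral_extendE -/c lte_mul_pinfty// ge0_fin_numE//.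
have [M [Y [hM hY Mc MY]]] := ito_process_exists hB cPsi finPsi.
have /choice[X hX] : forall t, exists X : Omega -> 'cV[R]_n, 0 <= t ->
    is_ito_integral B t (fun s _ => Phi t s) X.
  move=> t; have [t0|t0] := leP 0 t; last by exists (fun=> 0).
  by have [X hX] := ito_integral_exists hB t0 (cPhi t t0); exists X.
exists X, Y; split.
- move=> t t0; apply: is_ito_integral_ext (hX t t0) => s st.
  by rewrite /Phi clampE// extendE//; case/andP: st.
- split; first by move=> i; have [] := hY i.
  exists M; split; [move=> T T0|exact: Mc|exact: MY].
  apply: is_ito_integral_ext (hM T T0) => s /andP[s0 _].
  by rewrite /Psi !extendE.
apply: near_le_cvge0 => // eps eps0.
have e1 : 0 < eps / (8 * (c + 1)) by rewrite divr_gt0// mulr_gt0// ltr_wpDl.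
have e2 : 0 < eps / (8 * n.+1%:R) by rewrite divr_gt0// mulr_gt0.
have tails : \forall t \near +oo, forall i,
    (row_sqint (fun j s => (cut t Psi i j s - half_line Psi i j s)%R) <=
     (eps / (8 * n.+1%:R))%:E)%E.
  by apply: filter_forall => i; exact: half_line_tail.
have kernel := cvge0_near_lt _ lim e1.
near=> t; have t0 : 0 <= t by near: t; exact: nbhs_pinfty_ge.
apply: (le_trans (ito_dist_le hB (cPhi t t0) cPsi (hX t t0) hY)).
have -> : eps%:E = (4%:E * ((eps / 8)%:E + (eps / 8)%:E))%E.
  by rewrite -!EFinD -EFinM; congr EFin; field.
apply: lee_wpmul2l => //; apply: leeD.
  have -> : (fun s => (frobenius (Phi t s - Psi s) ^+ 2)%:E) =
      (fun s => (frobenius ((H t (clamp t s) - extend Hoo s) *m extend f s) ^+ 2)%:E).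
    by apply/funext => s; rewrite mulmxBl.
  apply: (le_trans (frobenius_integral_mul_le (measurable_itv _)
    (entries_continuousB (cH t t0) cHoo') cf' fK)).
  rewrite frobenius_integral_clampE -/c.
  apply: (@le_trans _ _ (c%:E * (eps / (8 * (c + 1)))%:E)%E).
    apply: lee_wpmul2l; first by rewrite lee_fin.
    by apply: ltW; near: t; exact: kernel.
  have -> : eps / 8 = (c + 1) * (eps / (8 * (c + 1))).
    by field; rewrite lt0r_neq0// ltr_wpDl.
  by rewrite -EFinM lee_fin ler_wpM2r ?(ltW e1)// lerDl.
apply: (@le_trans _ _ (\sum_(i < n) (eps / (8 * n.+1%:R))%:E)%E).
  by apply: lee_sum => i _; have := near tails t; apply.
rewrite sumEFin lee_fin sumr_const card_ord -[_ *+ n]mulr_natr.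
have -> : eps / 8 = eps / (8 * n.+1%:R) * n.+1%:R by field.
by rewrite ler_wpM2l ?(ltW e2)// ler_nat.
Unshelve. all: by end_near. Qed.

(** The integrands [delta_mx p j0] single out the columns of the kernel. *)
Lemma mulmx_delta_entry (A : 'M[R]_n) (p : 'I_n) (j0 : 'I_d) i j :
  (A *m delta_mx p j0 : 'M[R]_(n, d)) i j = A i p * (j == j0)%:R.
Proof.
rewrite mxE (bigD1 p)//= big1 ?addr0 ?mxE ?eqxx// => k kp.
by rewrite mxE (negbTE kp) mulr0.
Qed.

Lemma frobenius_columns (A : 'M[R]_n) (j0 : 'I_d) :
  frobenius A ^+ 2 = \sum_p frobenius (A *m delta_mx p j0 : 'M[R]_(n, d)) ^+ 2.
Proof.
under eq_bigr do rewrite frobenius_sqr.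
rewrite frobenius_sqr exchange_big; apply: eq_bigr => p _; apply: eq_bigr => i _.
rewrite (bigD1 j0)//= big1 ?addr0; first by rewrite mulmx_delta_entry eqxx mulr1.
by move=> j jj0; rewrite mulmx_delta_entry (negbTE jj0) mulr0 expr0n.
Qed.

Lemma frobenius_integral_columns (A : R -> 'M[R]_n) (j0 : 'I_d) (D : set R) :
  measurable D -> entries_continuous A ->
  (\int[mu]_(s in D) (frobenius (A s) ^+ 2)%:E =
   \sum_p \int[mu]_(s in D) (frobenius (A s *m delta_mx p j0 : 'M[R]_(n, d)) ^+ 2)%:E)%E.
Proof.
move=> mD cA; rewrite -ge0_integral_sum//; last 2 first.
- move=> p; apply: frobenius_sqr_measurable; apply: entries_continuous_mulmx => // i j s.
  exact: cvg_cst.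
- by move=> p s _; rewrite lee_fin sqr_ge0.
by apply: eq_integral => s _; rewrite (frobenius_columns _ j0) sumEFin.
Qed.

(** Tested against [delta_mx p j0], the convergence concerns the [p]-th column of
    the kernel and the single motion [j0]. Almost sure convergence of the
    integral process makes that column of [Hoo] square integrable; the isometry
    then turns mean square convergence into convergence of the column, and the
    columns add up to the kernel. *)
Lemma mean_square_necessity (Hoo : R -> 'M[R]_n) : (0 < d)%N ->
  continuous_half_line Hoo ->
  (forall f : R -> 'M[R]_(n, d), bounded_continuous_half_line f ->
     exists (X : R -> Omega -> 'cV[R]_n) (Y : Omega -> 'cV[R]_n),
       [/\ forall t : R, 0 <= t -> is_ito_integral B t (fun s _ => H t s *m f s) (X t),
           is_ito_integral_half_line B (fun s _ => Hoo s *m f s) Y &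
           (fun t => mean_square (X t) Y) @ +oo --> 0%E]) ->
  (\int[mu]_(s in `[0%R, +oo[) (frobenius (Hoo s) ^+ 2)%:E < +oo)%E /\
  (fun t : R => \int[mu]_(s in `[0%R, t]) (frobenius (H t s - Hoo s) ^+ 2)%:E)%E
    @ +oo --> 0%E.
Proof.
move=> d_gt0 cHoo h; pose j0 := Ordinal d_gt0.
have cHoo' := entries_continuous_extend cHoo.
have cst p : entries_continuous (fun=> delta_mx p j0 : 'M[R]_(n, d)).
  by move=> i j s; exact: cvg_cst.
have hp p : exists (X : R -> Omega -> 'cV[R]_n) (Y : Omega -> 'cV[R]_n),
    [/\ forall t : R, 0 <= t ->
          is_ito_integral B t (fun s _ => H t s *m delta_mx p j0) (X t),
        is_ito_integral_half_line B (fun s _ => Hoo s *m delta_mx p j0) Y &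
        (fun t => mean_square (X t) Y) @ +oo --> 0%E].
  apply: (h (fun=> delta_mx p j0)); split; first by apply: continuous_subspaceT => s; exact: cvg_cst.
  by exists (frobenius (delta_mx p j0 : 'M[R]_(n, d))).
pose Psi p s : 'M[R]_(n, d) := extend Hoo s *m delta_mx p j0.
have cPsi p : entries_continuous (Psi p) by exact: entries_continuous_mulmx.
have fin p i : (row_sqint (half_line (Psi p) i) < +oo)%E /\
    forall Y : Omega -> 'cV[R]_n,
    is_ito_integral_half_line B (fun s _ => Hoo s *m delta_mx p j0) Y ->
    ito_limit B (half_line (Psi p) i) (fun w => Y w i 0).
  have aux (Y : Omega -> 'cV[R]_n) :
      is_ito_integral_half_line B (fun s _ => Hoo s *m delta_mx p j0) Y ->
      exists M : nat -> Omega -> R,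
        [/\ forall k, ito_limit B (cut k%:R (Psi p) i) (M k),
            measurable_fun setT (fun w => Y w i 0) &
            {ae P, forall w, M ^~ w @ \oo --> Y w i 0}].
    move=> [mY [M [hM _ MY]]]; exists (fun k w => M k%:R w i 0); split; [|exact: mY|].
      move=> k; apply: (is_ito_integral_limit (cut_measurableW _ (cPsi p))).
      apply: is_ito_integral_ext (hM k%:R _) => // s /andP[s0 _].
      by rewrite /Psi extendE.
    apply: filterS MY => w cw.
    have cij : continuous (fun A : 'cV[R]_n => A i 0) by exact: coord_continuous.
    have c1 := cvg_comp _ _ cw (cij (Y w)).
    exact: (cvg_comp _ _ (@cvgr_idn R) c1).
  have fin : (row_sqint (half_line (Psi p) i) < +oo)%E.
    have [X [Y [_ hY _]]] := hp p; have [M [hM _ MY]] := aux Y hY.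
    apply: (ae_cvg_sqint_fin hB (cPsi p) _ hM MY (j0 := j0)) => s j jj0.
    by rewrite /Psi mulmx_delta_entry (negbTE jj0) mulr0.
  split=> // Y /aux[M [hM mY MY]]; exact: half_line_limit MY.
split.
  rewrite -frobenius_integral_extendE (frobenius_integral_columns j0)//.
  apply: lte_sum_pinfty => p _.
  rewrite (frobenius_integral_half_line (cPsi p)).
  apply: (@lte_sum_pinfty R _ _ _ (fun i => row_sqint (half_line (Psi p) i))) => i _.
  by have [] := fin p i.
apply: near_le_cvge0 => //.
  by move=> t; apply: integral_ge0 => s _; rewrite lee_fin sqr_ge0.
move=> eps eps0; have e1 : 0 < eps / n.+1%:R by rewrite divr_gt0.
have : \forall t \near +oo, forall p,
    (\int[mu]_(s in `[0%R, t])
       (frobenius ((H t (clamp t s) - extend Hoo s) *m delta_mx p j0 : 'M[R]_(n, d)) ^+ 2)%:E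
     <= (eps / n.+1%:R)%:E)%E.
  apply: filter_forall => p; have [X [Y [hX hY lim]]] := hp p.
  have ms := cvge0_near_lt _ lim e1.
  near=> t; have t0 : 0 <= t by near: t; exact: nbhs_pinfty_ge.
  apply: (@le_trans _ _ (mean_square (X t) Y)); last by apply: ltW; near: t; exact: ms.
  have cH := entries_continuous_clamp t0 hH.
  have hXt : is_ito_integral B t (fun s _ => H t (clamp t s) *m delta_mx p j0) (X t).
    by apply: is_ito_integral_ext (hX t t0) => s st; rewrite clampE.
  have hY' i : ito_limit B (half_line (Psi p) i) (fun w => Y w i 0).
    by have [_] := fin p i; exact.
  have := ito_dist_ge hB (entries_continuous_mulmx cH (cst p)) (cPsi p) hXt hY'.
  by under eq_integral do rewrite -mulmxBl.
apply: filterS2 (nbhs_pinfty_ge (num_real 0)) => t t0 ht.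
have cH := entries_continuous_clamp t0 hH.
rewrite -frobenius_integral_clampE (frobenius_integral_columns j0)//; last first.
  exact: entries_continuousB.
apply: (@le_trans _ _ (\sum_(p < n) (eps / n.+1%:R)%:E)%E); first exact: lee_sum.
rewrite sumEFin lee_fin sumr_const card_ord -[_ *+ n]mulr_natr.
by rewrite mulrAC ler_pdivrMr// ler_wpM2l ?ltW// ltr_nat.
Unshelve. all: by end_near. Qed.

End kernels.

Theorem theorem3 (R : realType) (d0 : measure_display)
    (Omega : measurableType d0) (P : probability Omega R)
    (n d : nat) (hn : (1 <= n)%N) (hd : (1 <= d)%N)
    (H : R -> R -> 'M[R]_n)
    (hH : {within @triangle R, continuous (fun p : R * R => H p.1 p.2)})
    (B : 'I_d -> R -> {RV P >-> R}) (hB : brownian_motion B) :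
  (exists Hoo : R -> 'M[R]_n,
     [/\ continuous_half_line Hoo,
         (\int[lebesgue_measure]_(s in `[0%R, +oo[)
            (frobenius (Hoo s) ^+ 2)%:E < +oo)%E &
         (fun t : R => \int[lebesgue_measure]_(s in `[0%R, t])
            (frobenius (H t s - Hoo s) ^+ 2)%:E)%E @ +oo --> 0%E])
  <->
  (exists Hoo : R -> 'M[R]_n,
     continuous_half_line Hoo /\
     forall f : R -> 'M[R]_(n, d), bounded_continuous_half_line f ->
       exists (X : R -> Omega -> 'cV[R]_n) (Y : Omega -> 'cV[R]_n),
         [/\ forall t : R, 0 <= t ->
               is_ito_integral B t (fun s _ => H t s *m f s) (X t),
             is_ito_integral_half_line B (fun s _ => Hoo s *m f s) Y &
             (fun t : R => 'E_P[fun w => (frobenius (X t w - Y w) ^+ 2)%R])%E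
               @ +oo --> 0%E]).
Proof.
split=> [[Hoo [cHoo fin lim]]|[Hoo [cHoo h]]]; exists Hoo.
  split; first exact: cHoo.
  by move=> f bf; exact: mean_square_convergence.
by have [fin lim] := mean_square_necessity hB hH hd cHoo h; split.
Qed.
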